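(* Let $\nu>0$ and let $u\in \mathcal C([0,\infty),\mathcal X^{-1}(\mathbb R^3))\cap L^1_{loc}([0,\infty),\mathcal X^{1}(\mathbb R^3))$ be a global solution of (NS) with viscosity $\nu$. Let $v^0\in\mathcal X^{-1}(\mathbb R^3)$ be divergence free and satisfy $$\|v^0-u(0)\|_{\mathcal X^{-1}}<\frac{\nu}{8}\exp\Big(-\frac{2}{\nu}\int_0^\infty\|\widehat u(s)\|_{L^1}^2\,ds\Big).$$ Then (NS) with initial datum $v^0$ has a global solution $v\in \mathcal C([0,\infty),\mathcal X^{-1})\cap L^1_{loc}([0,\infty),\mathcal X^{1})$, and for all $t\ge0$, $$\|v(t)-u(t)\|_{\mathcal X^{-1}}+\frac{\nu}{2}\int_0^t\|v(s)-u(s)\|_{\mathcal X^{1}}\,ds\le \|v^0-u(0)\|_{\mathcal X^{-1}}\exp\Big(\frac{2}{\nu}\int_0^\infty\|\widehat u(s)\|_{L^1}^2\,ds\Big).$$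
   Context: For $i\in\{-1,0,1\}$, $\mathcal X^{i}(\mathbb R^3)$ denotes the space of tempered distributions $f$ on $\mathbb R^3$ whose Fourier transform $\widehat f(\xi)=\int_{\mathbb R^3}e^{-ix\cdot\xi}f(x)\,dx$ is a locally integrable function with $\|f\|_{\mathcal X^{i}}:=\int_{\mathbb R^3}|\xi|^{i}|\widehat f(\xi)|\,d\xi<\infty$ (so $\|f\|_{\mathcal X^0}=\|\widehat f\|_{L^1}$). Vector fields are measured componentwise. The Navier–Stokes system (NS) with viscosity $\nu>0$ is: $\partial_t u-\nu\Delta u+(u\cdot\nabla)u=-\nabla p$, $\operatorname{div}u=0$ on $\mathbb R^+\times\mathbb R^3$, $u(0)=u^0$; a solution on $[0,T)$ is a divergence-free $u\in \mathcal C([0,T),\mathcal X^{-1})\cap L^1_{loc}([0,T),\mathcal X^{1})$ satisfying the equations in the sense of distributions (equivalently $\partial_t u-\nu\Delta u+\mathbb P\operatorname{div}(u\otimes u)=0$ with $\mathbb P$ the Leray projector) with $u(0)=u^0$; it is global if $T=\infty$. It is known (and may be used) that for every divergence-free $u^0\in\mathcal X^{-1}$ there is a unique maximal such solution on some $[0,T^* )$, $T^*>0$. *)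

(* Defs.v *)
From mathcomp Require Import all_boot all_algebra.
From mathcomp Require Import all_classical all_reals all_analysis.
From mathcomp Require Import complex.
Import GRing.Theory Num.Theory.

Set Implicit Arguments.
Unset Strict Implicit.
Unset Printing Implicit Defensive.

Local Open Scope classical_set_scope.
Local Open Scope ring_scope.
Local Open Scope complex_scope.

Section NSDefs.
Context {R : realType}.

Definition R3 := (R * R * R)%type.
Definition leb := (@lebesgue_measure R).
Definition leb3 := ((leb \x leb) \x leb)%E.

Definition coord (xi : R3) (k : 'I_3) : R :=
  match val k with 0 => xi.1.1 | 1 => xi.1.2 | _ => xi.2 end.
Definition sub3 (xi eta : R3) : R3 :=
  ((xi.1.1 - eta.1.1, xi.1.2 - eta.1.2), xi.2 - eta.2).
Definition norm3 (xi : R3) : R := Num.sqrt (\sum_(k < 3) coord xi k ^+ 2).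

Definition cmod (z : R[i]) : R := Num.sqrt (complex.Re z ^+ 2 + complex.Im z ^+ 2).

(* A (tempered-distribution) vector field on R^3 is represented by its
   Fourier transform  xi |-> (hat f_k(xi))_{k<3}, a C^3-valued function. *)
Definition Field := R3 -> 'I_3 -> R[i].
Definition fsub (f g : Field) : Field := fun xi k => f xi k - g xi k.

Definition Xnorm (i : int) (f : Field) : \bar R :=
  (\sum_(k < 3) \int[leb3]_xi ((norm3 xi ^ i) * cmod (f xi k))%:E)%E.

Definition InX (i : int) (f : Field) : Prop :=
  [/\ forall k, measurable_fun setT (fun xi => complex.Re (f xi k)) /\
                measurable_fun setT (fun xi => complex.Im (f xi k)),
      forall k (r : R), 0 < r ->
        (\int[leb3]_(xi in [set xi | (norm3 xi < r)%R]) (cmod (f xi k))%:E < +oo)%E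
    & (Xnorm i f < +oo)%E].

Definition divfree (f : Field) : Prop :=
  {ae leb3, forall xi, \sum_(k < 3) (coord xi k)%:C * f xi k = 0}.

Definition cint {d} {T : measurableType d} (mu : {measure set T -> \bar R})
    (D : set T) (g : T -> R[i]) : R[i] :=
  (Rintegral mu D (fun x => complex.Re (g x)))%:C
  + 'i * (Rintegral mu D (fun x => complex.Im (g x)))%:C.

(* Fourier-side convolution:  (hat (f g))(xi) = (2 pi)^-3 (hat f * hat g)(xi) *)
Definition conv (f g : R3 -> R[i]) (xi : R3) : R[i] :=
  cint leb3 setT (fun eta => f (sub3 xi eta) * g eta).

Definition leray (xi : R3) (k l : 'I_3) : R[i] :=
  ((k == l)%:R - coord xi k * coord xi l / norm3 xi ^+ 2)%:C.

(* Fourier transform of P div (w (x) w):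
   sum_l P_{kl}(xi) sum_j i xi_j (2pi)^-3 (hat w_j * hat w_l)(xi) *)
Definition NSnonlin (w : Field) (xi : R3) (k : 'I_3) : R[i] :=
  \sum_(l < 3) leray xi k l *
    \sum_(j < 3) ('i * (coord xi j)%:C * ((2 * pi) ^+ 3)^-1%:C *
                  conv (fun eta => w eta j) (fun eta => w eta l) xi).

(* u is a global solution of (NS) with viscosity nu and initial datum u0:
   u in C([0,oo), X^-1) /\ L^1_loc([0,oo), X^1), divergence free, and
   the Fourier transform of the equation  d_t u - nu Lap u + P div(u (x) u) = 0
   holds in time-integrated form. *)
Definition global_solution (nu : R) (u : R -> Field) (u0 : Field) : Prop :=
  [/\ forall t, 0 <= t -> InX (-1) (u t) /\ divfree (u t),
      forall t, 0 <= t -> forall e : R, 0 < e ->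
        exists2 dl : R, 0 < dl & forall s, 0 <= s -> `|s - t| < dl ->
          (Xnorm (-1) (fsub (u s) (u t)) < e%:E)%E,
      forall k, measurable_fun [set p : R * R3 | 0 <= p.1]
                  (fun p => complex.Re (u p.1 p.2 k)) /\
                measurable_fun [set p : R * R3 | 0 <= p.1]
                  (fun p => complex.Im (u p.1 p.2 k)),
      forall T, 0 <= T -> (\int[leb]_(s in `[0%R, T]) Xnorm 1 (u s) < +oo)%E
    &
      forall t, 0 <= t -> {ae leb3, forall xi, forall k,
        u t xi k = u0 xi k - cint leb `[0%R, t]
          (fun s => (nu * norm3 xi ^+ 2)%:C * u s xi k + NSnonlin (u s) xi k)}].

End NSDefs.

(* Main.v *)
(* The difference w = v - u solves, on the Fourier side, the Duhamel equation
   w(t) = e^(-nu |xi|^2 t) w0 - int_0^t e^(-nu |xi|^2 (t - s)) (N(u + w) - N(u))(s) ds,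
   where |N(u + w) - N(u)| is bounded by |xi| (W * W + U * W + W * U)/2 with U, W the
   moduli of u, w.  The nonnegative functions M_0 = 0, M_(n+1) = Duhamel(M_n) obtained by
   replacing every term by this bound increase with n.  By interpolation
   (int M)^2 <= (int M/|xi|) (int |xi| M) and Young's inequality, M_(n+1) satisfies the
   energy inequality A_(n+1)(t) + (nu/2) int_0^t D_(n+1) <= eps + (2/nu) int_0^t g A_n,
   where A = int M/|xi|, D = int |xi| M, g = (int U)^2, as long as A_n <= nu/8; hence
   A_n(t) + (nu/2) int_0^t D_n <= eps exp((2/nu) int g) for all n, by induction, and the limit
   M_oo inherits the bound.  The Picard iterates of w satisfy |w_(n+1) - w_n| + M_n <= M_(n+1)
   pointwise, so they converge to a solution with |w| <= M_oo; no contraction in a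
   function space is needed.  Continuity in time follows from the integrated equation, and
   w is divergence free because the Leray projector is. *)
From HB Require Import structures.
Require Import Defs.
From mathcomp Require Import all_boot all_order all_algebra.
From mathcomp Require Import all_classical all_reals all_analysis.
From mathcomp Require Import complex measurable_realfun.
From mathcomp Require Import ring lra.
Import GRing.Theory Num.Theory Order.TTheory.
Import numFieldNormedType.Exports.
Set Implicit Arguments.
Unset Strict Implicit.
Unset Printing Implicit Defensive.
Local Open Scope classical_set_scope.
Local Open Scope ring_scope.

(** * Time integrals and the Duhamel formula *)

(** Estimates are carried out on functions with values in [0,+oo], where Tonelli and monotone
    convergence ask for no integrability. Existence and a priori bound are thus decoupled: the
    majorants are defined before anything is known to be finite, the energy bound then makes their
    integrals finite, and only afterwards are complex integrals given a meaning, at almost every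
    frequency. Since +oo cannot be subtracted, comparisons are written additively: increment plus
    old majorant is at most new majorant. Constants: A <= nu/8 gives (1/2) (int M)^2 <= (nu/16) D,
    and the two cross terms give at most (nu/4) D + (1/nu) g A; both fit into (nu/2) D + (2/nu) g A.
    Of the dissipation nu D_(n+1), one half absorbs (nu/2) D_n, because D_n <= D_(n+1), and the
    other half is kept in the final estimate. The resulting inequality bounds A_(n+1) through A_n,
    so that partial sums of the exponential series take the place of Gronwall's lemma. *)

Section TimeIntegrals.
Context {R : realType}.
Local Open Scope ereal_scope.
Local Notation RT := (measurableTypeR R).
Local Notation lam := (@lebesgue_measure R).
Implicit Types (t s r : R).

Lemma measurable_decay d (X : measurableType d) (k a : X -> RT) :
  measurable_fun setT k -> measurable_fun setT a ->
  measurable_fun setT (fun x => (expR (- (k x * a x)))%:E : \bar R).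
Proof.
move=> mk ma; apply/measurable_EFinP; apply: measurableT_comp; first exact: measurable_expR.
by apply: measurable_funN; exact: measurable_funM.
Qed.

Lemma measurable_decayB (k t : R) :
  measurable_fun setT (fun s : RT => (expR (- (k * (t - s))))%:E : \bar R).
Proof. by apply: (@measurable_decay _ _ (cst k)) => //; exact: measurable_funB. Qed.

Lemma decay_le1 (k s : R) : (0 <= k -> 0 <= s -> expR (- (k * s)) <= 1)%R.
Proof. by move=> k0 s0; rewrite -[leRHS](@expR0 R) ler_expR oppr_le0 mulr_ge0. Qed.

Lemma integral_indic_mul d (T : measurableType d) (mu : {measure set T -> \bar R})
    (D : set T) (f : T -> \bar R) : measurable D ->
  \int[mu]_(x in D) f x = \int[mu]_x (f x * (\1_D x)%:E).
Proof.
move=> mD; rewrite integral_mkcond; apply: eq_integral => x _.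
rewrite patchE indicE; case: ifPn => _; by rewrite (mule1, mule0).
Qed.

Lemma measurable_band d (X : measurableType d) (a b : X -> R) :
  measurable_fun setT a -> measurable_fun setT b ->
  measurable [set p : X * RT | (a p.1 <= p.2 <= b p.1)%R].
Proof.
move=> ma mb.
have -> : [set p : X * RT | (a p.1 <= p.2 <= b p.1)%R] =
    (fun p : X * RT => p.2 - a p.1)%R @^-1` `[0%R, +oo[ `&`
    (fun p : X * RT => b p.1 - p.2)%R @^-1` `[0%R, +oo[.
  apply/seteqP; split => p /=; rewrite !in_itv/= !andbT !subr_ge0.
    by move/andP.
  by move=> [-> ->].
apply: measurableI; rewrite -[X in measurable X]setTI.
  apply: measurable_funB => //; exact: measurableT_comp ma _.
apply: measurable_funB => //; exact: measurableT_comp mb _.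
Qed.

(** Moving the variable limits into the indicator of a measurable band of the product turns this
    into the measurability of a Tonelli integral. *)
Lemma measurable_fun_band_integral d (X : measurableType d) (a b : X -> R)
    (f : X * RT -> \bar R) :
  measurable_fun setT a -> measurable_fun setT b ->
  measurable_fun setT f -> (forall p, 0 <= f p) ->
  measurable_fun setT (fun x => \int[lam]_(s in `[a x, b x]) f (x, s)).
Proof.
move=> ma mb mf f0.
pose B := [set p : X * RT | (a p.1 <= p.2 <= b p.1)%R].
pose h (p : X * R) := f p * (\1_B p)%:E.
have -> : (fun x => \int[lam]_(s in `[a x, b x]) f (x, s)) =
    fubini_F lam h.
  by apply/funext => x; rewrite /fubini_F [LHS]integral_indic_mul.
apply: measurable_fun_fubini_tonelli_F.
  apply: emeasurable_funM => //; apply/measurable_EFinP.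
  by apply: measurable_indic; exact: measurable_band.
by move=> p; apply: mule_ge0 => //; rewrite lee_fin.
Qed.

(** Tonelli on the triangle 0 <= r <= s <= t: both sides are iterated integrals of F times its
    indicator. *)
Lemma integral_triangle (F : RT * RT -> \bar R) t :
  measurable_fun setT F -> (forall p, 0 <= F p) ->
  \int[lam]_(s in `[0%R, t]) \int[lam]_(r in `[0%R, s]) F (s, r) =
  \int[lam]_(r in `[0%R, t]) \int[lam]_(s in `[r, t]) F (s, r).
Proof.
move=> mF F0.
pose B := [set p : RT * RT | (0 <= p.2 <= p.1)%R] `&` [set p | (p.1 <= t)%R].
have mB : measurable B.
  apply: measurableI; first exact: (@measurable_band _ _ (cst 0%R) id).
  rewrite -[X in measurable X]setTI -[X in _ `&` X]/(fst @^-1` [set s | (s <= t)%R]).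
  by apply: measurable_fst => //; rewrite -set_itvNyc.
pose h (p : RT * RT) := F p * (\1_B p)%:E.
transitivity (\int[lam]_s \int[lam]_r h (s, r)).
  rewrite integral_indic_mul//; apply: eq_integral => s _.
  rewrite integral_indic_mul// -ge0_integralZr//.
  - apply: eq_integral => r _; rewrite /h -muleA; congr (_ * _).
    rewrite -EFinM !indicE -natrM mulnb; congr ((nat_of_bool _)%:R%:E).
    rewrite !mem_setE !in_itv/=; apply/andP/idP.
      by rewrite inE => -[/andP[a b] /andP[c e]]; split => //=; apply/andP.
    rewrite inE => -[/= /andP[a b] c]; rewrite a b c/= andbT; split=> //.
    exact: le_trans a b.
  - apply: emeasurable_funM; first exact: measurableT_comp mF _.
    by apply/measurable_EFinP; exact: measurable_indic.
  - by move=> r _; apply: mule_ge0 => //; rewrite lee_fin.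
rewrite fubini_tonelli//.
- rewrite [RHS]integral_indic_mul//; apply: eq_integral => r _.
  rewrite [in RHS]integral_indic_mul// -ge0_integralZr//.
  - apply: eq_integral => s _; rewrite /h -muleA; congr (_ * _).
    rewrite -EFinM !indicE -natrM mulnb; congr ((nat_of_bool _)%:R%:E).
    rewrite !mem_setE !in_itv/=; apply/idP/andP.
      rewrite inE => -[/= /andP[a b] c]; rewrite a b c/=; split=> //.
      exact: le_trans b c.
    by rewrite inE => -[/andP[a b] /andP[c e]]; split => //=; apply/andP.
  - apply: emeasurable_funM; first exact: measurableT_comp mF _.
    by apply/measurable_EFinP; exact: measurable_indic.
  - by move=> s _; apply: mule_ge0 => //; rewrite lee_fin.
- by apply: emeasurable_funM => //; apply/measurable_EFinP; exact: measurable_indic.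
- by move=> p; apply: mule_ge0 => //; rewrite lee_fin.
Qed.

Lemma integral_split_itv (f : RT -> \bar R) (r t : R) :
  measurable_fun setT f -> (forall s, 0 <= f s) -> (0 <= r <= t)%R ->
  \int[lam]_(s in `[0%R, t]) f s =
  \int[lam]_(s in `[0%R, r]) f s + \int[lam]_(s in `[r, t]) f s.
Proof.
move=> mf f0 /andP[r0 rt].
rewrite -(@integral_itv_obnd_cbnd _ r); last exact: measurable_funTS.
rewrite -ge0_integral_setU//=; last 2 first.
- exact: measurable_funTS.
- apply/disj_setPS => x [/=]; rewrite !in_itv/= => /andP[_ a] /andP[b _].
  by have := lt_le_trans b a; rewrite ltxx.
by rewrite -itv_bndbnd_setU// bnd_simp.
Qed.

(** The square [0, t]^2 is cut along its diagonal into two triangles. This replaces the product rule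
    for primitives, which may be infinite here. *)
Lemma integral_by_parts_nneg (a b : RT -> \bar R) t :
  measurable_fun setT a -> (forall s, 0 <= a s) ->
  measurable_fun setT b -> (forall s, 0 <= b s) -> 
  \int[lam]_(s in `[0%R, t]) a s * \int[lam]_(s in `[0%R, t]) b s =
  \int[lam]_(s in `[0%R, t]) (a s * \int[lam]_(r in `[0%R, s]) b r) +
  \int[lam]_(s in `[0%R, t]) (b s * \int[lam]_(r in `[0%R, s]) a r).
Proof.
move=> ma a0 mb b0.
have -> : \int[lam]_(s in `[0%R, t]) (b s * \int[lam]_(r in `[0%R, s]) a r) =
    \int[lam]_(s in `[0%R, t]) (a s * \int[lam]_(r in `[s, t]) b r).
  transitivity (\int[lam]_(s in `[0%R, t]) \int[lam]_(r in `[0%R, s])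
      (a r * b s)).
    apply: eq_integral => s _; rewrite muleC ge0_integralZr//.
    exact: measurable_funTS.
  rewrite (@integral_triangle (fun p => a p.2 * b p.1))//.
  - apply: eq_integral => s _ /=; rewrite ge0_integralZl//.
    exact: measurable_funTS.
  - by apply: emeasurable_funM; exact: measurableT_comp.
  - by move=> p; apply: mule_ge0.
rewrite -ge0_integralD//.
- rewrite -ge0_integralZr//; last 2 first.
  + exact: measurable_funTS.
  + exact: integral_ge0.
  apply: eq_integral => s; rewrite inE/= in_itv/= => st.
  by rewrite -ge0_muleDr ?integral_ge0// -integral_split_itv.
- by move=> s _; apply: mule_ge0 => //; exact: integral_ge0.
- apply: measurable_funTS; apply: emeasurable_funM => //.
  apply: (@measurable_fun_band_integral _ _ (cst 0%R) id (b \o snd)) => //.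
    exact: measurableT_comp.
  by move=> p; exact: b0.
- by move=> s _; apply: mule_ge0 => //; exact: integral_ge0.
- apply: measurable_funTS; apply: emeasurable_funM => //.
  apply: (@measurable_fun_band_integral _ _ id (cst t) (b \o snd)) => //.
    exact: measurableT_comp.
  by move=> p; exact: b0.
Qed.

End TimeIntegrals.

Section Duhamel.
Context {R : realType}.
Local Open Scope ereal_scope.
Local Notation RT := (measurableTypeR R).
Local Notation lam := (@lebesgue_measure R).
Implicit Types (t s r k : R).

(** The integral of g(s_1) ... g(s_n) over the simplex s_n <= ... <= s_1 <= t, that is, (int g)^n /
    n!. With powers of 2/nu in front, these are the terms of the exponential in the energy bound. *)
Fixpoint iterated_integral (g : RT -> \bar R) (n : nat) (t : R) : \bar R :=
  if n is m.+1 then \int[lam]_(s in `[0%R, t]) (g s * iterated_integral g m s)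
  else 1.

Lemma iterated_integral_ge0 (g : RT -> \bar R) n t :
  (forall s, 0 <= g s) -> 0 <= iterated_integral g n t.
Proof.
move=> g0; elim: n t => //= n IH t.
by apply: integral_ge0 => s _; apply: mule_ge0.
Qed.

Lemma measurable_iterated_integral (g : RT -> \bar R) n :
  measurable_fun setT g -> (forall s, 0 <= g s) ->
  measurable_fun [set: RT] (iterated_integral g n).
Proof.
move=> mg g0; elim: n => [|n IH]; first exact: measurable_cst.
apply: (@measurable_fun_band_integral _ _ _ (cst 0%R) id
  ((fun s => g s * iterated_integral g n s) \o snd)) => //.
- by apply: measurableT_comp => //; apply: emeasurable_funM.
- by move=> p; apply: mule_ge0 => //; exact: iterated_integral_ge0.
Qed.

(** Induction on n: with G = int g and J_n the iterated integrals, [integral_by_parts_nneg] splits G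
    J_(n+1) into J_(n+2) and the integral of g G J_n, whose integrand is (n+1) g J_(n+1). The
    product form avoids division in [0,+oo]. *)
Lemma iterated_integralS (g : RT -> \bar R) n t :
  measurable_fun setT g -> (forall s, 0 <= g s) -> 
  n.+1%:R%:E * iterated_integral g n.+1 t =
  (\int[lam]_(s in `[0%R, t]) g s) * iterated_integral g n t.
Proof.
move=> mg g0; elim: n t => [|n IH] t.
  by rewrite mul1e /= mule1; apply: eq_integral => s _; rewrite mule1.
pose J := iterated_integral g.
have mJ m : measurable_fun [set: RT] (J m) by exact: measurable_iterated_integral.
have J0 m s : 0 <= J m s by exact: iterated_integral_ge0.
rewrite [X in _ * X]/= integral_by_parts_nneg//; last 2 first.
- by apply: emeasurable_funM => //; exact: mJ.
- by move=> s; apply: mule_ge0 => //; exact: J0.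
rewrite -[n.+2]addn1 natrD addrC EFinD ge0_muleDl ?lee_fin// mul1e; congr (_ + _).
rewrite -ge0_integralZl ?lee_fin//=.
- apply: eq_integral => s _.
  rewrite -muleA [X in _ = g s * X]muleC -IH.
  by rewrite muleCA.
- by apply: measurable_funTS; apply: emeasurable_funM => //; exact: (mJ n.+1).
- by move=> s _; apply: mule_ge0 => //; exact: (J0 n.+1).
Qed.

Lemma iterated_integral_le (g : RT -> \bar R) n t (G : R) :
  measurable_fun setT g -> (forall s, 0 <= g s) ->
  \int[lam]_(s in `[0%R, t]) g s <= G%:E ->
  iterated_integral g n t <= (G ^+ n / n`!%:R)%:E.
Proof.
move=> mg g0 gG; elim: n => [|n IH]; first by rewrite expr0 fact0 divr1.
have n0 : (0 < n.+1%:R :> R)%R by rewrite ltr0n.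
rewrite -(@lee_pmul2l _ (n.+1%:R%:E)) ?lte_fin// iterated_integralS//.
apply: (@le_trans _ _ (G%:E * (G ^+ n / n`!%:R)%:E)).
  apply: lee_pmul => //; first by apply: integral_ge0 => s _.
  exact: iterated_integral_ge0.
rewrite -!EFinM lee_fin factS natrM invfM exprS.
have f0 : (n`!%:R != 0 :> R)%R by rewrite pnatr_eq0 -lt0n fact_gt0.
move: (n.+1%:R)%R n0 => c c0; rewrite le_eqVlt; apply/orP; left; apply/eqP.
by field; rewrite f0 gt_eqF.
Qed.

Lemma sum_exp_coeff_le (x : R) n : (0 <= x)%R ->
  (\sum_(0 <= i < n) x ^+ i / i`!%:R <= expR x)%R.
Proof.
move=> x0; rewrite /expR.
have := @nondecreasing_cvgn_le _ (series (exp_coeff x)).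
apply => //.
  apply: nondecreasing_series => i _ _.
  by rewrite /exp_coeff/=; apply: divr_ge0; rewrite ?exprn_ge0.
exact: is_cvg_series_exp_coeff.
Qed.

Definition duhamel k (f : RT -> \bar R) (t : R) : \bar R :=
  \int[lam]_(s in `[0%R, t]) ((expR (- (k * (t - s))))%:E * f s).

Lemma duhamel_ge0 k f t : (forall s, 0 <= f s) -> 0 <= duhamel k f t.
Proof.
by move=> f0; apply: integral_ge0 => s _; apply: mule_ge0 => //; rewrite lee_fin expR_ge0.
Qed.

Lemma measurable_duhamel d (X : measurableType d) (k tau : X -> R)
    (f : X * RT -> \bar R) : measurable_fun setT k -> measurable_fun setT tau ->
  measurable_fun setT f -> (forall p, 0 <= f p) ->
  measurable_fun setT (fun x => duhamel (k x) (fun s => f (x, s)) (tau x)).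
Proof.
move=> mk mt mf f0.
apply: (@measurable_fun_band_integral _ _ _ (cst 0%R) tau
  (fun p => (expR (- (k p.1 * (tau p.1 - p.2))))%:E * f p)) => //.
- apply: emeasurable_funM => //; apply: measurable_decay; first exact: measurableT_comp.
  by apply: measurable_funB => //; exact: measurableT_comp mt _.
- by move=> p; apply: mule_ge0 => //; rewrite lee_fin expR_ge0.
Qed.

(** The factor k is kept on the left, so that k = 0, the zero frequency, is no separate case. *)
Lemma integral_exp_decay k r t : (0 <= k)%R -> (r <= t)%R ->
  k%:E * \int[lam]_(s in `[r, t]) (expR (- (k * (s - r))))%:E =
  (1 - expR (- (k * (t - r))))%:E.
Proof.
move=> k0; rewrite le_eqVlt => /predU1P[<-|rt].
  by rewrite subrr mulr0 oppr0 expR0 subrr set_itv1 integral_set1 mule0.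
have dlin s : is_derive s (1%R : R) (fun s => - (k * (s - r)))%R (- k)%R.
  have -> : (fun s => - (k * (s - r)))%R = ((- k) \*: (id - cst r))%R.
    by apply/funext => x /=; rewrite /GRing.scale/= mulNr.
  by apply: is_derive_eq; rewrite subr0 /GRing.scale/= mulr1.
have dF s : is_derive s (1%R : R) (fun s => - expR (- (k * (s - r))))%R
    (k * expR (- (k * (s - r))))%R.
  rewrite (_ : (fun _ => _) = - (expR \o (fun s => - (k * (s - r)))))%R//.
  apply: is_derive_eq.
  by rewrite /GRing.scale/= mulrN opprK mulrC.
have cexp : continuous (fun s => expR (- (k * (s - r))))%R.
  move=> s; apply: continuous_comp; last exact: continuous_expR.
  apply: differentiable_continuous; apply/derivable1_diffP.
  exact: (@ex_derive _ _ _ _ _ _ _ (dlin s)).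
rewrite -ge0_integralZl_EFin//; last first.
  apply/measurable_EFinP; apply: measurable_funTS.
  exact: continuous_measurable_fun.
under eq_integral do rewrite -EFinM.
rewrite (@continuous_FTC2 _ _ (fun s => - expR (- (k * (s - r))))%R)//.
- by rewrite subrr mulr0 oppr0 expR0 -EFinB opprK addrC.
- apply: continuous_subspaceT => s; apply: cvgM; [exact: cvg_cst|exact: cexp].
- split.
  + by move=> s _; exact: (@ex_derive _ _ _ _ _ _ _ (dF s)).
  + by apply/cvg_at_right_filter; apply: cvgN; exact: cexp.
  + by apply/cvg_at_left_filter; apply: cvgN; exact: cexp.
- by move=> s _; rewrite derive1E; apply: derive_val.
Qed.

(** Integrated form of y' + k y = f, y(0) = b, for y given by the Duhamel formula; written with sums
    only, it makes sense in [0,+oo]. Exchanging the two time integrals leaves the integral of an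
    exponential inside. *)
Lemma duhamel_identity k (b : \bar R) (f : RT -> \bar R) t :
  (0 <= k)%R -> (0 <= t)%R -> 0 <= b ->
  measurable_fun setT f -> (forall s, 0 <= f s) ->
  ((expR (- (k * t)))%:E * b + duhamel k f t) +
  k%:E * \int[lam]_(s in `[0%R, t]) ((expR (- (k * s)))%:E * b + duhamel k f s) =
  b + \int[lam]_(s in `[0%R, t]) f s.
Proof.
move=> k0 t0 b0 mf f0.
have e0 s : 0 <= (expR s)%:E :> \bar R by rewrite lee_fin expR_ge0.
have me : measurable_fun [set: RT] (fun s => (expR (- (k * s)))%:E : \bar R).
  exact: (@measurable_decay _ _ _ (cst k)).
have mdiff : measurable_fun [set: RT * RT] (fun p => (expR (- (k * (p.1 - p.2))))%:E : \bar R).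
  by apply: (@measurable_decay _ _ _ (cst k)) => //; exact: measurable_funB.
have md : measurable_fun [set: RT] (duhamel k f).
  apply: (@measurable_duhamel _ _ (cst k) id (f \o snd)) => //.
    exact: measurableT_comp.
  by move=> p; exact: f0.
have I1 : k%:E * \int[lam]_(s in `[0%R, t]) ((expR (- (k * s)))%:E * b) =
    (1 - expR (- (k * t)))%:E * b.
  rewrite ge0_integralZr//; last exact: measurable_funTS.
  rewrite muleA; congr (_ * _); rewrite -[t in RHS]subr0 -integral_exp_decay//.
  by under [in RHS]eq_integral do rewrite subr0.
have I2 : k%:E * \int[lam]_(s in `[0%R, t]) duhamel k f s =
    \int[lam]_(r in `[0%R, t]) ((1 - expR (- (k * (t - r))))%:E * f r).
  rewrite /duhamel (@integral_triangle _ (fun p => (expR (- (k * (p.1 - p.2))))%:E * f p.2)).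
  - rewrite -ge0_integralZl//=.
    + apply: eq_integral => r; rewrite inE/= in_itv/= => /andP[_ rt].
      rewrite ge0_integralZr//; last first.
        apply: measurable_funTS; apply: (@measurable_decay _ _ _ (cst k)) => //.
        exact: measurable_funB.
      by rewrite muleA integral_exp_decay.
    + apply: measurable_funTS.
      apply: (@measurable_fun_band_integral _ _ _ id (cst t)
        (fun p => (expR (- (k * (p.2 - p.1))))%:E * f p.1)) => //.
      * apply: emeasurable_funM; last exact: measurableT_comp.
        exact: (measurableT_comp mdiff (@measurable_swap _ _ _ _)).
      * by move=> p; apply: mule_ge0.
    + by move=> r _; apply: integral_ge0 => s _; apply: mule_ge0.
  - by apply: emeasurable_funM => //; exact: measurableT_comp.
  - by move=> p; apply: mule_ge0.
rewrite ge0_integralD//; last 4 first.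
- by move=> s _; apply: mule_ge0.
- by apply: measurable_funTS; exact: emeasurable_funM.
- by move=> s _; exact: duhamel_ge0.
- exact: measurable_funTS.
rewrite ge0_muleDr//; last 2 first.
- by apply: integral_ge0 => s _; apply: mule_ge0.
- by apply: integral_ge0 => s _; exact: duhamel_ge0.
have h s : (0 <= s)%R -> (0 <= 1 - expR (- (k * s)))%R.
  by move=> s0; rewrite subr_ge0 decay_le1.
(* The terms in b and the terms in f balance separately, each time because e^(-x) + (1 - e^(-x)) =
   1. *)
rewrite I1 I2 addeACA; congr (_ + _).
  rewrite -ge0_muleDl// ?lee_fin ?h//.
  by rewrite -EFinD addrC subrK mul1e.
rewrite /duhamel -ge0_integralD//; last 4 first.
- by move=> s _; apply: mule_ge0.
- apply: measurable_funTS; apply: emeasurable_funM => //; exact: measurable_decayB.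
- move=> s; rewrite /= in_itv/= => /andP[_ st].
  by apply: mule_ge0 => //; rewrite lee_fin h// subr_ge0.
- apply: measurable_funTS; apply: emeasurable_funM => //.
  apply/measurable_EFinP; apply: measurable_funB => //.
  apply/measurable_EFinP; exact: measurable_decayB.
apply: eq_integral => s; rewrite inE/= in_itv/= => /andP[_ st].
rewrite -ge0_muleDl// ?lee_fin ?h ?subr_ge0//.
by rewrite -EFinD addrC subrK mul1e.
Qed.

End Duhamel.

(** * Monotone limits and Young's inequality in [0,+oo] *)

Section NonnegativeExtended.
Context {R : realType}.
Local Open Scope ereal_scope.

(** The product is discontinuous at 0 times +oo. Monotonicity helps: a zero limit forces its whole
    sequence to vanish. *)
Lemma nondecreasing_cvgeM (a b : (\bar R)^nat) (la lb : \bar R) :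
  (forall n, 0 <= a n) -> (forall n, 0 <= b n) ->
  nondecreasing_seq a -> nondecreasing_seq b ->
  a @ \oo --> la -> b @ \oo --> lb -> (a n * b n) @[n --> \oo] --> la * lb.
Proof.
move=> a0 b0 nda ndb ala blb.
have lea n : a n <= la.
  apply: (cvge_to_ge ala); near=> m; apply: nda; near: m; exact: nbhs_infty_ge.
have leb n : b n <= lb.
  apply: (cvge_to_ge blb); near=> m; apply: ndb; near: m; exact: nbhs_infty_ge.
have la0 : 0 <= la by exact: le_trans (lea 0%N).
have lb0 : 0 <= lb by exact: le_trans (leb 0%N).
have [la_eq|lan0] := eqVneq la 0.
  rewrite la_eq mul0e (_ : (fun n => _) = cst 0) ?cvg_cst//.
    exact: cvg_cst.
  apply/funext => n; suff -> : a n = 0 by rewrite mul0e.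
  by apply/eqP; rewrite eq_le a0 -la_eq lea.
have [lb_eq|lbn0] := eqVneq lb 0.
  rewrite lb_eq mule0 (_ : (fun n => _) = cst 0).
    exact: cvg_cst.
  apply/funext => n; suff -> : b n = 0 by rewrite mule0.
  by apply/eqP; rewrite eq_le b0 -lb_eq leb.
apply: cvgeM => //; move: lan0 lbn0; clear.
by case: la => [x||]; case: lb => [y||].
Unshelve. all: by end_near. Qed.

Lemma ge0_monotone_cvg d (T : measurableType d) (mu : {measure set T -> \bar R})
    (D : set T) (f : (T -> \bar R)^nat) (g : T -> \bar R) : measurable D ->
  (forall n, measurable_fun D (f n)) -> (forall n x, D x -> 0 <= f n x) ->
  (forall x, D x -> nondecreasing_seq (f ^~ x)) ->
  (forall x, D x -> f n x @[n --> \oo] --> g x) ->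
  \int[mu]_(x in D) f n x @[n --> \oo] --> \int[mu]_(x in D) g x.
Proof.
move=> mD mf f0 nd fg.
rewrite (_ : \int[mu]_(x in D) g x = \int[mu]_(x in D) limn (f ^~ x)).
  by apply: cvg_monotone_convergence => // x Dx n m nm; exact: nd.
apply: eq_integral => x; rewrite inE => Dx.
by apply/esym/cvg_lim => //; exact: fg.
Qed.

(** The infimum over a > 0 of the bound on z is the square root of A X; for z, A > 0 it is enough to
    test a = z / A instead of the minimiser. *)
Lemma mean_square_le (z A X : R) : (0 <= z)%R -> (0 <= A)%R -> (0 <= X)%R ->
  (forall a : R, 0 < a -> z <= a / 2 * A + (2 * a)^-1 * X)%R -> (z * z <= A * X)%R.
Proof.
move=> z0 A0 X0 h.
move: z0; rewrite le_eqVlt => /predU1P[<-|z0]; first by rewrite mulr0 mulr_ge0.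
move: A0; rewrite le_eqVlt => /predU1P[Ae|A0].
  (* For A = 0 and z > 0 this a is so large that the bound reads z <= X z / (2 (X + z)) <= z / 2, a
     contradiction. *)
  have := h ((X + z) / z)%R; rewrite divr_gt0//; last by lra.
  move=> /(_ isT); rewrite -Ae mulr0 add0r mul0r => hz.
  have : (z <= X * z / (2 * (X + z)))%R.
    apply: (le_trans hz); rewrite le_eqVlt; apply/orP; left; apply/eqP.
    have xz0 : (X + z != 0)%R by rewrite gt_eqF//; lra.
    have z1 : (z != 0)%R by rewrite gt_eqF.
    by field; rewrite ?xz0 ?z1.
  rewrite ler_pdivlMr; last lra.
  nra.
have := h (z / A)%R; rewrite divr_gt0// => /(_ isT).
rewrite (_ : z / A / 2 * A + (2 * (z / A))^-1 * X = (z * z + A * X) / (2 * z))%R.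
  by rewrite ler_pdivlMr; [nra|lra].
by field; rewrite !gt_eqF.
Qed.

(** In the application z and U are the masses of M and u, while A and X are the low and high norms
    of M. Then z^2 / 2 <= A X / 2 <= (nu/16) X, and the interpolation bound with a = 2 U / nu gives
    U z <= U^2 A / nu + (nu/4) X. *)
Lemma young_quadratic (nu : R) (z A X U : \bar R) : (0 < nu)%R ->
  0 <= z -> 0 <= A -> 0 <= X -> 0 <= U -> A <= (nu / 8)%:E ->
  (forall a : R, (0 < a)%R -> z <= (a / 2)%:E * A + ((2 * a)^-1)%:E * X) ->
  2^-1%:E * (z * z + U * z + z * U) <=
    (nu / 2)%:E * X + (2 / nu)%:E * (U * U * A).
Proof.
move=> nu0 z0 A0 X0 U0 Anu h.
have Afin : A \is a fin_num by rewrite ge0_fin_numE// (le_lt_trans Anu) ?ltry.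
have nu2 : (0 < nu / 2)%R by lra.
have nu2' : (0 < 2 / nu)%R by rewrite divr_gt0.
case: X X0 h => [X|_ _|//]; last first.
  rewrite gt0_muley ?lte_fin// addye ?leey//.
  have : 0 <= (2 / nu)%:E * (U * U * A) by rewrite !mule_ge0// lee_fin ltW.
  by case: (_ * _).
case: A A0 Anu Afin => [A||]//; rewrite !lee_fin => A0 Anu _ X0 h.
have zfin : z \is a fin_num.
  rewrite ge0_fin_numE//; apply: (le_lt_trans (h 1%R _)) => //.
  by rewrite -!EFinM -EFinD ltry.
case: z z0 zfin h => [z||]//; rewrite lee_fin => z0 _ h.
have hr (a : R) : (0 < a -> z <= a / 2 * A + (2 * a)^-1 * X)%R.
  by move=> a0; have := h a a0; rewrite -!EFinM -EFinD lee_fin.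
have zz := mean_square_le z0 A0 X0 hr.
have AX : (A * X <= nu / 8 * X)%R by exact: ler_wpM2r.
case: U U0 => [U||]//.
  rewrite lee_fin => U0; rewrite -?EFinM -?EFinD -?EFinM -?EFinD lee_fin.
  move: U0; rewrite le_eqVlt => /predU1P[<-|U0].
    rewrite !mul0r !mulr0 !addr0; nra.
  have := hr (2 * U / nu)%R; rewrite divr_gt0 ?mulr_gt0// => /(_ isT) hU.
  have hUz : (U * z <= (U * U * A) / nu + nu / 4 * X)%R.
    apply: (@le_trans _ _ (U * (2 * U / nu / 2 * A + (2 * (2 * U / nu))^-1 * X)))%R.
      by rewrite ler_pM2l.
    rewrite le_eqVlt; apply/orP; left; apply/eqP.
    by field; rewrite !gt_eqF.
  have : (0 <= (U * U * A) / nu)%R by rewrite divr_ge0// ?mulr_ge0// ltW.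
  rewrite (_ : 2 / nu * (U * U * A) = 2 * ((U * U * A) / nu))%R; last by ring.
  nra.
(* Now U = +oo: either A = 0, and then z = 0 removes the cross terms, or the right-hand side is
   infinite. *)
move=> _; move: A0; rewrite le_eqVlt => /predU1P[Ae|A0].
  have -> : z = 0%R.
    have : (z * z <= 0)%R by rewrite (le_trans zz)// -Ae mul0r.
    nra.
  rewrite -Ae !mule0 !mul0e !adde0 mule0 -EFinM lee_fin.
  by apply: mulr_ge0 => //; exact: ltW.
have -> : (2 / nu)%:E * (+oo * +oo * A%:E) = +oo.
  by rewrite mulyy gt0_mulye ?lte_fin// gt0_muley ?lte_fin.
by rewrite -EFinM addey ?leey.
Qed.

End NonnegativeExtended.

(** * The majorant iteration *)

Section Majorant.
Context {R : realType} {d} {T : measurableType d}.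
Local Open Scope ereal_scope.
Local Notation RT := (measurableTypeR R).
Local Notation lam := (@lebesgue_measure R).
Context (mu : {sigma_finite_measure set T -> \bar R}).
Context (sub : T -> T -> T) (rho : T -> R).
Hypothesis msub : measurable_fun [set: T * T] (fun p => sub p.1 p.2).
Hypothesis integral_sub : forall (f : T -> \bar R) y,
  measurable_fun setT f -> (forall x, 0 <= f x) ->
  \int[mu]_x f (sub x y) = \int[mu]_x f x.
Hypothesis mrho : measurable_fun setT rho.
Hypothesis rho_ge0 : forall x, (0 <= rho x)%R.
Hypothesis rho_ae : {ae mu, forall x, (0 < rho x)%R}.

Implicit Types f g u m : T -> \bar R.

(** In the application T is the frequency space R^3, [sub] the difference of frequencies and [rho]
    the Euclidean length. *)
Definition econv (f g : T -> \bar R) (x : T) := \int[mu]_y (f (sub x y) * g y).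

Definition jmeas (M : RT -> T -> \bar R) :=
  measurable_fun [set: RT * T] (fun p => M p.1 p.2).

Lemma jmeas_section (M : RT -> T -> \bar R) t : jmeas M -> measurable_fun setT (M t).
Proof. by move=> mM; exact: (measurableT_comp mM (measurable_pair1 t)). Qed.

Lemma jmeas_sectionr (M : RT -> T -> \bar R) x :
  jmeas M -> measurable_fun [set: RT] (M ^~ x).
Proof. by move=> mM; exact: (measurableT_comp mM (measurable_pair2 x)). Qed.

Lemma econv_ge0 f g x : (forall y, 0 <= f y) -> (forall y, 0 <= g y) ->
  0 <= econv f g x.
Proof. by move=> f0 g0; apply: integral_ge0 => y _; exact: mule_ge0. Qed.

Lemma jmeas_econv (F G : RT -> T -> \bar R) :
  jmeas F -> jmeas G -> (forall s x, 0 <= F s x) -> (forall s x, 0 <= G s x) ->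
  jmeas (fun s x => econv (F s) (G s) x).
Proof.
move=> mF mG F0 G0.
apply: (@measurable_fun_fubini_tonelli_F _ _ _ _ _ mu
  (fun q : (RT * T) * T => F q.1.1 (sub q.1.2 q.2) * G q.1.1 q.2)).
- have m1 : measurable_fun [set: (RT * T) * T] (fun q => q.1.1).
    exact: (measurableT_comp measurable_fst measurable_fst).
  have m2 : measurable_fun [set: (RT * T) * T] (fun q => q.1.2).
    exact: (measurableT_comp measurable_snd measurable_fst).
  have m3 : measurable_fun [set: (RT * T) * T] (fun q => q.2).
    exact: measurable_snd.
  apply: emeasurable_funM.
    have ms := measurableT_comp msub (measurable_fun_pair m2 m3).
    exact: (measurableT_comp mF (measurable_fun_pair m1 ms)).
  exact: (measurableT_comp mG (measurable_fun_pair m1 m3)).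
- by move=> q; exact: mule_ge0.
Qed.

Lemma measurable_econv_integrand f g x : measurable_fun setT f -> measurable_fun setT g ->
  measurable_fun setT (fun y => f (sub x y) * g y).
Proof.
move=> mf mg; apply: emeasurable_funM => //; apply: measurableT_comp => //.
exact: (measurableT_comp msub (measurable_pair1 x)).
Qed.

Lemma le_econv (f g f' g' : T -> \bar R) x :
  measurable_fun setT f -> measurable_fun setT g ->
  measurable_fun setT f' -> measurable_fun setT g' ->
  (forall y, 0 <= f y) -> (forall y, 0 <= g y) ->
  (forall y, f y <= f' y) -> (forall y, g y <= g' y) ->
  econv f g x <= econv f' g' x.
Proof.
move=> mf mg mf' mg' f0 g0 ff gg; apply: ge0_le_integral => //.
- by move=> y _; exact: mule_ge0.
- exact: measurable_econv_integrand.
- exact: measurable_econv_integrand.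
- by move=> y _; exact: lee_pmul.
Qed.

(** Tonelli, then translation invariance in the inner integral. *)
Lemma integral_econv f g : measurable_fun setT f -> measurable_fun setT g ->
  (forall y, 0 <= f y) -> (forall y, 0 <= g y) ->
  \int[mu]_x econv f g x = \int[mu]_x f x * \int[mu]_x g x.
Proof.
move=> mf mg f0 g0; rewrite /econv.
rewrite (@fubini_tonelli _ _ _ _ _ mu mu (fun p => f (sub p.1 p.2) * g p.2)).
- under eq_integral => y _.
    rewrite /= ge0_integralZr//; last first.
      apply: measurableT_comp => //; exact: (measurableT_comp msub (measurable_pair2 y)).
    rewrite integral_sub//.
    over.
  by rewrite ge0_integralZl// integral_ge0.
- by apply: emeasurable_funM; apply: measurableT_comp.
- by move=> p; exact: mule_ge0.
Qed.

(* The convolution square of [u + m] minus that of [u]. *)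
Definition equad (u m : T -> \bar R) x := econv m m x + econv u m x + econv m u x.

Lemma equad_ge0 u m x : (forall y, 0 <= u y) -> (forall y, 0 <= m y) ->
  0 <= equad u m x.
Proof. by move=> u0 m0; apply: adde_ge0; [apply: adde_ge0|]; apply: econv_ge0. Qed.

Lemma le_equad u m m' x : measurable_fun setT u ->
  measurable_fun setT m -> measurable_fun setT m' ->
  (forall y, 0 <= u y) -> (forall y, 0 <= m y) -> (forall y, m y <= m' y) ->
  equad u m x <= equad u m' x.
Proof.
by move=> mu' mm mm' u0 m0 mm0; apply: leeD; [apply: leeD|]; apply: le_econv.
Qed.

Lemma integral_equad u m : measurable_fun setT u -> measurable_fun setT m ->
  (forall y, 0 <= u y) -> (forall y, 0 <= m y) ->
  \int[mu]_x equad u m x =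
  \int[mu]_x m x * \int[mu]_x m x + \int[mu]_x u x * \int[mu]_x m x +
  \int[mu]_x m x * \int[mu]_x u x.
Proof.
move=> mu' mm u0 m0; rewrite /equad.
have mc f g : measurable_fun setT f -> measurable_fun setT g ->
  (forall y, 0 <= f y) -> (forall y, 0 <= g y) -> measurable_fun setT (econv f g).
  move=> mf mg f0 g0; have := @jmeas_econv (fun=> f) (fun=> g).
  move=> /(_ _ _ (fun _ => f0) (fun _ => g0)) h.
  apply: (jmeas_section 0%R (h _ _)); exact: measurableT_comp.
rewrite ge0_integralD//; last 4 first.
- by move=> x _; rewrite adde_ge0// econv_ge0.
- by apply: emeasurable_funD; apply: mc.
- by move=> x _; rewrite econv_ge0.
- exact: mc.
rewrite ge0_integralD//; last 4 first.
- by move=> x _; rewrite econv_ge0.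
- exact: mc.
- by move=> x _; rewrite econv_ge0.
- exact: mc.
by rewrite !integral_econv.
Qed.

Lemma mrhoV : measurable_fun setT (fun x => (rho x)^-1)%R.
Proof.
rewrite (_ : (fun _ => _) = fun x => rho x `^ (-1))%R.
  have mp : measurable_fun [set: RT] ((fun z : R => z `^ (-1))%R : RT -> RT).
    exact: measurable_powR.
  exact: (measurableT_comp mp mrho).
by apply/funext => x; rewrite powR_inv1.
Qed.

(** Pointwise 1 <= (a / rho + rho / a) / 2 wherever rho > 0. The parameter a stays free, since its
    best value depends on norms that may still be 0 or infinite. *)
Lemma integral_interpolation m (a : R) : (0 < a)%R ->
  measurable_fun setT m -> (forall y, 0 <= m y) ->
  \int[mu]_x m x <= (a / 2)%:E * \int[mu]_x ((rho x)^-1%:E * m x) +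
                   ((2 * a)^-1)%:E * \int[mu]_x ((rho x)%:E * m x).
Proof.
move=> a0 mm m0.
have mri : measurable_fun setT (fun x => (rho x)^-1%:E * m x).
  apply: emeasurable_funM => //; apply/measurable_EFinP.
  exact: mrhoV.
have mr : measurable_fun setT (fun x => (rho x)%:E * m x).
  by apply: emeasurable_funM => //; apply/measurable_EFinP.
have p1 x : 0 <= (rho x)^-1%:E * m x by rewrite mule_ge0// lee_fin invr_ge0.
have p2 x : 0 <= (rho x)%:E * m x by rewrite mule_ge0// lee_fin.
have a2 : (0 <= a / 2)%R by rewrite divr_ge0// ltW.
have a20 : (0 <= 2 * a)%R by rewrite mulr_ge0// ltW.
have a2' : (0 <= (2 * a)^-1)%R by rewrite invr_ge0 mulr_ge0// ltW.
rewrite -!ge0_integralZl// -ge0_integralD//; last 4 first.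
- by move=> x _; rewrite mule_ge0// lee_fin.
- exact: measurable_funeM.
- by move=> x _; rewrite mule_ge0// lee_fin.
- exact: measurable_funeM.
apply: ae_ge0_le_integral => //.
- by move=> x _; rewrite adde_ge0// mule_ge0// lee_fin.
- by apply: emeasurable_funD; exact: measurable_funeM.
apply: filterS rho_ae => x rx _.
rewrite !muleA -ge0_muleDl ?mule_ge0 ?lee_fin ?invr_ge0//.
rewrite -!EFinM -EFinD -[leLHS]mul1e lee_wpmul2r// lee_fin.
have r1 : (0 < (rho x)^-1)%R by rewrite invr_gt0.
rewrite -subr_ge0.
have -> : (a / 2 * (rho x)^-1 + (2 * a)^-1 * rho x - 1 =
  (a - rho x) ^+ 2 * (2 * a)^-1 * (rho x)^-1)%R.
  by field; rewrite !gt_eqF.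
by apply: mulr_ge0; [apply: mulr_ge0; [exact: sqr_ge0|]|exact: ltW].
Qed.

Context (nu : R) (U : RT -> T -> \bar R) (b : T -> \bar R).
Hypothesis nu_gt0 : (0 < nu)%R.
Hypothesis mU : jmeas U.
Hypothesis U_ge0 : forall s x, 0 <= U s x.
Hypothesis mb : measurable_fun setT b.
Hypothesis b_ge0 : forall x, 0 <= b x.
Implicit Types M : RT -> T -> \bar R.

(* The constant [2^-1] has room for the factor 2 lost in [cmod_cint_le] and for
   the sums over components, since [(2 * pi) ^- 3] is small. *)
Definition forcing M (s : R) (x : T) : \bar R := (2^-1 * rho x)%:E * equad (U s) (M s) x.

Definition picard M (t : RT) (x : T) : \bar R :=
  (expR (- (nu * rho x ^+ 2 * t)))%:E * b x +
  duhamel (nu * rho x ^+ 2) (forcing M ^~ x) t.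

Definition nonneg M := forall s x, 0 <= M s x.

Lemma half_rho_ge0 x : 0 <= (2^-1 * rho x)%:E.
Proof. by rewrite lee_fin mulr_ge0// invr_ge0. Qed.

Lemma kappa_ge0 x : (0 <= nu * rho x ^+ 2)%R.
Proof. by rewrite mulr_ge0 ?sqr_ge0// ltW. Qed.

Lemma equad_jmeas M : jmeas M -> nonneg M -> jmeas (fun s x => equad (U s) (M s) x).
Proof.
move=> mM M0; apply: emeasurable_funD; last exact: jmeas_econv.
by apply: emeasurable_funD; exact: jmeas_econv.
Qed.

Lemma forcing_jmeas M : jmeas M -> nonneg M -> jmeas (forcing M).
Proof.
move=> mM M0; apply: emeasurable_funM; last exact: equad_jmeas.
apply/measurable_EFinP; apply: measurable_funM => //.
exact: (measurableT_comp mrho measurable_snd).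
Qed.

Lemma forcing_ge0 M : nonneg M -> nonneg (forcing M).
Proof. by move=> M0 s x; rewrite mule_ge0 ?half_rho_ge0// equad_ge0. Qed.

Lemma picard_ge0 M : nonneg M -> nonneg (picard M).
Proof.
move=> M0 s x; apply: adde_ge0; first by rewrite mule_ge0// lee_fin expR_ge0.
by apply: duhamel_ge0 => r; exact: forcing_ge0.
Qed.

Lemma picard_jmeas M : jmeas M -> nonneg M -> jmeas (picard M).
Proof.
move=> mM M0.
have mk : measurable_fun [set: RT * T] (fun p => nu * rho p.2 ^+ 2)%R.
  apply: measurable_funM => //; apply: measurable_funX.
  exact: (measurableT_comp mrho measurable_snd).
apply: emeasurable_funD.
  apply: emeasurable_funM; last exact: (measurableT_comp mb measurable_snd).
  by apply: measurable_decay => //; exact: measurable_fst.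
apply: (@measurable_duhamel _ _ _ (fun p => nu * rho p.2 ^+ 2)%R fst
  (fun q : (RT * T) * RT => forcing M q.2 q.1.2)) => //.
  have m2 : measurable_fun [set: (RT * T) * RT] (fun q => q.1.2).
    exact: (measurableT_comp measurable_snd measurable_fst).
  exact: (measurableT_comp (forcing_jmeas mM M0)
    (measurable_fun_pair (@measurable_snd _ _ _ _) m2)).
by move=> q; exact: forcing_ge0.
Qed.

Lemma le_forcing M M' s x : jmeas M -> nonneg M -> jmeas M' ->
  (forall y, M s y <= M' s y) -> forcing M s x <= forcing M' s x.
Proof.
move=> mM M0 mM' MM; apply: lee_wpmul2l; first exact: half_rho_ge0.
by apply: le_equad => //; exact: jmeas_section.
Qed.

Lemma le_picard M M' t x : jmeas M -> nonneg M -> jmeas M' ->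
  (forall s y, M s y <= M' s y) -> picard M t x <= picard M' t x.
Proof.
move=> mM M0 mM' MM; apply: leeD => //.
have M'0 : nonneg M' by move=> s y; exact: le_trans (MM s y).
have me (f : RT -> \bar R) : measurable_fun setT f -> measurable_fun `[0%R, t]
    (fun s => (expR (- (nu * rho x ^+ 2 * (t - s))))%:E * f s).
  move=> mf; apply: measurable_funTS; apply: emeasurable_funM => //.
  exact: measurable_decayB.
apply: ge0_le_integral => //.
- by move=> s _; rewrite mule_ge0 ?lee_fin ?expR_ge0// forcing_ge0.
- by apply: me; apply: jmeas_sectionr; exact: forcing_jmeas.
- by apply: me; apply: jmeas_sectionr; exact: forcing_jmeas.
- move=> s _; apply: lee_wpmul2l; first by rewrite lee_fin expR_ge0.
  exact: le_forcing.
Qed.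

Definition mass M s := \int[mu]_x M s x.
Definition lownorm M s := \int[mu]_x ((rho x)^-1%:E * M s x).
Definition highnorm M s := \int[mu]_x ((rho x)%:E * M s x).
Definition usq s := mass U s * mass U s.

Lemma lownorm_integrand_jmeas M : jmeas M -> jmeas (fun s x => (rho x)^-1%:E * M s x).
Proof.
move=> mM; apply: emeasurable_funM => //; apply/measurable_EFinP.
exact: (measurableT_comp mrhoV measurable_snd).
Qed.

Lemma highnorm_integrand_jmeas M : jmeas M -> jmeas (fun s x => (rho x)%:E * M s x).
Proof.
move=> mM; apply: emeasurable_funM => //; apply/measurable_EFinP.
exact: (measurableT_comp mrho measurable_snd).
Qed.

Lemma rhoV_ge0 x : 0 <= (rho x)^-1%:E.
Proof. by rewrite lee_fin invr_ge0. Qed.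

Lemma rhoE_ge0 x : 0 <= (rho x)%:E.
Proof. by rewrite lee_fin. Qed.

Lemma mass_ge0 M s : nonneg M -> 0 <= mass M s.
Proof. by move=> M0; apply: integral_ge0. Qed.

Lemma lownorm_ge0 M s : nonneg M -> 0 <= lownorm M s.
Proof. by move=> M0; apply: integral_ge0 => x _; rewrite mule_ge0 ?rhoV_ge0. Qed.

Lemma highnorm_ge0 M s : nonneg M -> 0 <= highnorm M s.
Proof. by move=> M0; apply: integral_ge0 => x _; rewrite mule_ge0 ?rhoE_ge0. Qed.

Lemma measurable_mass M : jmeas M -> nonneg M -> measurable_fun [set: RT] (mass M).
Proof.
by move=> mM M0; apply: (@measurable_fun_fubini_tonelli_F _ _ _ _ _ mu
  (fun p : RT * T => M p.1 p.2)).
Qed.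

Lemma measurable_lownorm M : jmeas M -> nonneg M -> measurable_fun [set: RT] (lownorm M).
Proof.
move=> mM M0; apply: (@measurable_mass (fun s x => (rho x)^-1%:E * M s x)).
  exact: lownorm_integrand_jmeas.
by move=> s x; rewrite mule_ge0 ?rhoV_ge0.
Qed.

Lemma measurable_highnorm M : jmeas M -> nonneg M -> measurable_fun [set: RT] (highnorm M).
Proof.
move=> mM M0; apply: (@measurable_mass (fun s x => (rho x)%:E * M s x)).
  exact: highnorm_integrand_jmeas.
by move=> s x; rewrite mule_ge0 ?rhoE_ge0.
Qed.

Lemma mass_equad M s : jmeas M -> nonneg M ->
  \int[mu]_x equad (U s) (M s) x =
  mass M s * mass M s + mass U s * mass M s + mass M s * mass U s.
Proof. by move=> mM M0; apply: integral_equad => //; exact: jmeas_section. Qed.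

Lemma integral_time_swap M r t : jmeas M -> nonneg M ->
  \int[mu]_x \int[lam]_(s in `[r, t]) M s x =
  \int[lam]_(s in `[r, t]) \int[mu]_x M s x.
Proof.
move=> mM M0.
pose h (p : RT * T) := M p.1 p.2 * (\1_`[r, t] p.1)%:E.
have i0 s : 0 <= (\1_`[r, t] s : R)%:E by rewrite lee_fin.
have mi : measurable_fun [set: RT] (fun s => (\1_`[r, t] s)%:E : \bar R).
  by apply/measurable_EFinP; exact: measurable_indic.
transitivity (\int[mu]_x \int[lam]_s h (s, x)).
  by apply: eq_integral => x _; rewrite [LHS]integral_indic_mul.
rewrite -(@fubini_tonelli _ _ _ _ _ lam mu h).
- rewrite [RHS]integral_indic_mul//; apply: eq_integral => s _.
  by rewrite /h/= ge0_integralZr//; exact: jmeas_section.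
- by apply: emeasurable_funM => //; exact: (measurableT_comp mi measurable_fst).
- by move=> p; exact: mule_ge0.
Qed.

Lemma ge0_le_integral_comb (P H B Q : T -> \bar R) (k l : R) :
  (0 <= k)%R -> (0 <= l)%R ->
  measurable_fun setT P -> measurable_fun setT H ->
  measurable_fun setT B -> measurable_fun setT Q ->
  (forall x, 0 <= P x) -> (forall x, 0 <= H x) ->
  (forall x, 0 <= B x) -> (forall x, 0 <= Q x) ->
  (forall x, P x + k%:E * H x <= B x + l%:E * Q x) ->
  \int[mu]_x P x + k%:E * \int[mu]_x H x <=
  \int[mu]_x B x + l%:E * \int[mu]_x Q x.
Proof.
move=> k0 l0 mP mH mB mQ P0 H0 B0 Q0 h.
have kH0 x : 0 <= k%:E * H x by apply: mule_ge0; rewrite ?lee_fin.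
have lQ0 x : 0 <= l%:E * Q x by apply: mule_ge0; rewrite ?lee_fin.
have mkH : measurable_fun setT (fun x => k%:E * H x) by exact: measurable_funeM.
have mlQ : measurable_fun setT (fun x => l%:E * Q x) by exact: measurable_funeM.
rewrite -!ge0_integralZl// -!ge0_integralD//.
apply: ge0_le_integral => //; try exact: emeasurable_funD.
by move=> x _; exact: adde_ge0.
Qed.

(** [duhamel_identity] with k = nu rho^2 is divided by rho, which turns k into nu rho and the weight
    rho / 2 of the forcing into 1/2, and is then integrated over frequencies. *)
Lemma picard_energy M t : jmeas M -> nonneg M -> (0 <= t)%R ->
  lownorm (picard M) t + nu%:E * \int[lam]_(s in `[0%R, t]) highnorm (picard M) s <=
  \int[mu]_x ((rho x)^-1%:E * b x) +
  2^-1%:E * \int[lam]_(s in `[0%R, t])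
    (mass M s * mass M s + mass U s * mass M s + mass M s * mass U s).
Proof.
move=> mM M0 t0.
have mP := picard_jmeas mM M0.
have P0 := picard_ge0 M0.
have nu0 : (0 <= nu)%R by exact: ltW.
have half0 : (0 <= 2^-1 :> R)%R by rewrite invr_ge0.
have mq := equad_jmeas mM M0.
have q0 : nonneg (fun s x => equad (U s) (M s) x) by move=> s x; exact: equad_ge0.
have mint N : jmeas N -> nonneg N ->
    measurable_fun setT (fun x => \int[lam]_(s in `[0%R, t]) N s x).
  move=> mN N0; apply: (@measurable_fun_band_integral _ _ _ (cst 0%R) (cst t)
    (fun p : T * RT => N p.2 p.1)) => //.
  exact: (measurableT_comp mN (@measurable_swap _ _ _ _)).
have int0 N x : nonneg N -> 0 <= \int[lam]_(s in `[0%R, t]) N s x.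
  by move=> N0; apply: integral_ge0 => s _; exact: N0.
have mhigh := highnorm_integrand_jmeas mP.
have high0 : nonneg (fun s x => (rho x)%:E * picard M s x).
  by move=> s x; rewrite mule_ge0 ?rhoE_ge0.
have mlow : measurable_fun setT (fun x => (rho x)^-1%:E * b x).
  by apply: emeasurable_funM => //; apply/measurable_EFinP; exact: mrhoV.
rewrite -(@integral_time_swap (fun s x => (rho x)%:E * picard M s x))//.
have -> : \int[lam]_(s in `[0%R, t])
    (mass M s * mass M s + mass U s * mass M s + mass M s * mass U s) =
    \int[lam]_(s in `[0%R, t]) \int[mu]_x equad (U s) (M s) x.
  by apply: eq_integral => s _; rewrite mass_equad.
rewrite -(integral_time_swap _ _ mq q0).
apply: ge0_le_integral_comb => //.
- exact: jmeas_section (lownorm_integrand_jmeas mP).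
- exact: (mint _ mhigh high0).
- exact: (mint _ mq q0).
- by move=> x; rewrite mule_ge0 ?rhoV_ge0.
- by move=> x; exact: (int0 _ _ high0).
- by move=> x; rewrite mule_ge0 ?rhoV_ge0.
- by move=> x; exact: (int0 _ _ q0).
move=> x.
have -> : (rho x)^-1%:E * picard M t x +
    nu%:E * \int[lam]_(s in `[0%R, t]) ((rho x)%:E * picard M s x) =
    (rho x)^-1%:E * (b x + \int[lam]_(s in `[0%R, t]) forcing M s x).
  rewrite -(@duhamel_identity _ (nu * rho x ^+ 2))//; last 3 first.
  - exact: kappa_ge0.
  - exact: jmeas_sectionr (forcing_jmeas mM M0).
  - by move=> s; exact: forcing_ge0.
  rewrite -[X in _ = _ * (X + _)]/(picard M t x) [RHS]ge0_muleDr; last 2 first.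
  - exact: P0.
  - by apply: mule_ge0; [rewrite lee_fin kappa_ge0|exact: (int0 _ _ P0)].
  congr (_ + _); rewrite ge0_integralZl//; last 2 first.
  - by apply: measurable_funTS; exact: jmeas_sectionr.
  - exact: rhoE_ge0.
  rewrite !muleA -!EFinM; congr (_%:E * _).
  (* At rho x = 0 both coefficients vanish, because 0^-1 = 0. *)
  have [->|r0] := eqVneq (rho x) 0%R; first by rewrite invr0; ring.
  by field.
rewrite ge0_muleDr//; last exact: (int0 _ _ (forcing_ge0 M0)).
apply: leeD => //.
rewrite /forcing ge0_integralZl ?half_rho_ge0//; last first.
  by apply: measurable_funTS; exact: (jmeas_sectionr x mq).
rewrite muleA -EFinM; apply: lee_wpmul2r; first exact: (int0 _ _ q0).
(* The product of 1 / rho and rho / 2 is 1/2, except at rho x = 0, where it is 0; hence only an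
   inequality. *)
rewrite lee_fin; have [->|r0] := eqVneq (rho x) 0%R.
  by rewrite mulr0 mulr0.
by rewrite mulrCA mulVf// mulr1.
Qed.

Lemma forcing_young M t : jmeas M -> nonneg M ->
  (forall s, (0 <= s <= t)%R -> lownorm M s <= (nu / 8)%:E) ->
  2^-1%:E * \int[lam]_(s in `[0%R, t])
    (mass M s * mass M s + mass U s * mass M s + mass M s * mass U s) <=
  (nu / 2)%:E * \int[lam]_(s in `[0%R, t]) highnorm M s +
  (2 / nu)%:E * \int[lam]_(s in `[0%R, t]) (usq s * lownorm M s).
Proof.
move=> mM M0 low.
have half0 : (0 <= 2^-1 :> R)%R by rewrite invr_ge0.
have nu2 : (0 <= nu / 2)%R by rewrite divr_ge0// ltW.
have nu2' : (0 <= 2 / nu)%R by rewrite divr_ge0// ltW.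
have z0 s : 0 <= mass M s by exact: mass_ge0.
have u0 s : 0 <= mass U s by exact: mass_ge0.
have A0 s : 0 <= lownorm M s by exact: lownorm_ge0.
have X0 s : 0 <= highnorm M s by exact: highnorm_ge0.
have mz := measurable_mass mM M0.
have mu0 := measurable_mass mU U_ge0.
have mA := measurable_lownorm mM M0.
have mX := measurable_highnorm mM M0.
have uA0 s : 0 <= usq s * lownorm M s by rewrite !mule_ge0.
have muA : measurable_fun [set: RT] (fun s => usq s * lownorm M s).
  by apply: emeasurable_funM => //; exact: emeasurable_funM.
have mq : measurable_fun [set: RT] (fun s =>
    mass M s * mass M s + mass U s * mass M s + mass M s * mass U s).
  by apply: emeasurable_funD; [apply: emeasurable_funD|]; exact: emeasurable_funM.
have q0 s : 0 <= mass M s * mass M s + mass U s * mass M s + mass M s * mass U s.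
  by rewrite !adde_ge0// mule_ge0.
rewrite -!ge0_integralZl//; last 3 first.
- exact: measurable_funTS.
- exact: measurable_funTS.
- exact: measurable_funTS.
rewrite -ge0_integralD//; last 4 first.
- by move=> s _; rewrite mule_ge0// lee_fin.
- by apply: measurable_funeM; exact: measurable_funTS.
- by move=> s _; rewrite mule_ge0// lee_fin.
- by apply: measurable_funeM; exact: measurable_funTS.
apply: ge0_le_integral => //.
- by move=> s _; rewrite mule_ge0// lee_fin.
- by apply: measurable_funeM; exact: measurable_funTS.
- by apply: measurable_funTS; apply: emeasurable_funD; exact: measurable_funeM.
move=> s; rewrite /= in_itv/= => st.
apply: young_quadratic => //; first exact: low.
move=> a a0; apply: integral_interpolation => //; exact: jmeas_section.
Qed.

Context (eps Ginf : R).
Hypothesis eps_def : \int[mu]_x ((rho x)^-1%:E * b x) = eps%:E.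
Hypothesis usq_le : forall t, \int[lam]_(s in `[0%R, t]) usq s <= Ginf%:E.
Hypothesis small : (eps * expR (2 / nu * Ginf) < nu / 8)%R.

Fixpoint majorant n : RT -> T -> \bar R :=
  if n is m.+1 then picard (majorant m) else fun _ _ => 0.

Lemma majorant_props n : nonneg (majorant n) /\ jmeas (majorant n).
Proof.
elim: n => [|n [n0 nm]]; first by split=> //; exact: measurable_cst.
by split; [exact: picard_ge0|exact: picard_jmeas].
Qed.

Lemma majorant_ge0 n : nonneg (majorant n). Proof. by case: (majorant_props n). Qed.

Lemma jmeas_majorant n : jmeas (majorant n). Proof. by case: (majorant_props n). Qed.

Lemma majorantS n t x : majorant n t x <= majorant n.+1 t x.
Proof.
elim: n t x => [|n IH] t x; first exact: (majorant_ge0 1).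
by apply: le_picard => //; [exact: jmeas_majorant|exact: majorant_ge0|
  exact: (jmeas_majorant n.+1)].
Qed.

Lemma majorant_nd t x : nondecreasing_seq (fun n => majorant n t x).
Proof. by apply/nondecreasing_seqP => n; exact: majorantS. Qed.

Lemma usq_ge0 s : 0 <= usq s.
Proof. by apply: mule_ge0; exact: mass_ge0. Qed.

Lemma measurable_usq : measurable_fun [set: RT] usq.
Proof. by apply: emeasurable_funM; exact: measurable_mass. Qed.

Lemma eps_ge0 : (0 <= eps)%R.
Proof.
rewrite -lee_fin -eps_def; apply: integral_ge0 => x _.
by rewrite mule_ge0 ?rhoV_ge0.
Qed.

Lemma Ginf_ge0 : (0 <= Ginf)%R.
Proof.
rewrite -lee_fin; apply: le_trans (usq_le 0%R).
by apply: integral_ge0 => s _; exact: usq_ge0.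
Qed.

Definition energy M t :=
  lownorm M t + (nu / 2)%:E * \int[lam]_(s in `[0%R, t]) highnorm M s.

Lemma energy_highnorm_fin M t c : nonneg M -> energy M t <= c%:E ->
  \int[lam]_(s in `[0%R, t]) highnorm M s < +oo.
Proof.
move=> M0 Mc; rewrite ltey; apply/eqP => oo; move: Mc.
rewrite /energy oo gt0_muley ?lte_fin ?divr_gt0// addey ?leye_eq// gt_eqF//.
by apply: lt_le_trans (ltNyr 0%R) _; exact: lownorm_ge0.
Qed.

(** Partial sums of exp((2/nu) int usq), with the powers written as iterated integrals. In this form
    they satisfy with equality ([exp_partialS]) the recursion that the energies of the majorants
    satisfy as an inequality. *)
Definition exp_partial n t :=
  \sum_(i < n) ((2 / nu) ^+ i)%:E * iterated_integral usq i t.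

Lemma two_div_nu_ge0 : (0 <= 2 / nu)%R.
Proof. by rewrite divr_ge0// ltW. Qed.

Lemma exp_partial_le n t : exp_partial n t <= (expR (2 / nu * Ginf))%:E.
Proof.
apply: (@le_trans _ _ (\sum_(i < n) ((2 / nu * Ginf) ^+ i / i`!%:R)%:E)).
  apply: lee_sum => i _; rewrite [((2 / nu * Ginf) ^+ i)%R]exprMn -mulrA EFinM.
  apply: lee_wpmul2l; first by rewrite lee_fin exprn_ge0// two_div_nu_ge0.
  by apply: iterated_integral_le; [exact: measurable_usq|exact: usq_ge0|].
rewrite sumEFin lee_fin.
have := @sum_exp_coeff_le R (2 / nu * Ginf) n.
rewrite big_mkord; apply.
by rewrite mulr_ge0 ?two_div_nu_ge0 ?Ginf_ge0.
Qed.

Lemma exp_partial_ge0 n t : 0 <= exp_partial n t.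
Proof.
apply: sume_ge0 => i _; rewrite mule_ge0// ?lee_fin ?exprn_ge0 ?two_div_nu_ge0//.
by apply: iterated_integral_ge0; exact: usq_ge0.
Qed.

Lemma measurable_exp_partial n : measurable_fun [set: RT] (exp_partial n).
Proof.
apply: emeasurable_fun_sum => i; apply: measurable_funeM.
by apply: measurable_iterated_integral; [exact: measurable_usq|exact: usq_ge0].
Qed.

Lemma exp_partialS n t : exp_partial n.+1 t =
  1 + (2 / nu)%:E * \int[lam]_(s in `[0%R, t]) (usq s * exp_partial n s).
Proof.
rewrite /exp_partial big_ord_recl expr0 mule1; congr (_ + _).
have mi i : measurable_fun [set: RT] (fun s => usq s * iterated_integral usq i s).
  apply: emeasurable_funM; first exact: measurable_usq.
  by apply: measurable_iterated_integral; [exact: measurable_usq|exact: usq_ge0].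
have i0 i s : 0 <= usq s * iterated_integral usq i s.
  by rewrite mule_ge0 ?usq_ge0//; apply: iterated_integral_ge0; exact: usq_ge0.
have l0 i : 0 <= ((2 / nu) ^+ i)%:E by rewrite lee_fin exprn_ge0// two_div_nu_ge0.
transitivity ((2 / nu)%:E * \int[lam]_(s in `[0%R, t])
    \sum_(i < n) (((2 / nu) ^+ i)%:E * (usq s * iterated_integral usq i s))).
  rewrite ge0_integral_sum//; last 2 first.
  - by move=> i; apply: measurable_funTS; exact: measurable_funeM.
  - by move=> i s _; exact: mule_ge0.
  rewrite ge0_sume_distrr; last first.
    by move=> i _; apply: integral_ge0 => s _; exact: mule_ge0.
  apply: eq_bigr => i _; rewrite ge0_integralZl//; last exact: measurable_funTS.
  by rewrite muleA -EFinM -exprS.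
congr (_ * _); apply: eq_integral => s _.
rewrite ge0_sume_distrr; last first.
  by move=> i _; rewrite mule_ge0//; apply: iterated_integral_ge0; exact: usq_ge0.
by apply: eq_bigr => i _; rewrite muleCA.
Qed.

(** Induction on n, for all times at once. Through [small], the bound at n implies the condition low
    norm <= nu/8 under which the quadratic terms of the next step can be estimated; smallness thus
    propagates without a continuity argument in time. *)
Lemma majorant_energy n t : (0 <= t)%R ->
  energy (majorant n) t <= eps%:E * exp_partial n t.
Proof.
elim: n t => [|n IH] t t0.
  rewrite /exp_partial big_ord0 mule0 /energy /lownorm /highnorm.
  rewrite integral0_eq; last by move=> x _; rewrite mule0.
  rewrite integral0_eq ?mule0 ?adde0// => s _.
  by rewrite integral0_eq// => x _; rewrite mule0.
have M0 := @majorant_ge0 n.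
have mM := jmeas_majorant n.
have lowK s : (0 <= s)%R -> energy (majorant n) s <= (nu / 8)%:E.
  move=> s0; apply: (le_trans (IH s s0)).
  apply: (@le_trans _ _ (eps%:E * (expR (2 / nu * Ginf))%:E)).
    by apply: lee_wpmul2l; [rewrite lee_fin eps_ge0|exact: exp_partial_le].
  by rewrite -EFinM lee_fin ltW.
have nu2 : (0 <= nu / 2)%R by rewrite divr_ge0// ltW.
have D0 N s : nonneg N -> 0 <= (nu / 2)%:E * \int[lam]_(r in `[0%R, s]) highnorm N r.
  move=> N0; rewrite mule_ge0 ?lee_fin//; apply: integral_ge0 => r _.
  exact: highnorm_ge0.
have low s : (0 <= s <= t)%R -> lownorm (majorant n) s <= (nu / 8)%:E.
  by move=> /andP[s0 _]; apply: le_trans (lowK s s0); rewrite /energy; apply: leeDl; exact: D0.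
have En := picard_energy mM M0 t0.
have Yo := forcing_young mM M0 low.
have {En Yo} := le_trans En (leeD (lexx _) Yo).
rewrite eps_def -/(majorant n.+1) => En.
set DN := (nu / 2)%:E * \int[lam]_(s in `[0%R, t]) highnorm (majorant n) s in En.
(* [DN] is what Young's inequality takes from the dissipation of step n. It is at most half the
   dissipation of step n+1, and its finiteness, known by induction, is what permits cancelling
   it. *)
have DNfin : DN \is a fin_num.
  rewrite ge0_fin_numE ?D0//; apply: le_lt_trans (ltry (nu / 8)).
  by apply: le_trans (lowK t t0); rewrite leeDr// lownorm_ge0.
have mS := jmeas_majorant n.+1.
have S0 := @majorant_ge0 n.+1.
have DNS : DN <= (nu / 2)%:E * \int[lam]_(s in `[0%R, t]) highnorm (majorant n.+1) s.
  apply: lee_wpmul2l; first by rewrite lee_fin.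
  apply: ge0_le_integral => //.
  - by move=> s _; exact: highnorm_ge0.
  - by apply: measurable_funTS; exact: measurable_highnorm.
  - by apply: measurable_funTS; exact: measurable_highnorm.
  move=> s _; apply: ge0_le_integral => //.
  - by move=> x _; rewrite mule_ge0 ?rhoE_ge0.
  - exact: jmeas_section (highnorm_integrand_jmeas mM).
  - exact: jmeas_section (highnorm_integrand_jmeas mS).
  - by move=> x _; apply: lee_wpmul2l; [exact: rhoE_ge0|exact: majorantS].
rewrite -(leeD2rE _ _ DNfin).
apply: (@le_trans _ _ (lownorm (majorant n.+1) t +
    nu%:E * \int[lam]_(s in `[0%R, t]) highnorm (majorant n.+1) s)).
  rewrite /energy -addeA leeD2l//.
  apply: le_trans (leeD2l _ DNS) _.
  rewrite -ge0_muleDl ?lee_fin// -EFinD.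
  by rewrite (_ : nu / 2 + nu / 2 = nu)%R//; lra.
apply: (le_trans En).
rewrite addeCA [leRHS]addeC leeD2l//.
rewrite exp_partialS.
set Y := \int[lam]_(s in `[0%R, t]) (usq s * exp_partial n s).
have Y0 : 0 <= Y.
  apply: integral_ge0 => s _.
  by apply: mule_ge0; [exact: usq_ge0|exact: exp_partial_ge0].
have -> : eps%:E * (1 + (2 / nu)%:E * Y) = eps%:E + (2 / nu)%:E * (eps%:E * Y).
  rewrite ge0_muleDr ?mule1//; first by rewrite muleCA.
  by apply: mule_ge0 => //; rewrite lee_fin two_div_nu_ge0.
rewrite leeD2l//; apply: lee_wpmul2l; first by rewrite lee_fin two_div_nu_ge0.
rewrite /Y.
have mue : measurable_fun [set: RT] (fun s => usq s * exp_partial n s).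
  by apply: emeasurable_funM; [exact: measurable_usq|exact: measurable_exp_partial].
have ue0 s : 0 <= usq s * exp_partial n s by rewrite mule_ge0 ?usq_ge0 ?exp_partial_ge0.
rewrite -ge0_integralZl//; last 2 first.
- exact: measurable_funTS.
- by rewrite lee_fin eps_ge0.
apply: ge0_le_integral => //.
- by move=> s _; rewrite mule_ge0 ?usq_ge0// lownorm_ge0.
- apply: measurable_funTS; apply: emeasurable_funM; first exact: measurable_usq.
  exact: measurable_lownorm.
- by apply: measurable_funTS; exact: measurable_funeM.
move=> s; rewrite /= in_itv/= => /andP[s0 _].
rewrite muleCA; apply: lee_wpmul2l; first exact: usq_ge0.
by apply: le_trans (IH s s0); rewrite /energy; apply: leeDl; exact: D0.
Qed.

Definition Kbound := (eps * expR (2 / nu * Ginf))%R.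

Lemma majorant_energy_le n t : (0 <= t)%R -> energy (majorant n) t <= Kbound%:E.
Proof.
move=> t0; apply: (le_trans (majorant_energy n t0)).
by rewrite EFinM lee_wpmul2l ?exp_partial_le// lee_fin eps_ge0.
Qed.

Definition majlim t x := limn (fun n => majorant n t x).

Lemma majlim_cvg t x : majorant n t x @[n --> \oo] --> majlim t x.
Proof. exact/ereal_nondecreasing_is_cvgn/majorant_nd. Qed.

Lemma majorant_le_majlim n t x : majorant n t x <= majlim t x.
Proof.
apply: (cvge_to_ge (@majlim_cvg t x)); near=> m; apply: majorant_nd.
by near: m; exact: nbhs_infty_ge.
Unshelve. all: by end_near. Qed.

Lemma majlim_ge0 : nonneg majlim.
Proof. by move=> t x; apply: le_trans (majorant_le_majlim 0 t x). Qed.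

Lemma jmeas_majlim : jmeas majlim.
Proof.
apply: (@emeasurable_fun_cvg _ _ _ _ (fun n (p : RT * T) => majorant n p.1 p.2)).
  by move=> n; exact: jmeas_majorant.
by move=> p _; exact: majlim_cvg.
Qed.

Lemma scaled_majorant_cvg (k : R) t x : (0 <= k)%R ->
  nondecreasing_seq (fun n => k%:E * majorant n t x) /\
  (k%:E * majorant n t x) @[n --> \oo] --> k%:E * majlim t x.
Proof.
move=> k0; split; last by apply: cvgeZl => //; exact: majlim_cvg.
by move=> n m nm; apply: lee_wpmul2l; [rewrite lee_fin|exact: majorant_nd].
Qed.

Lemma lownorm_majorant_cvg t :
  lownorm (majorant n) t @[n --> \oo] --> lownorm majlim t.
Proof.
apply: ge0_monotone_cvg => //.
- by move=> n; exact: jmeas_section (lownorm_integrand_jmeas (jmeas_majorant n)).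
- by move=> n x _; rewrite mule_ge0 ?rhoV_ge0 ?majorant_ge0.
- by move=> x _; apply: (proj1 (scaled_majorant_cvg _ _ _)); rewrite invr_ge0.
- by move=> x _; apply: (proj2 (scaled_majorant_cvg _ _ _)); rewrite invr_ge0.
Qed.

Lemma highnorm_majorant_nd t : nondecreasing_seq (fun n => highnorm (majorant n) t).
Proof.
move=> n m nm; apply: ge0_le_integral => //.
- by move=> x _; rewrite mule_ge0 ?rhoE_ge0 ?majorant_ge0.
- exact: jmeas_section (highnorm_integrand_jmeas (jmeas_majorant n)).
- exact: jmeas_section (highnorm_integrand_jmeas (jmeas_majorant m)).
- by move=> x _; apply: (proj1 (scaled_majorant_cvg _ _ _)) => //.
Qed.

Lemma highnorm_majorant_cvg t :
  highnorm (majorant n) t @[n --> \oo] --> highnorm majlim t.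
Proof.
apply: ge0_monotone_cvg => //.
- by move=> n; exact: jmeas_section (highnorm_integrand_jmeas (jmeas_majorant n)).
- by move=> n x _; rewrite mule_ge0 ?rhoE_ge0 ?majorant_ge0.
- by move=> x _; apply: (proj1 (scaled_majorant_cvg _ _ _)).
- by move=> x _; apply: (proj2 (scaled_majorant_cvg _ _ _)).
Qed.

Lemma majlim_energy_le t : (0 <= t)%R -> energy majlim t <= Kbound%:E.
Proof.
move=> t0.
have h : energy (majorant n) t @[n --> \oo] --> energy majlim t.
  apply: cvgeD.
  - apply: ge0_adde_def; rewrite inE; first exact: lownorm_ge0 majlim_ge0.
    apply: mule_ge0; first by rewrite lee_fin divr_ge0// ltW.
    by apply: integral_ge0 => s _; exact: highnorm_ge0 majlim_ge0.
  - exact: lownorm_majorant_cvg.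
  - apply: cvgeZl => //; apply: ge0_monotone_cvg => //.
    + move=> n; apply: measurable_funTS; apply: measurable_highnorm.
        exact: jmeas_majorant.
      exact: majorant_ge0.
    + by move=> n s _; apply: highnorm_ge0; exact: majorant_ge0.
    + by move=> s _; exact: highnorm_majorant_nd.
    + by move=> s _; exact: highnorm_majorant_cvg.
apply: (cvge_to_le h); near=> n; exact: majorant_energy_le.
Unshelve. all: by end_near. Qed.

Lemma econv_cvg (F G : nat -> T -> \bar R) (f g : T -> \bar R) x :
  (forall n, measurable_fun setT (F n)) -> (forall n, measurable_fun setT (G n)) ->
  (forall n y, 0 <= F n y) -> (forall n y, 0 <= G n y) ->
  (forall y, nondecreasing_seq (F ^~ y)) -> (forall y, nondecreasing_seq (G ^~ y)) ->
  (forall y, F n y @[n --> \oo] --> f y) -> (forall y, G n y @[n --> \oo] --> g y) ->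
  econv (F n) (G n) x @[n --> \oo] --> econv f g x.
Proof.
move=> mF mG F0 G0 ndF ndG cF cG; apply: ge0_monotone_cvg => //.
- by move=> n; exact: measurable_econv_integrand.
- by move=> n y _; exact: mule_ge0.
- by move=> y _ n m nm; apply: lee_pmul => //; [exact: ndF|exact: ndG].
- by move=> y _; exact: nondecreasing_cvgeM.
Qed.

Lemma equad_majorant_cvg s x :
  equad (U s) (majorant n s) x @[n --> \oo] --> equad (U s) (majlim s) x.
Proof.
have mm n : measurable_fun setT (majorant n s) by exact: jmeas_section (jmeas_majorant n).
have m0 n y : 0 <= majorant n s y by exact: majorant_ge0.
have mu' : measurable_fun setT (U s) by exact: jmeas_section.
have c1 : econv (majorant n s) (majorant n s) x @[n --> \oo] --> econv (majlim s) (majlim s) x.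
  by apply: econv_cvg => // y; by [exact: majorant_nd|exact: majlim_cvg].
have c2 : econv (U s) (majorant n s) x @[n --> \oo] --> econv (U s) (majlim s) x.
  apply: (@econv_cvg (fun=> U s) (fun n => majorant n s)) => // y;
  by [exact: majorant_nd|exact: majlim_cvg|exact: cvg_cst|move=> *; exact: lexx].
have c3 : econv (majorant n s) (U s) x @[n --> \oo] --> econv (majlim s) (U s) x.
  apply: (@econv_cvg (fun n => majorant n s) (fun=> U s)) => // y;
  by [exact: majorant_nd|exact: majlim_cvg|exact: cvg_cst|move=> *; exact: lexx].
have e0 f g : (forall y, 0 <= f y) -> (forall y, 0 <= g y) -> 0 <= econv f g x.
  exact: econv_ge0.
have l0 := majlim_ge0 s.
have e1 := e0 _ _ l0 l0; have e2 := e0 _ _ (U_ge0 s) l0; have e3 := e0 _ _ l0 (U_ge0 s).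
apply: cvgeD => //; last apply: cvgeD => //; apply: ge0_adde_def; rewrite inE.
all: first [exact: e3|exact: e1|exact: e2|exact: (adde_ge0 e1 e2)].
Qed.

Lemma picard_majorant_cvg t x :
  picard (majorant n) t x @[n --> \oo] --> picard majlim t x.
Proof.
apply: cvgeD; last 2 first.
- exact: cvg_cst.
- have e0 s : 0 <= (expR s)%:E :> \bar R by rewrite lee_fin expR_ge0.
  have f0 n s : 0 <= forcing (majorant n) s x by apply: forcing_ge0; exact: majorant_ge0.
  apply: ge0_monotone_cvg => //.
  + move=> n; apply: measurable_funTS; apply: emeasurable_funM.
      exact: measurable_decayB.
    apply: jmeas_sectionr; apply: forcing_jmeas; first exact: jmeas_majorant.
    exact: majorant_ge0.
  + by move=> n s _; rewrite mule_ge0.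
  + move=> s _ n m nm; apply: lee_wpmul2l => //; apply: le_forcing.
    * exact: jmeas_majorant.
    * exact: majorant_ge0.
    * exact: jmeas_majorant.
    * by move=> y; exact: majorant_nd.
  + move=> s _; apply: cvgeZl => //; apply: cvgeZl => //.
    exact: equad_majorant_cvg.
apply: ge0_adde_def; rewrite inE.
  by rewrite mule_ge0// lee_fin expR_ge0.
by apply: duhamel_ge0 => s; apply: forcing_ge0; exact: majlim_ge0.
Qed.

(** [picard] commutes with the increasing limit of the majorants, and a shifted sequence has the
    same limit. *)
Lemma picard_majlim t x : picard majlim t x = majlim t x.
Proof.
apply: (cvg_unique _ (@picard_majorant_cvg t x)) => //.
have := @majlim_cvg t x.
by rewrite -(cvg_shiftS (fun n => majorant n t x)).
Qed.

(** Serves to show that almost every frequency is good. Half of this integral is the left-hand side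
    of [forcing_young], whose right-hand side is finite by the energy bound and by low norm <=
    nu/8. *)
Lemma majlim_forcing_finite t : (0 <= t)%R ->
  \int[lam]_(s in `[0%R, t]) \int[mu]_x equad (U s) (majlim s) x < +oo.
Proof.
move=> t0.
have K8 : (Kbound <= nu / 8)%R by exact: ltW.
have nu2 : (0 < nu / 2)%R by rewrite divr_gt0.
have low s : (0 <= s)%R -> lownorm majlim s <= (nu / 8)%:E.
  move=> s0; apply: (@le_trans _ _ (energy majlim s)).
    apply: leeDl; apply: mule_ge0; first by rewrite lee_fin ltW.
    by apply: integral_ge0 => r _; exact: highnorm_ge0 majlim_ge0.
  by apply: (le_trans (majlim_energy_le s0)); rewrite lee_fin.
have := forcing_young jmeas_majlim majlim_ge0
  (t := t) (fun s h => low s (proj1 (andP h))).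
have -> : \int[lam]_(s in `[0%R, t])
    (mass majlim s * mass majlim s + mass U s * mass majlim s + mass majlim s * mass U s) =
    \int[lam]_(s in `[0%R, t]) \int[mu]_x equad (U s) (majlim s) x.
  by apply: eq_integral => s _; rewrite mass_equad//; [exact: jmeas_majlim|exact: majlim_ge0].
set I := \int[lam]_(s in `[0%R, t]) \int[mu]_x equad (U s) (majlim s) x.
move=> h.
have : 2^-1%:E * I < +oo.
  apply: (le_lt_trans h); apply: lte_add_pinfty.
    apply: (@le_lt_trans _ _ (energy majlim t)).
      by apply: leeDr; exact: lownorm_ge0 majlim_ge0.
    exact: le_lt_trans (majlim_energy_le t0) (ltry _).
  apply: lte_mul_pinfty => //; first by rewrite lee_fin two_div_nu_ge0.
  apply: (@le_lt_trans _ _ (\int[lam]_(s in `[0%R, t]) (usq s * (nu / 8)%:E))).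
    apply: ge0_le_integral => //.
    - by move=> s _; apply: mule_ge0; [exact: usq_ge0|exact: lownorm_ge0 majlim_ge0].
    - apply: measurable_funTS; apply: emeasurable_funM; first exact: measurable_usq.
      by apply: measurable_lownorm; [exact: jmeas_majlim|exact: majlim_ge0].
    - apply: measurable_funTS; apply: emeasurable_funM => //; exact: measurable_usq.
    - move=> s; rewrite /= in_itv/= => /andP[s0 _].
      by apply: lee_wpmul2l; [exact: usq_ge0|exact: low].
  rewrite ge0_integralZr//.
  - rewrite muleC; apply: lte_mul_pinfty => //; first by rewrite lee_fin divr_ge0// ltW.
    exact: le_lt_trans (usq_le t) (ltry _).
  - by apply: measurable_funTS; exact: measurable_usq.
  - by move=> s _; exact: usq_ge0.
  - by rewrite lee_fin divr_ge0// ltW.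
case: I {h} => [r| |]; rewrite ?ltry ?ltNyr//.
by rewrite gt0_muley ?lte_fin// invr_gt0.
Qed.

End Majorant.

(** * Fields on Fourier space *)

Section ProductSigmaFinite.
Local Open Scope ereal_scope.
Context {R : realType} d1 d2 (T1 : measurableType d1) (T2 : measurableType d2).
Context (m1 : {sigma_finite_measure set T1 -> \bar R}).
Context (m2 : {sigma_finite_measure set T2 -> \bar R}).

(* Canonical structure inference does not find the sigma-finite structure on
   [m1 \x m2], whose key is taken by the product of two subprobabilities. *)
Definition product_sigma_finite : {sigma_finite_measure set (T1 * T2)%type -> \bar R} :=
  let m : measure (T1 * T2)%type R := m1 \x m2 in
  HB.pack_for {sigma_finite_measure set (T1 * T2)%type -> \bar R} (Measure.sort m)
    (lebesgue_integral_fubini.measure_function_Measure_isSigmaFinite__to__measure_function_isSFinite m1 m2)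
    (lebesgue_integral_fubini.measure_function_Measure_isSigmaFinite__to__measure_function_isSigmaFinite m1 m2).

End ProductSigmaFinite.

Section Invariance.
Context {R : realType}.
Local Open Scope ereal_scope.
Local Notation RT := (measurableTypeR R).
Local Notation lam := (@lebesgue_measure R).

(** Lebesgue measure is determined by its values on half-open intervals, whose length a translation
    preserves. *)
Lemma lebesgue_measure_shift (c : R) (A : set RT) : measurable A ->
  pushforward lam ((fun x => x - c)%R : RT -> RT) A = lam A.
Proof.
have mf : measurable_fun [set: RT] ((fun x => x - c)%R : RT -> RT).
  exact: measurable_funB.
move=> mA; apply/esym/lebesgue_measure_unique => //= _ [[a b]] _ <-.
rewrite /pushforward.
have -> : (fun x => x - c)%R @^-1` `]a, b]%classic = `](a + c)%R, (b + c)%R]%classic.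
  by apply/seteqP; split => x /=; rewrite !in_itv/= ltrBrDr lerBlDr.
rewrite !lebesgue_measure_itv/= !lte_fin ltrD2r; case: ifPn => // _.
by rewrite -!EFinB; congr EFin; ring.
Qed.

Lemma integral_lebesgue_shift (f : RT -> \bar R) (c : R) :
  measurable_fun setT f -> (forall x, 0 <= f x) ->
  \int[lam]_x f (x - c)%R = \int[lam]_x f x.
Proof.
move=> mf f0.
have ms : measurable_fun [set: RT] ((fun x => x - c)%R : RT -> RT).
  exact: measurable_funB.
rewrite -[LHS](@ge0_integral_pushforward _ _ _ _ _ _ ms lam setT f)//.
by apply: eq_measure_integral => //= A mA _; exact: lebesgue_measure_shift.
Qed.

Lemma integral_prod_invariant d1 d2 (T1 : measurableType d1) (T2 : measurableType d2)
    (m1 : {sigma_finite_measure set T1 -> \bar R})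
    (m2 : {sigma_finite_measure set T2 -> \bar R}) (p1 : T1 -> T1) (p2 : T2 -> T2) :
  measurable_fun setT p1 -> measurable_fun setT p2 ->
  (forall f : T1 -> \bar R, measurable_fun setT f -> (forall x, 0 <= f x) ->
    \int[m1]_x f (p1 x) = \int[m1]_x f x) ->
  (forall f : T2 -> \bar R, measurable_fun setT f -> (forall x, 0 <= f x) ->
    \int[m2]_x f (p2 x) = \int[m2]_x f x) ->
  forall f : T1 * T2 -> \bar R, measurable_fun setT f -> (forall x, 0 <= f x) ->
    \int[m1 \x m2]_x f (p1 x.1, p2 x.2) = \int[m1 \x m2]_x f x.
Proof.
move=> mp1 mp2 i1 i2 f mf f0.
have mp : measurable_fun setT (fun x : T1 * T2 => (p1 x.1, p2 x.2)).
  by apply: measurable_fun_pair; apply: measurableT_comp.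
rewrite (@fubini_tonelli1 _ _ _ _ _ m1 m2 (fun x => f (p1 x.1, p2 x.2)))//; last exact: measurableT_comp.
rewrite [RHS](fubini_tonelli1 _ mf f0) /fubini_F/=.
under eq_integral => x _.
  rewrite (i2 (fun y => f (p1 x, y)))//; last exact: measurableT_comp.
  over.
rewrite (i1 (fun x => \int[m2]_y f (x, y)))//.
- exact: (@measurable_fun_fubini_tonelli_F _ _ _ _ _ m2 f mf f0).
- by move=> x; exact: integral_ge0.
Qed.

Definition mu2 : {sigma_finite_measure set (RT * RT)%type -> \bar R} :=
  product_sigma_finite lam lam.

(** Up to conversion this is [leb3], with the sigma-finite structure that Tonelli requires. *)
Definition mu3 : {sigma_finite_measure set (RT * RT * RT)%type -> \bar R} :=
  product_sigma_finite mu2 lam.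

Lemma integral_sub3 (f : R3 -> \bar R) (y : R3) :
  measurable_fun [set: (RT * RT * RT)%type] f -> (forall x, 0 <= f x) ->
  \int[mu3]_x f (sub3 x y) = \int[mu3]_x f x.
Proof.
move=> mf f0.
have ms c : measurable_fun [set: RT] ((fun x => x - c)%R : RT -> RT).
  exact: measurable_funB.
have i1 c (g : RT -> \bar R) : measurable_fun setT g -> (forall x, 0 <= g x) ->
    \int[lam]_x g (x - c)%R = \int[lam]_x g x by exact: integral_lebesgue_shift.
apply: (@integral_prod_invariant _ _ _ _ mu2 lam
  (fun x => (x.1 - y.1.1, x.2 - y.1.2)%R) (fun x => x - y.2)%R) => //.
- by apply: measurable_fun_pair; apply: measurable_funB.
- move=> g mg g0.
  exact: (@integral_prod_invariant _ _ _ _ lam lam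
    (fun x => x - y.1.1)%R (fun x => x - y.1.2)%R
    (ms _) (ms _) (i1 _) (i1 _) g mg g0).
- by move=> g mg g0; exact: i1.
Qed.

Lemma measurable_sub3 :
  measurable_fun [set: (RT * RT * RT) * (RT * RT * RT)]
    (fun p => sub3 p.1 p.2 : RT * RT * RT).
Proof.
have m1 : measurable_fun [set: (RT * RT * RT) * (RT * RT * RT)] (fun p => p.1).
  exact: measurable_fst.
have m2 : measurable_fun [set: (RT * RT * RT) * (RT * RT * RT)] (fun p => p.2).
  exact: measurable_snd.
have f1 := @measurable_fst _ _ (RT * RT)%type RT.
have f2 := @measurable_snd _ _ (RT * RT)%type RT.
have f11 := measurableT_comp (@measurable_fst _ _ RT RT) f1.
have f12 := measurableT_comp (@measurable_snd _ _ RT RT) f1.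
apply: measurable_fun_pair; first apply: measurable_fun_pair; apply: measurable_funB.
- exact: (measurableT_comp f11 m1).
- exact: (measurableT_comp f11 m2).
- exact: (measurableT_comp f12 m1).
- exact: (measurableT_comp f12 m2).
- exact: (measurableT_comp f2 m1).
- exact: (measurableT_comp f2 m2).
Qed.

Lemma measurable_coord k : measurable_fun [set: (RT * RT * RT)%type] (fun x => Defs.coord x k : RT).
Proof.
have f1 := @measurable_fst _ _ (RT * RT)%type RT.
rewrite /Defs.coord; case: (val k) => [|[|_]].
- exact: (measurableT_comp (@measurable_fst _ _ RT RT) f1).
- exact: (measurableT_comp (@measurable_snd _ _ RT RT) f1).
- exact: (@measurable_snd _ _ (RT * RT)%type RT).
Qed.

Lemma measurable_sqrt : measurable_fun [set: RT] (@Num.sqrt R : RT -> RT).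
Proof. by apply: continuous_measurable_fun; exact: sqrt_continuous. Qed.

Lemma measurable_norm3 : measurable_fun [set: (RT * RT * RT)%type] (@norm3 R : _ -> RT).
Proof.
apply: (measurableT_comp measurable_sqrt).
apply: measurable_sum => k; apply: measurable_funX; exact: measurable_coord.
Qed.

Lemma norm3_ge0 (x : @R3 R) : (0 <= norm3 x)%R.
Proof. exact: sqrtr_ge0. Qed.

Lemma coord_le_norm3 (x : @R3 R) k : (`|Defs.coord x k| <= norm3 x)%R.
Proof.
rewrite -sqrtr_sqr; apply: ler_wsqrtr.
rewrite (bigD1 k)//= lerDl; apply: sumr_ge0 => i _; exact: sqr_ge0.
Qed.

Lemma norm3_gt0_ae : {ae mu3, forall x, (0 < norm3 x)%R}.
Proof.
(* The origin lies in the plane where the third coordinate is 0, a product set that the product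
   formula shows to be null. *)
exists ([set: RT * RT] `*` [set 0%R]); split.
- apply: measurableX => //; exact: measurable_set1.
- rewrite [LHS](@product_measure1E _ _ _ _ _ mu2 lam)//.
  by rewrite [X in _ * X]lebesgue_measure_set1 mule0.
- move=> x /= /negP; rewrite -leNgt => h; split => //=.
  have := coord_le_norm3 x (inord 2).
  rewrite /Defs.coord /= inordK//= => h2.
  by apply/eqP; rewrite -normr_le0 (le_trans h2).
Qed.

End Invariance.

(** * Complex moduli and integrals of complex functions *)

Section ComplexModulus.
Context {R : realType}.
Implicit Types z w : R[i].
Local Open Scope complex_scope.
Local Notation Re := complex.Re.
Local Notation Im := complex.Im.

(** The norm of [R[i]] has its values in [R[i]], whereas the estimates need a real modulus; the laws
    of the norm are transferred through this identity. *)
Lemma cmodE z : (cmod z)%:C = `|z|. Proof. by rewrite normc_def. Qed.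

Lemma cmod_ge0 z : 0 <= cmod z. Proof. exact: sqrtr_ge0. Qed.

Lemma cmod0 : cmod (0 : R[i]) = 0.
Proof. by apply: complexI; rewrite cmodE normr0. Qed.

Lemma cmodM z w : cmod (z * w) = cmod z * cmod w.
Proof. by apply: complexI; rewrite rmorphM/= !cmodE normrM. Qed.

Lemma cmodN z : cmod (- z) = cmod z.
Proof. by apply: complexI; rewrite !cmodE normrN. Qed.

Lemma cmodD_le z w : cmod (z + w) <= cmod z + cmod w.
Proof. by rewrite -lecR rmorphD/= !cmodE ler_normD. Qed.

Lemma cmodB_sym z w : cmod (z - w) = cmod (w - z).
Proof. by rewrite -cmodN opprB. Qed.

Lemma cmod_real (x : R) : cmod x%:C = `|x|.
Proof. by rewrite /cmod/= expr0n/= addr0 sqrtr_sqr. Qed.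

Lemma cmod_Re z : `|Re z| <= cmod z.
Proof. by rewrite -sqrtr_sqr ler_wsqrtr// lerDl sqr_ge0. Qed.

Lemma cmod_Im z : `|Im z| <= cmod z.
Proof. by rewrite -sqrtr_sqr ler_wsqrtr// lerDr sqr_ge0. Qed.

Lemma cmod_le_ReIm z : cmod z <= `|Re z| + `|Im z|.
Proof.
rewrite -[leRHS]ger0_norm ?addr_ge0// -sqrtr_sqr ler_wsqrtr//.
rewrite sqrrD !real_normK ?num_real// -subr_ge0.
by rewrite [leRHS](_ : _ = `|Re z| * `|Im z| *+ 2) ?mulrn_wge0 ?mulr_ge0//; ring.
Qed.

Lemma cmod_i : cmod 'i = 1 :> R.
Proof. by rewrite /cmod/= expr0n/= add0r expr1n sqrtr1. Qed.

Lemma cmod_sum_le (I : Type) (r : seq I) (P : pred I) (F : I -> R[i]) :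
  cmod (\sum_(i <- r | P i) F i) <= \sum_(i <- r | P i) cmod (F i).
Proof.
elim/big_ind2: _ => //; first by rewrite cmod0.
by move=> x1 x2 y1 y2 h1 h2; apply: (le_trans (cmodD_le _ _)); exact: lerD.
Qed.

Lemma ReD z w : Re (z + w) = Re z + Re w. Proof. by case: z; case: w. Qed.
Lemma ImD z w : Im (z + w) = Im z + Im w. Proof. by case: z; case: w. Qed.
Lemma ReN z : Re (- z) = - Re z. Proof. by case: z. Qed.
Lemma ImN z : Im (- z) = - Im z. Proof. by case: z. Qed.
Lemma ReM z w : Re (z * w) = Re z * Re w - Im z * Im w.
Proof. by case: z; case: w. Qed.
Lemma ImM z w : Im (z * w) = Re z * Im w + Im z * Re w.
Proof. by case: z => a b; case: w. Qed.
Lemma Re_scale (x : R) z : Re (x%:C * z) = x * Re z.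
Proof. by rewrite ReM/= mul0r subr0. Qed.
Lemma Im_scale (x : R) z : Im (x%:C * z) = x * Im z.
Proof. by rewrite ImM/= mul0r addr0. Qed.
Lemma complex_ext z w : Re z = Re w -> Im z = Im w -> z = w.
Proof. by case: z => a b; case: w => c e /= -> ->. Qed.

End ComplexModulus.

Section ComplexIntegral.
Context {R : realType}.
Local Open Scope complex_scope.
Local Notation RT := (measurableTypeR R).
Local Notation Re := complex.Re.
Local Notation Im := complex.Im.

Definition cmeas d (T : measurableType d) (D : set T) (g : T -> R[i]) :=
  measurable_fun D (fun x => Re (g x) : RT) /\ measurable_fun D (fun x => Im (g x) : RT).

Section Measurability.
Context d (T : measurableType d) (D : set T).
Implicit Types f g : T -> R[i].

Lemma cmeas_cst z : cmeas D (fun _ => z).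
Proof. by split; exact: measurable_cst. Qed.

Lemma cmeasD f g : cmeas D f -> cmeas D g -> cmeas D (fun x => f x + g x).
Proof.
move=> [f1 f2] [g1 g2]; split.
  by under eq_fun do rewrite ReD; exact: measurable_funD.
by under eq_fun do rewrite ImD; exact: measurable_funD.
Qed.

Lemma cmeasN f : cmeas D f -> cmeas D (fun x => - f x).
Proof.
move=> [f1 f2]; split.
  by under eq_fun do rewrite ReN; exact: measurable_funN.
by under eq_fun do rewrite ImN; exact: measurable_funN.
Qed.

Lemma cmeasB f g : cmeas D f -> cmeas D g -> cmeas D (fun x => f x - g x).
Proof. by move=> mf mg; apply: cmeasD => //; exact: cmeasN. Qed.

Lemma cmeasM f g : cmeas D f -> cmeas D g -> cmeas D (fun x => f x * g x).
Proof.
move=> [f1 f2] [g1 g2]; split.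
  under eq_fun do rewrite ReM.
  by apply: measurable_funB; exact: measurable_funM.
under eq_fun do rewrite ImM.
by apply: measurable_funD; exact: measurable_funM.
Qed.

Lemma cmeas_real (f : T -> RT) : measurable_fun D f -> cmeas D (fun x => (f x)%:C).
Proof. by move=> mf; split => //=; exact: measurable_cst. Qed.

Lemma cmeas_sum n (F : 'I_n -> T -> R[i]) : (forall i, cmeas D (F i)) ->
  cmeas D (fun x => \sum_(i < n) F i x).
Proof.
elim: n F => [|n IH] F mF.
  by under eq_fun do rewrite big_ord0; exact: cmeas_cst.
under eq_fun do rewrite big_ord_recl.
by apply: cmeasD => //; exact: IH.
Qed.

Lemma measurable_cmod f : cmeas D f -> measurable_fun D (fun x => cmod (f x) : RT).
Proof.
move=> [f1 f2]; apply: measurableT_comp; first exact: measurable_sqrt.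
by apply: measurable_funD; exact: measurable_funX.
Qed.

Lemma measurable_EFin_cmod f : cmeas D f -> measurable_fun D (fun x => (cmod (f x))%:E).
Proof. by move=> mf; apply/measurable_EFinP; exact: measurable_cmod. Qed.

End Measurability.

Lemma cmeas_comp d1 d2 (T1 : measurableType d1) (T2 : measurableType d2)
    (g : T2 -> R[i]) (phi : T1 -> T2) :
  cmeas setT g -> measurable_fun setT phi -> cmeas setT (fun x => g (phi x)).
Proof.
move=> [g1 g2] mp; split; first exact: (measurableT_comp g1 mp).
exact: (measurableT_comp g2 mp).
Qed.

(** Tonelli applies to the positive and negative parts separately; [fine] is total and measurable,
    so parameters with a divergent integral do no harm. *)
Lemma measurable_Rintegral_param d1 d2 (X : measurableType d1) (Y : measurableType d2)
    (mu : {sigma_finite_measure set Y -> \bar R}) (f : X * Y -> RT) :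
  measurable_fun setT f ->
  measurable_fun setT (fun x => (\int[mu]_y f (x, y))%R : RT).
Proof.
move=> mf; rewrite /Rintegral.
apply: (@measurableT_comp _ _ _ _ _ _ (@fine R)); first exact: fine_measurable.
under eq_fun do rewrite integralE.
have mfe : measurable_fun setT (fun p => (f p)%:E) by exact/measurable_EFinP.
apply: emeasurable_funB.
  rewrite [X in measurable_fun _ X](_ : _ = fubini_F mu ((fun p => (f p)%:E)^\+)%E).
    apply: measurable_fun_fubini_tonelli_F; first exact: measurable_funepos.
    by move=> p; exact: funepos_ge0.
  by apply/funext => x; apply: eq_integral => y _; rewrite !funeposE.
rewrite [X in measurable_fun _ X](_ : _ = fubini_F mu ((fun p => (f p)%:E)^\-)%E).
  apply: measurable_fun_fubini_tonelli_F; first exact: measurable_funeneg.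
  by move=> p; exact: funeneg_ge0.
by apply/funext => x; apply: eq_integral => y _; rewrite !funenegE.
Qed.

Section CintTheory.
Context d (T : measurableType d) (mu : {measure set T -> \bar R}) (D : set T).
Hypothesis mD : measurable D.
Implicit Types f g : T -> R[i].

Lemma Re_cint g : Re (cint mu D g) = (\int[mu]_(x in D) Re (g x))%R.
Proof. by rewrite /cint ReD ReM/= mul0r mulr0 subrr addr0. Qed.

Lemma Im_cint g : Im (cint mu D g) = (\int[mu]_(x in D) Im (g x))%R.
Proof. by rewrite /cint ImD ImM/= mul0r mul1r !add0r. Qed.

Definition cintegrable g := cmeas D g /\ (\int[mu]_(x in D) (cmod (g x))%:E < +oo)%E.

Lemma cintegrable_ReIm g : cintegrable g ->
  mu.-integrable D (EFin \o (fun x => Re (g x))) /\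
  mu.-integrable D (EFin \o (fun x => Im (g x))).
Proof.
move=> [mg fin]; have [m1 m2] := mg.
split; apply/integrableP; split; try exact/measurable_EFinP.
  apply: le_lt_trans fin; apply: ge0_le_integral => //.
  - by apply: measurableT_comp => //; exact/measurable_EFinP.
  - exact: measurable_EFin_cmod.
  - by move=> x _ /=; rewrite lee_fin cmod_Re.
apply: le_lt_trans fin; apply: ge0_le_integral => //.
- by apply: measurableT_comp => //; exact/measurable_EFinP.
- exact: measurable_EFin_cmod.
- by move=> x _ /=; rewrite lee_fin cmod_Im.
Qed.

Lemma cintD f g : cintegrable f -> cintegrable g ->
  cint mu D (fun x => f x + g x) = cint mu D f + cint mu D g.
Proof.
move=> /cintegrable_ReIm[f1 f2] /cintegrable_ReIm[g1 g2].
apply: complex_ext.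
  rewrite [RHS]ReD !Re_cint -(RintegralD mD f1 g1).
  by apply: eq_Rintegral => x _; rewrite ReD.
rewrite [RHS]ImD !Im_cint -(RintegralD mD f2 g2).
by apply: eq_Rintegral => x _; rewrite ImD.
Qed.

Lemma cintB f g : cintegrable f -> cintegrable g ->
  cint mu D (fun x => f x - g x) = cint mu D f - cint mu D g.
Proof.
move=> /cintegrable_ReIm[f1 f2] /cintegrable_ReIm[g1 g2].
apply: complex_ext.
  rewrite [RHS]ReD ReN !Re_cint -(RintegralB mD f1 g1).
  by apply: eq_Rintegral => x _; rewrite ReD ReN.
rewrite [RHS]ImD ImN !Im_cint -(RintegralB mD f2 g2).
by apply: eq_Rintegral => x _; rewrite ImD ImN.
Qed.

Lemma cintZ (c : R) f : cintegrable f ->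
  cint mu D (fun x => c%:C * f x) = c%:C * cint mu D f.
Proof.
move=> /cintegrable_ReIm[f1 f2].
apply: complex_ext; rewrite ?Re_scale ?Im_scale ?Re_cint ?Im_cint -RintegralZl//.
  by apply: eq_Rintegral => x _; rewrite Re_scale.
by apply: eq_Rintegral => x _; rewrite Im_scale.
Qed.

Lemma eq_cint f g : {in D, f =1 g} -> cint mu D f = cint mu D g.
Proof.
move=> fg; apply: complex_ext; rewrite ?Re_cint ?Im_cint;
  by apply: eq_Rintegral => x Dx; rewrite fg.
Qed.

Lemma cint0 : cint mu D (fun=> 0) = 0.
Proof.
by apply: complex_ext; rewrite ?Re_cint ?Im_cint /Rintegral integral0.
Qed.

(** If the integral is infinite, [fine] sends it to 0 and the bound persists. *)
Lemma abs_Rintegral_le (h : T -> RT) : measurable_fun D h ->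
  ((`|\int[mu]_(x in D) h x|%R)%:E <= \int[mu]_(x in D) (`|h x|%R)%:E)%E.
Proof.
move=> mh; apply: (@le_trans _ _ (`|\int[mu]_(x in D) (h x)%:E|)%E).
  by rewrite /Rintegral; case: (\int[mu]_(x in D) (h x)%:E)%E => [r| |] //=;
    rewrite normr0 leey.
by apply: (le_trans (le_abse_integral _ _ _)) => //; exact/measurable_EFinP.
Qed.

(** Real and imaginary parts are estimated separately, each by the full modulus, whence the factor
    2. *)
Lemma cmod_cint_le g : cmeas D g ->
  ((cmod (cint mu D g))%:E <= 2%:E * \int[mu]_(x in D) (cmod (g x))%:E)%E.
Proof.
move=> mg; have [m1 m2] := mg.
apply: (@le_trans _ _ ((`|\int[mu]_(x in D) Re (g x)|%R)%:E +
    (`|\int[mu]_(x in D) Im (g x)|%R)%:E)%E).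
  by rewrite -EFinD lee_fin -Re_cint -Im_cint cmod_le_ReIm.
rewrite -[2%R]/(1 + 1)%R EFinD ge0_muleDl// !mul1e; apply: leeD.
  apply: (le_trans (abs_Rintegral_le m1)); apply: ge0_le_integral => //.
  - by apply/measurable_EFinP; exact: measurableT_comp.
  - exact: measurable_EFin_cmod.
  - by move=> x _; rewrite lee_fin cmod_Re.
apply: (le_trans (abs_Rintegral_le m2)); apply: ge0_le_integral => //.
- by apply/measurable_EFinP; exact: measurableT_comp.
- exact: measurable_EFin_cmod.
- by move=> x _; rewrite lee_fin cmod_Im.
Qed.

End CintTheory.

Lemma cmeas_cint_param d1 d2 (X : measurableType d1) (Y : measurableType d2)
    (mu : {sigma_finite_measure set Y -> \bar R}) (g : X * Y -> R[i]) :
  cmeas setT g -> cmeas setT (fun x => cint mu setT (fun y => g (x, y))).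
Proof.
move=> [g1 g2]; split.
  by under eq_fun do rewrite Re_cint; exact: measurable_Rintegral_param g1.
by under eq_fun do rewrite Im_cint; exact: measurable_Rintegral_param g2.
Qed.

End ComplexIntegral.

(** * The Navier-Stokes nonlinearity against convolutions of moduli *)

Section NonlinearComparison.
Context {R : realType}.
Local Open Scope complex_scope.
Local Notation RT := (measurableTypeR R).
Local Notation T3 := (RT * RT * RT)%type.
Local Notation field := (@Field R).
Implicit Types (A : field) (xi eta : @R3 R).

(** Summing over components, as opposed to taking the Euclidean length, makes [Xnorm] the integral
    of one scalar function and the norm of a tensor product the product of the norms. *)
Definition fnorm A xi : R := \sum_(k < 3) cmod (A xi k).

Definition fmeas A := forall k, cmeas [set: T3] (fun xi => A xi k).

Lemma fnorm_ge0 A xi : 0 <= fnorm A xi.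
Proof. by apply: sumr_ge0 => k _; exact: cmod_ge0. Qed.

Lemma cmod_le_fnorm A xi k : cmod (A xi k) <= fnorm A xi.
Proof.
by rewrite /fnorm (bigD1 k)//= lerDl; apply: sumr_ge0 => i _; exact: cmod_ge0.
Qed.

Lemma fnorm_le_sub A A' xi : fnorm A xi <= fnorm (fsub A A') xi + fnorm A' xi.
Proof.
rewrite -big_split/=; apply: ler_sum => k _.
by rewrite -{1}(subrK (A' xi k) (A xi k)) cmodD_le.
Qed.

Lemma measurable_fnorm A : fmeas A -> measurable_fun [set: T3] (fnorm A : T3 -> RT).
Proof. by move=> mA; apply: measurable_sum => k; exact: measurable_cmod. Qed.

Lemma fmeas_sub A A' : fmeas A -> fmeas A' -> fmeas (fsub A A').
Proof. by move=> mA mA' k; exact: cmeasB. Qed.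

Lemma measurable_sub3r xi : measurable_fun [set: T3] (fun eta => sub3 xi eta : T3).
Proof. exact: (measurableT_comp measurable_sub3 (measurable_pair1 xi)). Qed.

Lemma cmod_leray_le xi k l : cmod (leray xi k l) <= 2.
Proof.
rewrite /leray cmod_real; apply: (le_trans (ler_normB _ _)).
rewrite -[2]/(1 + 1); apply: lerD.
  by case: (k == l); rewrite ?normr1 ?normr0.
rewrite normrM normfV normrM (ger0_norm (sqr_ge0 (norm3 xi))).
have [r0|r0] := eqVneq (norm3 xi) 0; first by rewrite r0 expr0n/= invr0 mulr0.
have r1 : 0 < norm3 xi by rewrite lt_neqAle eq_sym r0 norm3_ge0.
rewrite ler_pdivrMr ?exprn_gt0// mul1r expr2.
by apply: ler_pM => //; exact: coord_le_norm3.
Qed.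

Lemma two_pi_cube_le : ((2 * pi) ^+ 3)^-1 <= 64^-1 :> R.
Proof.
have h := pi_ge2 R.
rewrite lef_pV2 ?posrE//; last by rewrite exprn_gt0// mulr_gt0// pi_gt0.
rewrite (_ : 64 = 4 ^+ 3 :> R); last by ring.
by apply: lerXn2r; rewrite ?nnegrE//; lra.
Qed.

Lemma fnorm_prod_sub A A' xi eta :
  \sum_(j < 3) \sum_(l < 3)
    cmod (A (sub3 xi eta) j * A eta l - A' (sub3 xi eta) j * A' eta l) <=
  fnorm (fsub A A') (sub3 xi eta) * fnorm A eta +
  fnorm A' (sub3 xi eta) * fnorm (fsub A A') eta.
Proof.
rewrite /fnorm !mulr_suml -big_split/=; apply: ler_sum => j _.
rewrite !mulr_sumr -big_split/=; apply: ler_sum => l _.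
rewrite -!cmodM.
have -> : A (sub3 xi eta) j * A eta l - A' (sub3 xi eta) j * A' eta l =
  fsub A A' (sub3 xi eta) j * A eta l + A' (sub3 xi eta) j * fsub A A' eta l.
  by rewrite /fsub mulrBl mulrBr addrA subrK.
exact: cmodD_le.
Qed.

(** Three components k, the bound 2 on an entry of the Leray matrix, (2 pi)^-3 <= 1/64 and the 2 of
    the premise multiply to 12/64 <= 1/4. The 2 of the premise is the one of [cmod_cint_le]. *)
Lemma NSnonlin_sub_le A A' xi (e : R) :
  \sum_(j < 3) \sum_(l < 3)
    cmod (Defs.conv (A ^~ j) (A ^~ l) xi - Defs.conv (A' ^~ j) (A' ^~ l) xi) <= 2 * e ->
  \sum_(k < 3) cmod (NSnonlin A xi k - NSnonlin A' xi k) <= 4^-1 * norm3 xi * e.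
Proof.
set d := fun j l => cmod (Defs.conv (A ^~ j) (A ^~ l) xi - Defs.conv (A' ^~ j) (A' ^~ l) xi).
move=> he.
have r0 := norm3_ge0 xi.
have d0 j l : 0 <= d j l by exact: cmod_ge0.
have S0 : 0 <= \sum_(j < 3) \sum_(l < 3) d j l.
  by apply: sumr_ge0 => j _; apply: sumr_ge0.
have c0 : 0 <= ((2 * pi) ^+ 3)^-1 :> R.
  by rewrite invr_ge0 exprn_ge0// mulr_ge0// pi_ge0.
have hk k : cmod (NSnonlin A xi k - NSnonlin A' xi k) <=
    2 * (norm3 xi * 64^-1 * \sum_(j < 3) \sum_(l < 3) d j l).
  rewrite /NSnonlin -sumrB exchange_big/= mulr_sumr mulr_sumr.
  apply: (le_trans (cmod_sum_le _ _ _)); apply: ler_sum => l _.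
  rewrite -mulrBr cmodM; apply: ler_pM; rewrite ?cmod_ge0 ?cmod_leray_le//.
  rewrite -sumrB mulr_sumr.
  apply: (le_trans (cmod_sum_le _ _ _)); apply: ler_sum => j _.
  rewrite -mulrBr !cmodM cmod_i mul1r !cmod_real.
  apply: ler_wpM2r; first exact: d0.
  apply: ler_pM => //; first exact: coord_le_norm3.
  by rewrite ger0_norm// two_pi_cube_le.
apply: (le_trans (ler_sum _ (fun k _ => hk k))).
rewrite sumr_const card_ord -mulr_natl.
have h : norm3 xi * \sum_(j < 3) \sum_(l < 3) d j l <= norm3 xi * (2 * e).
  exact: ler_wpM2l.
have e0 : 0 <= norm3 xi * e.
  by rewrite mulr_ge0//; have := le_trans S0 he; rewrite pmulr_rge0.
lra.
Qed.

Local Notation econv3 := (econv mu3 (@sub3 R)).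

(** With |A| <= m, |A'| <= m' and |A - A'| <= m - m', the telescoped product |A - A'| |A| + |A'| |A
    - A'| is at most (m - m') m + m' (m - m') = m m - m' m', the first factors being taken at xi -
    eta and the second at eta. The differences are moved to the other side because m may be
    infinite. *)
Lemma NSnonlin_compare A A' (m m' : @R3 R -> \bar R) xi :
  fmeas A -> fmeas A' ->
  measurable_fun [set: T3] m -> measurable_fun [set: T3] m' ->
  (forall eta, (fnorm (fsub A A') eta)%:E + m' eta <= m eta)%E ->
  (forall eta, (fnorm A' eta)%:E <= m' eta)%E ->
  (econv3 m m xi < +oo)%E ->
  ((\sum_(k < 3) cmod (NSnonlin A xi k - NSnonlin A' xi k))%:E +
    (4^-1 * norm3 xi)%:E * econv3 m' m' xi <= (4^-1 * norm3 xi)%:E * econv3 m m xi)%E.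
Proof.
move=> mA mA' mm mm' hsub hA' fin.
have m'0 eta : (0 <= m' eta)%E by apply: le_trans (hA' eta); rewrite lee_fin fnorm_ge0.
have m'm eta : (m' eta <= m eta)%E.
  by apply: le_trans (hsub eta); rewrite leeDr// lee_fin fnorm_ge0.
have m0 eta : (0 <= m eta)%E by exact: le_trans (m'm eta).
have hA eta : ((fnorm A eta)%:E <= m eta)%E.
  apply: le_trans (hsub eta).
  apply: (@le_trans _ _ ((fnorm (fsub A A') eta)%:E + (fnorm A' eta)%:E)%E).
    by rewrite -EFinD lee_fin fnorm_le_sub.
  by rewrite leeD2l.
pose g (B : field) (j l : 'I_3) eta : R[i] := B (sub3 xi eta) j * B eta l.
have mg B j l : fmeas B -> cmeas [set: T3] (g B j l).
  move=> mB; apply: cmeasM; last exact: mB.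
  exact: (cmeas_comp (mB j) (measurable_sub3r xi)).
pose h eta := \sum_(j < 3) \sum_(l < 3) cmod (g A j l eta - g A' j l eta).
have mh : measurable_fun [set: T3] (fun eta => (h eta)%:E).
  apply/measurable_EFinP; apply: measurable_sum => j; apply: measurable_sum => l.
  by apply: measurable_cmod; apply: cmeasB; exact: mg.
have h0 eta : (0 <= (h eta)%:E)%E.
  by rewrite lee_fin; apply: sumr_ge0 => j _; apply: sumr_ge0 => l _; exact: cmod_ge0.
have mmm : measurable_fun [set: T3] (fun eta => m (sub3 xi eta) * m eta)%E.
  by apply: (measurable_econv_integrand measurable_sub3).
have mmm' : measurable_fun [set: T3] (fun eta => m' (sub3 xi eta) * m' eta)%E.
  by apply: (measurable_econv_integrand measurable_sub3).
have pw eta : ((h eta)%:E + m' (sub3 xi eta) * m' eta <= m (sub3 xi eta) * m eta)%E.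
  set x := sub3 xi eta.
  apply: (@le_trans _ _ ((fnorm (fsub A A') x)%:E * m eta + m' x * m eta)%E); last first.
    by rewrite -ge0_muleDl ?lee_fin ?fnorm_ge0//; exact: lee_wpmul2r.
  apply: (@le_trans _ _ ((fnorm (fsub A A') x)%:E * m eta +
      m' x * ((fnorm (fsub A A') eta)%:E + m' eta))%E); last first.
    by rewrite leeD2l//; exact: lee_wpmul2l.
  rewrite ge0_muleDr ?lee_fin ?fnorm_ge0// addeA leeD2r//.
  apply: (@le_trans _ _ ((fnorm (fsub A A') x)%:E * (fnorm A eta)%:E +
      (fnorm A' x)%:E * (fnorm (fsub A A') eta)%:E)%E).
    by rewrite -!EFinM -EFinD lee_fin fnorm_prod_sub.
  apply: leeD.
    by apply: lee_wpmul2l; rewrite ?lee_fin ?fnorm_ge0.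
  by apply: lee_wpmul2r; rewrite ?lee_fin ?fnorm_ge0.
have ih : (\int[mu3]_eta (h eta)%:E + econv3 m' m' xi <= econv3 m m xi)%E.
  rewrite -ge0_integralD//; last by move=> eta _; exact: mule_ge0.
  apply: ge0_le_integral => //.
  - by move=> eta _; apply: adde_ge0 => //; exact: mule_ge0.
  - exact: emeasurable_funD.
(* Finiteness of the convolution of m with itself at xi makes both complex convolutions genuine
   integrals, so that their difference is the integral of the difference. *)
have gint B j l : fmeas B -> (forall eta, ((fnorm B eta)%:E <= m eta)%E) ->
    cintegrable mu3 [set: T3] (g B j l).
  move=> mB hB; split; first exact: mg.
  apply: le_lt_trans fin; apply: ge0_le_integral => //.
  - by move=> eta _; rewrite lee_fin cmod_ge0.
  - by apply: measurable_EFin_cmod; exact: mg.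
  - move=> eta _; rewrite cmodM EFinM; apply: lee_pmul; rewrite ?lee_fin ?cmod_ge0//.
      by apply: le_trans (hB _); rewrite lee_fin cmod_le_fnorm.
    by apply: le_trans (hB _); rewrite lee_fin cmod_le_fnorm.
have hA'm eta : ((fnorm A' eta)%:E <= m eta)%E by exact: le_trans (hA' _) (m'm _).
have ifin : (\int[mu3]_eta (h eta)%:E)%E \is a fin_num.
  rewrite ge0_fin_numE; last exact: integral_ge0.
  apply: le_lt_trans fin; apply: le_trans ih; rewrite leeDl//.
  exact: econv_ge0.
have dN : \sum_(k < 3) cmod (NSnonlin A xi k - NSnonlin A' xi k) <=
    4^-1 * norm3 xi * fine (\int[mu3]_eta (h eta)%:E)%E.
  apply: NSnonlin_sub_le; rewrite -lee_fin EFinM fineK//.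
  have -> : (\int[mu3]_eta (h eta)%:E = \sum_(j < 3) \sum_(l < 3)
      \int[mu3]_eta (cmod (g A j l eta - g A' j l eta))%:E)%E.
    transitivity (\int[mu3]_eta (\sum_(j < 3) \sum_(l < 3)
        (cmod (g A j l eta - g A' j l eta))%:E))%E.
      by apply: eq_integral => eta _; rewrite -sumEFin; under eq_bigr do rewrite -sumEFin.
    rewrite ge0_integral_sum//; last 2 first.
    - move=> j; apply: emeasurable_fun_sum => l; apply: measurable_EFin_cmod.
      by apply: cmeasB; exact: mg.
    - by move=> j eta _; apply: sume_ge0 => l _; rewrite lee_fin cmod_ge0.
    apply: eq_bigr => j _; rewrite ge0_integral_sum//.
    - by move=> l; apply: measurable_EFin_cmod; apply: cmeasB; exact: mg.
    - by move=> l eta _; rewrite lee_fin cmod_ge0.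
  have I0 j l : (0 <= \int[mu3]_eta (cmod (g A j l eta - g A' j l eta))%:E)%E.
    by apply: integral_ge0 => eta _; rewrite lee_fin cmod_ge0.
  rewrite ge0_sume_distrr; last by move=> j _; apply: sume_ge0.
  rewrite -sumEFin; apply: lee_sum => j _.
  rewrite ge0_sume_distrr// -sumEFin; apply: lee_sum => l _.
  rewrite /Defs.conv -(cintB measurableT (gint A j l mA hA) (gint A' j l mA' hA'm)).
  by apply: cmod_cint_le => //; apply: cmeasB; exact: mg.
have k0 : (0 <= (4^-1 * norm3 xi)%:E)%E by rewrite lee_fin mulr_ge0// norm3_ge0.
apply: (@le_trans _ _ ((4^-1 * norm3 xi)%:E *
    (\int[mu3]_eta (h eta)%:E + econv3 m' m' xi))%E); last exact: lee_wpmul2l.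
rewrite [leRHS]ge0_muleDr//; last 2 first.
- exact: integral_ge0.
- exact: econv_ge0.
rewrite leeD2r// -[X in (_ * X)%E](fineK ifin) -EFinM lee_fin.
exact: dN.
Qed.

End NonlinearComparison.

(** * Construction of the perturbation *)

Section EconvAdditive.
Context {R : realType} {d} {T : measurableType d}.
Context (mu : {sigma_finite_measure set T -> \bar R}) (sub : T -> T -> T).
Hypothesis msub : measurable_fun [set: T * T] (fun p => sub p.1 p.2).
Local Open Scope ereal_scope.
Implicit Types f g h u m : T -> \bar R.

Lemma econvDl f g h x : measurable_fun setT f -> measurable_fun setT g ->
  measurable_fun setT h -> (forall y, 0 <= f y) -> (forall y, 0 <= g y) ->
  (forall y, 0 <= h y) ->
  econv mu sub (fun y => f y + g y) h x = econv mu sub f h x + econv mu sub g h x.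
Proof.
move=> mf mg mh f0 g0 h0; rewrite /econv.
rewrite -(@ge0_integralD _ _ _ mu setT measurableT
  (fun y => f (sub x y) * h y) (fun y => g (sub x y) * h y)).
- by apply: eq_integral => y _; rewrite ge0_muleDl.
- by move=> y _; exact: mule_ge0.
- exact: (measurable_econv_integrand msub).
- by move=> y _; exact: mule_ge0.
- exact: (measurable_econv_integrand msub).
Qed.

Lemma econvDr f g h x : measurable_fun setT f -> measurable_fun setT g ->
  measurable_fun setT h -> (forall y, 0 <= f y) -> (forall y, 0 <= g y) ->
  (forall y, 0 <= h y) ->
  econv mu sub h (fun y => f y + g y) x = econv mu sub h f x + econv mu sub h g x.
Proof.
move=> mf mg mh f0 g0 h0; rewrite /econv.
rewrite -(@ge0_integralD _ _ _ mu setT measurableT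
  (fun y => h (sub x y) * f y) (fun y => h (sub x y) * g y)).
- by apply: eq_integral => y _; rewrite ge0_muleDr.
- by move=> y _; exact: mule_ge0.
- exact: (measurable_econv_integrand msub).
- by move=> y _; exact: mule_ge0.
- exact: (measurable_econv_integrand msub).
Qed.

(** Isolates the square of u, which is common to both sides of a comparison of u + m with u + m' and
    can be cancelled there. *)
Lemma econv_square_add u m x : measurable_fun setT u -> measurable_fun setT m ->
  (forall y, 0 <= u y) -> (forall y, 0 <= m y) ->
  econv mu sub (fun y => u y + m y) (fun y => u y + m y) x =
  econv mu sub u u x + equad mu sub u m x.
Proof.
move=> mU mm u0 m0.
have mum : measurable_fun setT (fun y => u y + m y) by exact: emeasurable_funD.
have um0 y : 0 <= u y + m y by exact: adde_ge0.
rewrite econvDl// !econvDr// /equad -addeA; congr (_ + _).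
by rewrite addeA [RHS]addeAC [RHS]addeC addeA [RHS]addeAC.
Qed.

Local Notation RT := (measurableTypeR R).
Local Notation lam := (@lebesgue_measure R).
Context (U ML : RT -> T -> \bar R).
Hypothesis mU : jmeas U.
Hypothesis U0 : forall s x, 0 <= U s x.
Hypothesis mML : jmeas ML.
Hypothesis ML0 : nonneg ML.

(* [cint] is junk on non-integrable functions, so the iteration is cut off outside
   these two sets; [good_freq] has full measure, and for frequencies in it so do
   the good times. *)
Definition good_time : set (RT * T) :=
  [set p | econv mu sub (U p.1) (U p.1) p.2 < +oo] `&`
  [set p | equad mu sub (U p.1) (ML p.1) p.2 < +oo].

(** One integrand that dominates, up to multiples of the frequency, everything that is integrated in
    time at a fixed frequency: the forcing difference, the nonlinearity of u, and u itself. *)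
Definition total s x : \bar R :=
  equad mu sub (U s) (ML s) x + econv mu sub (U s) (U s) x + U s x.

Definition good_freq : set T :=
  \bigcap_(n : nat) [set x | \int[lam]_(s in `[0%R, n%:R]) total s x < +oo].

Let mQ : jmeas (fun s x => equad mu sub (U s) (ML s) x).
Proof. exact: equad_jmeas. Qed.

Let mC : jmeas (fun s x => econv mu sub (U s) (U s) x).
Proof. exact: jmeas_econv. Qed.

Lemma measurable_good_time : measurable good_time.
Proof.
apply: measurableI; rewrite -[X in measurable X]setTI.
  exact: (emeasurable_fun_infty_o measurableT mC).
exact: (emeasurable_fun_infty_o measurableT mQ).
Qed.

Lemma total_jmeas : jmeas total.
Proof. by apply: emeasurable_funD => //; exact: emeasurable_funD. Qed.

Lemma total_ge0 : nonneg total.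
Proof.
move=> s x; apply: adde_ge0 => //; apply: adde_ge0; first exact: equad_ge0.
exact: econv_ge0.
Qed.

Lemma measurable_good_freq : measurable good_freq.
Proof.
apply: bigcap_measurable => // n _; rewrite -[X in measurable X]setTI.
apply: emeasurable_fun_infty_o => //.
apply: (@measurable_fun_band_integral _ _ _ (cst 0%R) (cst n%:R)
  (fun p : T * RT => total p.2 p.1)) => //.
  exact: (measurableT_comp total_jmeas (@measurable_swap _ _ _ _)).
by move=> p; exact: total_ge0.
Qed.

Lemma good_freq_fin x t : good_freq x -> \int[lam]_(s in `[0%R, t]) total s x < +oo.
Proof.
move=> gx.
have [n tn] : exists n : nat, (t <= n%:R)%R.
  exists (Num.bound `|t|%R); apply: (le_trans (ler_norm _)).
  by rewrite ltW// archi_boundP.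
apply: le_lt_trans (gx n I); apply: ge0_subset_integral => //.
- by apply: measurable_funTS; exact: jmeas_sectionr total_jmeas.
- by move=> s _; exact: total_ge0.
- move=> s /=; rewrite !in_itv/= => /andP[-> st]; exact: le_trans st tn.
Qed.

(** [good_freq] involves integer horizons only, so that countably many null sets are removed, each
    obtained from Tonelli. *)
Lemma good_freq_ae : (forall t, (0 <= t)%R ->
  \int[lam]_(s in `[0%R, t]) \int[mu]_x total s x < +oo) -> {ae mu, forall x, good_freq x}.
Proof.
move=> fin; apply: ae_foralln => n.
have mI : measurable_fun setT (fun x => \int[lam]_(s in `[0%R, n%:R]) total s x).
  apply: (@measurable_fun_band_integral _ _ _ (cst 0%R) (cst n%:R)
    (fun p : T * RT => total p.2 p.1)) => //.
    exact: (measurableT_comp total_jmeas (@measurable_swap _ _ _ _)).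
  by move=> p; exact: total_ge0.
have I0 x : 0 <= \int[lam]_(s in `[0%R, n%:R]) total s x.
  by apply: integral_ge0 => s _; exact: total_ge0.
have : mu.-integrable setT (fun x => \int[lam]_(s in `[0%R, n%:R]) total s x).
  apply/integrableP; split => //.
  under eq_integral do rewrite gee0_abs//.
  rewrite integral_time_swap; [exact: fin|exact: total_jmeas|exact: total_ge0].
move=> /(integrable_ae measurableT); apply: filterS => x /(_ I).
by rewrite ge0_fin_numE.
Qed.

End EconvAdditive.

(** Carries a pointwise comparison between increment and forcings through the Duhamel integral; e is
    the exponential weight there. *)
Lemma weighted_integral_le d (T : measurableType d) (R : realType)
    (mu : {measure set T -> \bar R}) (A : set T) (c : R) (e f g h : T -> \bar R) :
  measurable A -> 0 <= c -> measurable_fun setT e -> measurable_fun setT f ->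
  measurable_fun setT g -> measurable_fun setT h ->
  (forall x, 0 <= e x)%E -> (forall x, 0 <= f x)%E -> (forall x, 0 <= g x)%E ->
  (forall x, 0 <= h x)%E -> (forall x, c%:E * f x + g x <= h x)%E ->
  (c%:E * \int[mu]_(x in A) (e x * f x) + \int[mu]_(x in A) (e x * g x) <=
   \int[mu]_(x in A) (e x * h x))%E.
Proof.
move=> mA c0 me mf mg mh e0 f0 g0 h0 fgh.
have mM (k : T -> \bar R) : measurable_fun setT k ->
    measurable_fun A (fun x => e x * k x)%E.
  by move=> mk; apply: measurable_funTS; exact: emeasurable_funM.
have M0 (k : T -> \bar R) x : (forall x, 0 <= k x)%E -> (0 <= e x * k x)%E.
  by move=> k0; exact: mule_ge0.
have cM0 x : (0 <= c%:E * (e x * f x))%E by apply: mule_ge0 => //; exact: M0.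
rewrite -ge0_integralZl//; [|exact: mM|by move=> x _; exact: M0].
rewrite -ge0_integralD//; first last.
- exact: mM.
- by move=> x _; exact: M0.
- by apply: measurable_funeM; exact: mM.
apply: ge0_le_integral => //.
- by move=> x _; apply: adde_ge0 => //; exact: M0.
- by apply: emeasurable_funD; [apply: measurable_funeM; exact: mM|exact: mM].
- exact: mM.
move=> x _; rewrite muleCA -ge0_muleDr//; first exact: lee_wpmul2l.
exact: mule_ge0.
Qed.

(** * One Picard step for the difference field *)

Section Perturbation.
Context {R : realType}.
Local Open Scope complex_scope.
Local Notation RT := (measurableTypeR R).
Local Notation T3 := (RT * RT * RT)%type.
Local Notation field := (@Field R).
Local Notation lam := (@lebesgue_measure R).
Local Notation econv3 := (econv mu3 (@sub3 R)).
Local Notation equad3 := (equad mu3 (@sub3 R)).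
Implicit Types (W : R -> field) (xi : @R3 R).

Definition jfmeas W := forall k, cmeas [set: RT * T3] (fun p => W p.1 p.2 k).

Definition fadd (f g : field) : field := fun xi k => f xi k + g xi k.

Definition fnormE W (s : RT) (xi : T3) : \bar R := (fnorm (W s) xi)%:E.

Lemma fnormE_ge0 W : nonneg (fnormE W).
Proof. by move=> s xi; rewrite lee_fin fnorm_ge0. Qed.

Lemma jfmeas_section W s : jfmeas W -> fmeas (W s).
Proof. by move=> mW k; exact: (cmeas_comp (mW k) (measurable_pair1 (s : RT))). Qed.

Lemma jfmeas_sectionr W xi k : jfmeas W -> cmeas [set: RT] (fun s => W s xi k).
Proof. by move=> mW; exact: (cmeas_comp (mW k) (measurable_pair2 (xi : T3))). Qed.

Lemma fnormE_jmeas W : jfmeas W -> jmeas (fnormE W).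
Proof.
move=> mW; apply/measurable_EFinP; apply: measurable_sum => k.
exact: measurable_cmod (mW k).
Qed.

Lemma jfmeas_add W W' : jfmeas W -> jfmeas W' -> jfmeas (fun s => fadd (W s) (W' s)).
Proof. by move=> mW mW' k; exact: cmeasD. Qed.

Lemma measurable_leray k l : measurable_fun [set: T3] (fun xi =>
  (k == l)%:R - Defs.coord xi k * Defs.coord xi l / norm3 xi ^+ 2 : RT).
Proof.
apply: measurable_funB => //; apply: measurable_funM.
  by apply: measurable_funM; exact: measurable_coord.
under eq_fun do rewrite -exprVn.
apply: measurable_funX; apply: (mrhoV measurable_norm3); exact: norm3_ge0.
Qed.

Lemma NSnonlin_jfmeas W : jfmeas W -> jfmeas (fun s => NSnonlin (W s)).
Proof.
move=> mW k; apply: cmeas_sum => l; apply: cmeasM.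
  apply: cmeas_real.
  exact: (measurableT_comp (measurable_leray k l) (@measurable_snd _ _ RT T3)).
apply: cmeas_sum => j; apply: cmeasM.
  apply: cmeasM; last exact: cmeas_cst.
  apply: cmeasM; first exact: cmeas_cst.
  apply: cmeas_real.
  exact: (measurableT_comp (measurable_coord j) (@measurable_snd _ _ RT T3)).
apply: (@cmeas_cint_param _ _ _ _ _ mu3
  (fun q : (RT * T3) * T3 => W q.1.1 (sub3 q.1.2 q.2) j * W q.1.1 q.2 l)).
have m1 : measurable_fun [set: (RT * T3) * T3] (fun q => q.1.1).
  exact: (measurableT_comp measurable_fst measurable_fst).
have m2 : measurable_fun [set: (RT * T3) * T3] (fun q => q.1.2).
  exact: (measurableT_comp measurable_snd measurable_fst).
have m3 : measurable_fun [set: (RT * T3) * T3] (fun q => q.2).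
  exact: measurable_snd.
apply: cmeasM; last exact: (cmeas_comp (mW l) (measurable_fun_pair m1 m3)).
exact: (cmeas_comp (mW j) (measurable_fun_pair m1
  (measurableT_comp measurable_sub3 (measurable_fun_pair m2 m3)))).
Qed.

Lemma cint_mkcond d (T : measurableType d) (mu : {measure set T -> \bar R})
    (D : set T) (g : T -> R[i]) :
  cint mu D g = cint mu setT (fun x => (\1_D x)%:C * g x).
Proof.
have patchE' (f : T -> R) x : (f \_ D) x = \1_D x * f x.
  by rewrite patchE indicE; case: ifPn => _; rewrite ?mul1r ?mul0r.
apply: complex_ext; rewrite ?Re_cint ?Im_cint Rintegral_mkcond;
  apply: eq_Rintegral => x _; rewrite patchE' ?Re_scale ?Im_scale//.
Qed.

Lemma cmeas_cint_band d (X : measurableType d) (a b : X -> R) (g : X * RT -> R[i]) :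
  measurable_fun setT a -> measurable_fun setT b -> cmeas setT g ->
  cmeas setT (fun x => cint lam `[a x, b x] (fun s => g (x, s))).
Proof.
move=> ma mb mg; pose B := [set p : X * RT | (a p.1 <= p.2 <= b p.1)%R].
rewrite (_ : (fun x => _) = fun x => cint lam setT (fun s =>
    (\1_B (x, s))%:C * g (x, s))); last first.
  apply/funext => x; rewrite cint_mkcond; apply: eq_cint => s _.
  by congr (_ %:C * _).
apply: (@cmeas_cint_param _ _ _ _ _ lam (fun p => (\1_B p)%:C * g p)).
apply: cmeasM => //; apply: cmeas_real; apply: measurable_indic.
exact: measurable_band.
Qed.

(** C will be the convolution of U with itself, and its finiteness at good times is what allows the
    cancellation. *)
Lemma scaled_cancel (k : R) (S C Q Q' : \bar R) :
  (0 <= C -> 0 <= Q -> 0 <= Q' -> C < +oo ->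
  S + k%:E * (C + Q') <= k%:E * (C + Q) -> S + k%:E * Q' <= k%:E * Q)%E.
Proof.
move=> C0 Q0 Q'0 Coo; have Cfin : C \is a fin_num by rewrite ge0_fin_numE.
by rewrite !muleDr// ?ge0_adde_def ?inE// addeCA leeD2lE// fin_numM.
Qed.

Lemma cmod_scaleB (e : R) (z w : R[i]) : 0 <= e ->
  cmod (e%:C * z - e%:C * w) = e * cmod (w - z).
Proof. by move=> e0; rewrite -mulrBr cmodM cmod_real ger0_norm// cmodB_sym. Qed.

Lemma subr_subl (V : zmodType) (x y z : V) : x - z - (y - z) = x - y.
Proof. by rewrite opprB addrA subrK. Qed.

Lemma subr_subr (V : zmodType) (x y z : V) : z - x - (z - y) = y - x.
Proof. by rewrite opprB addrC addrA subrK. Qed.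

Lemma indic_scale_in (T : Type) (A : set T) x (z : R[i]) :
  x \in A -> (\1_A x)%:C * z = z.
Proof. by move=> Ax; rewrite indicE Ax mul1r. Qed.

Lemma indic_scale_notin (T : Type) (A : set T) x (z : R[i]) :
  x \notin A -> (\1_A x)%:C * z = 0.
Proof. by move=> Ax; rewrite indicE (negbTE Ax) mul0r. Qed.

Context (nu : R) (u : R -> field) (w0 : field).
Hypothesis nu_gt0 : 0 < nu.
Hypothesis mu_u : jfmeas u.
Hypothesis mw0 : fmeas w0.

Local Notation U := (fnormE u).
Local Notation b := (fun xi : T3 => (fnorm w0 xi)%:E).
Local Notation pic := (picard mu3 (@sub3 R) (@norm3 R) nu U b).
Context (ML : RT -> T3 -> \bar R).
Hypothesis mML : jmeas ML.
Hypothesis ML0 : nonneg ML.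

Let mU : jmeas U. Proof. exact: fnormE_jmeas. Qed.
Let U0 : forall s xi, (0 <= U s xi)%E. Proof. exact: fnormE_ge0. Qed.
Let mb : measurable_fun [set: T3] b.
Proof. by apply/measurable_EFinP; exact: measurable_fnorm. Qed.
Let b0 : forall xi, (0 <= b xi)%E. Proof. by move=> xi; rewrite lee_fin fnorm_ge0. Qed.
Definition kappa xi : R := nu * norm3 xi ^+ 2.

Local Notation good_time3 := (good_time mu3 (@sub3 R) U ML).
Local Notation good_freq3 := (good_freq mu3 (@sub3 R) U ML).

Definition forcing_diff W s : field := fun xi k =>
  (\1_good_time3 (s, xi))%:C *
  (NSnonlin (fadd (u s) (W s)) xi k - NSnonlin (u s) xi k).

(** Off [good_freq] the value is 0, which every majorant bounds, so that domination holds at all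
    frequencies and not only almost everywhere. *)
Definition wstep W t : field := fun xi k =>
  (\1_good_freq3 xi)%:C * ((expR (- (kappa xi * t)))%:C * w0 xi k -
    cint lam `[0%R, t] (fun s => (expR (- (kappa xi * (t - s))))%:C * forcing_diff W s xi k)).

Lemma measurable_good_time3 : measurable good_time3.
Proof. exact: (measurable_good_time mu3 measurable_sub3 mU U0 mML ML0). Qed.

Lemma measurable_good_freq3 : measurable good_freq3.
Proof. exact: (measurable_good_freq mu3 measurable_sub3 mU U0 mML ML0). Qed.

Lemma forcing_diff_jfmeas W : jfmeas W -> jfmeas (forcing_diff W).
Proof.
move=> mW k; apply: cmeasM.
  apply: cmeas_real.
  rewrite (_ : (fun p : RT * T3 => _) = \1_good_time3); last by apply/funext => -[].
  by apply: measurable_indic; exact: measurable_good_time3.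
apply: cmeasB; last exact: (NSnonlin_jfmeas mu_u k).
exact: (NSnonlin_jfmeas (jfmeas_add mu_u mW) k).
Qed.

Lemma measurable_kappa : measurable_fun [set: T3] (kappa : T3 -> RT).
Proof. by apply: measurable_funM => //; apply: measurable_funX; exact: measurable_norm3. Qed.

Lemma kappa_nneg xi : 0 <= kappa xi.
Proof. by rewrite mulr_ge0 ?sqr_ge0// ltW. Qed.

Lemma wstep_jfmeas W : jfmeas W -> jfmeas (wstep W).
Proof.
move=> mW k.
have mk2 := measurableT_comp measurable_kappa (@measurable_snd _ _ RT T3).
apply: cmeasM.
  apply: cmeas_real.
  have mi : measurable_fun [set: T3] (\1_good_freq3 : T3 -> RT).
    by apply: measurable_indic; exact: measurable_good_freq3.
  exact: (measurableT_comp mi (@measurable_snd _ _ RT T3)).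
apply: cmeasB.
  apply: cmeasM; last exact: (cmeas_comp (mw0 k) (@measurable_snd _ _ RT T3)).
  apply: cmeas_real; apply/measurable_EFinP.
  by apply: measurable_decay => //; exact: measurable_fst.
apply: (@cmeas_cint_band _ _ (cst 0%R) fst (fun q : (RT * T3) * RT =>
  (expR (- (kappa q.1.2 * (q.1.1 - q.2))))%:C * forcing_diff W q.2 q.1.2 k)) => //.
have m1 : measurable_fun [set: (RT * T3) * RT] (fun q => q.1.1).
  exact: (measurableT_comp measurable_fst measurable_fst).
have m2 : measurable_fun [set: (RT * T3) * RT] (fun q => q.1.2).
  exact: (measurableT_comp measurable_snd measurable_fst).
have m3 : measurable_fun [set: (RT * T3) * RT] (fun q => q.2).
  exact: measurable_snd.
apply: cmeasM; last exact: (cmeas_comp (forcing_diff_jfmeas mW k) (measurable_fun_pair m3 m2)).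
apply: cmeas_real; apply/measurable_EFinP; apply: measurable_decay.
  exact: (measurableT_comp measurable_kappa m2).
exact: measurable_funB.
Qed.

Lemma forcing_diff_bad W s xi k : (s, xi) \notin good_time3 -> forcing_diff W s xi k = 0.
Proof. exact: indic_scale_notin. Qed.

Lemma forcing_diff_good W s xi k : (s, xi) \in good_time3 ->
  forcing_diff W s xi k = NSnonlin (fadd (u s) (W s)) xi k - NSnonlin (u s) xi k.
Proof. exact: indic_scale_in. Qed.

Lemma wstep_bad W t xi k : xi \notin good_freq3 -> wstep W t xi k = 0.
Proof. exact: indic_scale_notin. Qed.

Lemma wstep_good W t xi k : xi \in good_freq3 -> wstep W t xi k =
  (expR (- (kappa xi * t)))%:C * w0 xi k -
    cint lam `[0%R, t] (fun s => (expR (- (kappa xi * (t - s))))%:C * forcing_diff W s xi k).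
Proof. exact: indic_scale_in. Qed.

(* In place of a contraction estimate: increments of the fields are bounded by
   increments of their majorants, so that convergence of the latter suffices. *)
Definition dominated W W' (M M' : RT -> T3 -> \bar R) :=
  (forall s xi, ((fnorm (fsub (W s) (W' s)) xi)%:E + M' s xi <= M s xi)%E) /\
  (forall s xi, ((fnorm (W' s) xi)%:E <= M' s xi)%E).

Lemma dominated_props W W' M M' : dominated W W' M M' ->
  [/\ nonneg M', (forall s xi, (M' s xi <= M s xi)%E), nonneg M &
      forall s xi, ((fnorm (W s) xi)%:E <= M s xi)%E].
Proof.
move=> [h1 h2].
have M'0 : nonneg M' by move=> s xi; apply: le_trans (h2 s xi); rewrite lee_fin fnorm_ge0.
have MM s xi : (M' s xi <= M s xi)%E.
  by apply: le_trans (h1 s xi); rewrite leeDr// lee_fin fnorm_ge0.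
split => //; first by move=> s xi; exact: le_trans (MM s xi).
move=> s xi; apply: le_trans (h1 s xi).
apply: (@le_trans _ _ ((fnorm (fsub (W s) (W' s)) xi)%:E + (fnorm (W' s) xi)%:E)%E).
  by rewrite -EFinD lee_fin fnorm_le_sub.
by rewrite leeD2l.
Qed.

(** [NSnonlin_compare] is applied to u + W and u + W' with the majorants U + M and U + M', and the
    square of U cancels. At bad times the fields contribute 0 and monotonicity in the majorant
    remains. *)
Lemma forcing_diff_compare W W' (M M' : RT -> T3 -> \bar R) s xi :
  jfmeas W -> jfmeas W' -> jmeas M -> jmeas M' -> dominated W W' M M' ->
  (forall s xi, (M s xi <= ML s xi)%E) ->
  ((\sum_(k < 3) cmod (forcing_diff W s xi k - forcing_diff W' s xi k))%:E +
    (4^-1 * norm3 xi)%:E * equad3 (U s) (M' s) xi <=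
    (4^-1 * norm3 xi)%:E * equad3 (U s) (M s) xi)%E.
Proof.
move=> mW mW' mM mM' dom MML.
have [M'0 M'M M0 WM] := dominated_props dom; have [h1 h2] := dom.
have c0 : (0 <= (4^-1 * norm3 xi)%:E)%E by rewrite lee_fin mulr_ge0// norm3_ge0.
have mUs : measurable_fun [set: T3] (U s) by exact: (jmeas_section s mU).
have mMs : measurable_fun [set: T3] (M s) by exact: (jmeas_section s mM).
have mMs' : measurable_fun [set: T3] (M' s) by exact: (jmeas_section s mM').
have mMLs : measurable_fun [set: T3] (ML s) by exact: (jmeas_section s mML).
have [gt|ngt] := boolP ((s, xi) \in good_time3); last first.
  rewrite big1 ?add0e; last first.
    by move=> k _; rewrite !forcing_diff_bad// subrr cmod0.
  apply: lee_wpmul2l => //.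
  exact: (le_equad mu3 measurable_sub3 xi mUs mMs' mMs (U0 s) (M'0 s) (M'M s)).
have [gt1 gt2] : (econv3 (U s) (U s) xi < +oo)%E /\ (equad3 (U s) (ML s) xi < +oo)%E.
  by move: gt; rewrite inE.
rewrite (_ : \sum_(k < 3) _ = \sum_(k < 3)
    cmod (NSnonlin (fadd (u s) (W s)) xi k - NSnonlin (fadd (u s) (W' s)) xi k)); last first.
  apply: eq_bigr => k _; rewrite !forcing_diff_good//; congr cmod.
  exact: subr_subl.
have eM : (equad3 (U s) (M s) xi < +oo)%E.
  apply: le_lt_trans gt2.
  exact: (le_equad mu3 measurable_sub3 xi mUs mMs mMLs (U0 s) (M0 s) (MML s)).
have eC := econv_square_add mu3 measurable_sub3 xi mUs mMs (U0 s) (M0 s).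
have eC' := econv_square_add mu3 measurable_sub3 xi mUs mMs' (U0 s) (M'0 s).
have C0 : (0 <= econv3 (U s) (U s) xi)%E by exact: econv_ge0.
have Q0 : (0 <= equad3 (U s) (M s) xi)%E by exact: equad_ge0.
have Q'0 : (0 <= equad3 (U s) (M' s) xi)%E by exact: equad_ge0.
have mA := jfmeas_section s (jfmeas_add mu_u mW).
have mA' := jfmeas_section s (jfmeas_add mu_u mW').
have := @NSnonlin_compare R _ _ (fun eta => U s eta + M s eta)%E
  (fun eta => U s eta + M' s eta)%E xi mA mA'
  (emeasurable_funD mUs mMs) (emeasurable_funD mUs mMs').
rewrite eC eC'.
set S := (\sum_(k < 3) _)%:E => /(_ _ _ _)/wrap[||//|].
- move=> eta.
  rewrite (_ : fnorm _ eta = fnorm (fsub (W s) (W' s)) eta); last first.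
    by apply: eq_bigr => k _; congr cmod; rewrite /fsub /fadd opprD addrACA subrr add0r.
  by rewrite addeCA leeD2l.
- move=> eta; apply: (@le_trans _ _ (U s eta + (fnorm (W' s) eta)%:E)%E).
    rewrite -EFinD lee_fin /fnorm -big_split/=; apply: ler_sum => k _.
    exact: cmodD_le.
  by rewrite leeD2l.
- by rewrite lte_add_pinfty.
exact: scaled_cancel.
Qed.

Lemma fnorm0 xi : fnorm (fun _ _ => 0) xi = 0.
Proof. by rewrite /fnorm big1// => k _; rewrite cmod0. Qed.

(** With the zero field and the zero majorant as second pair, increment estimates specialise to
    plain bounds. *)
Lemma dominated0 W (M : RT -> T3 -> \bar R) :
  (forall s xi, ((fnorm (W s) xi)%:E <= M s xi)%E) ->
  dominated W (fun _ _ _ => 0) M (fun _ _ => 0%E).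
Proof.
move=> WM; split => s xi; last by rewrite fnorm0.
rewrite adde0 (_ : fnorm _ xi = fnorm (W s) xi)//.
by apply: eq_bigr => k _; rewrite /fsub subr0.
Qed.

Lemma jfmeas0 : jfmeas (fun _ _ _ => 0).
Proof. by move=> k; exact: cmeas_cst. Qed.

Lemma forcing_diff0 s xi k : forcing_diff (fun _ _ _ => 0) s xi k = 0.
Proof.
rewrite /forcing_diff (_ : fadd (u s) (fun _ _ => 0) = u s) ?subrr ?mulr0//.
by apply/funext => eta; apply/funext => j; rewrite /fadd addr0.
Qed.

Lemma equad0r (m : T3 -> \bar R) xi : equad3 m (fun _ => 0%E) xi = 0%E.
Proof.
rewrite /equad /econv !integral0_eq ?adde0// => *; by rewrite ?mul0e ?mule0.
Qed.

Lemma forcing_diff_bound W (M : RT -> T3 -> \bar R) s xi :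
  jfmeas W -> jmeas M -> (forall s xi, ((fnorm (W s) xi)%:E <= M s xi)%E) ->
  (forall s xi, (M s xi <= ML s xi)%E) ->
  ((\sum_(k < 3) cmod (forcing_diff W s xi k))%:E <=
    (4^-1 * norm3 xi)%:E * equad3 (U s) (M s) xi)%E.
Proof.
move=> mW mM WM MML.
have m0 : jmeas (fun (_ : RT) (_ : T3) => 0%E : \bar R) by exact: measurable_cst.
have := forcing_diff_compare s xi mW jfmeas0 mM m0 (dominated0 WM) MML.
rewrite equad0r mule0 adde0; under eq_bigr do rewrite forcing_diff0 subr0.
by [].
Qed.

Lemma forcing_diff_cintegrable W (M : RT -> T3 -> \bar R) t xi k :
  jfmeas W -> jmeas M -> (forall s xi, ((fnorm (W s) xi)%:E <= M s xi)%E) ->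
  (forall s xi, (M s xi <= ML s xi)%E) -> good_freq3 xi ->
  cintegrable lam `[0%R, t] (fun s => forcing_diff W s xi k).
Proof.
move=> mW mM WM MML gf.
have mfd := jfmeas_sectionr xi k (forcing_diff_jfmeas mW).
split; first by split; apply: measurable_funTS; [exact: (proj1 mfd)|exact: (proj2 mfd)].
have M0 : nonneg M by move=> s eta; apply: le_trans (WM s eta); rewrite lee_fin fnorm_ge0.
have fin := good_freq_fin measurable_sub3 mU U0 mML ML0 t gf.
have mtot := total_jmeas mu3 measurable_sub3 mU U0 mML ML0.
have tot0 := total_ge0 mu3 (@sub3 R) U0 ML0.
have c0 : (0 <= (4^-1 * norm3 xi)%:E)%E by rewrite lee_fin mulr_ge0// norm3_ge0.
apply: (@le_lt_trans _ _ ((4^-1 * norm3 xi)%:E *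
    \int[lam]_(s in `[0%R, t]) total mu3 (@sub3 R) U ML s xi)%E).
  rewrite -ge0_integralZl//; last first.
    by apply: measurable_funTS; exact: jmeas_sectionr mtot.
  apply: ge0_le_integral => //.
  - by move=> s _; rewrite lee_fin cmod_ge0.
  - by apply: measurable_funTS; exact: measurable_EFin_cmod.
  - by apply: measurable_funTS; apply: measurable_funeM; exact: jmeas_sectionr mtot.
  move=> s _; apply: (@le_trans _ _ (\sum_(k < 3) cmod (forcing_diff W s xi k))%:E).
    rewrite lee_fin (bigD1 k)//= lerDl; apply: sumr_ge0 => i _; exact: cmod_ge0.
  apply: (le_trans (forcing_diff_bound s xi mW mM WM MML)).
  apply: lee_wpmul2l => //; rewrite /total -addeA.
  apply: (@le_trans _ _ (equad3 (U s) (ML s) xi)); last first.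
    by rewrite leeDl//; apply: adde_ge0 => //; exact: econv_ge0.
  exact: (le_equad mu3 measurable_sub3 xi (jmeas_section s mU) (jmeas_section s mM)
    (jmeas_section s mML) (U0 s) (M0 s) (MML s)).
by apply: lte_mul_pinfty.
Qed.

Lemma decay_forcing_cintegrable W (M : RT -> T3 -> \bar R) t xi k :
  jfmeas W -> jmeas M -> (forall s xi, ((fnorm (W s) xi)%:E <= M s xi)%E) ->
  (forall s xi, (M s xi <= ML s xi)%E) -> good_freq3 xi ->
  cintegrable lam `[0%R, t]
    (fun s => (expR (- (kappa xi * (t - s))))%:C * forcing_diff W s xi k).
Proof.
move=> mW mM WM MML gf.
have [mf fin] := forcing_diff_cintegrable t k mW mM WM MML gf.
have mG : cmeas `[0%R, t]
    (fun s => (expR (- (kappa xi * (t - s))))%:C * forcing_diff W s xi k).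
  apply: cmeasM => //; apply: cmeas_real; apply: measurable_funTS.
  by apply/measurable_EFinP; exact: measurable_decayB.
split => //; apply: le_lt_trans fin; apply: ge0_le_integral => //.
- by move=> s _; rewrite lee_fin cmod_ge0.
- exact: measurable_EFin_cmod.
- exact: measurable_EFin_cmod.
move=> s; rewrite /= in_itv/= => /andP[_ st].
rewrite lee_fin cmodM cmod_real ger0_norm ?expR_ge0//.
by rewrite ler_piMl ?cmod_ge0// decay_le1 ?kappa_nneg ?subr_ge0.
Qed.

(** The free evolution of w0 drops out of the difference of the fields and is the same summand in
    both majorants. The factor 2 of [cmod_cint_le], now for the time integral, turns the 1/4 of
    [forcing_diff_compare] into the 1/2 of [forcing]. *)
Lemma wstep_compare W W' (M M' : RT -> T3 -> \bar R) t xi :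
  jfmeas W -> jfmeas W' -> jmeas M -> jmeas M' -> dominated W W' M M' ->
  (forall s xi, (M s xi <= ML s xi)%E) ->
  ((fnorm (fsub (wstep W t) (wstep W' t)) xi)%:E + pic M' t xi <= pic M t xi)%E.
Proof.
move=> mW mW' mM mM' dom MML.
have [M'0 M'M M0 WM] := dominated_props dom.
have W'M' := proj2 dom.
have M'ML s eta : (M' s eta <= ML s eta)%E by exact: le_trans (M'M s eta) (MML s eta).
have [gf|ngf] := boolP (xi \in good_freq3); last first.
  rewrite /fnorm big1; last first.
    by move=> k _; rewrite /fsub !wstep_bad// subrr cmod0.
  rewrite add0e.
  exact: (le_picard mu3 measurable_sub3 measurable_norm3 (@norm3_ge0 R)
    nu b mU U0 t xi mM' M'0 mM M'M).
have gf' : good_freq3 xi by rewrite inE in gf.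
pose E s : R := expR (- (kappa xi * (t - s))).
pose D s : R := \sum_(k < 3) cmod (forcing_diff W s xi k - forcing_diff W' s xi k).
have E0 s : (0 <= (E s)%:E)%E by rewrite lee_fin expR_ge0.
have D0 s : (0 <= (D s)%:E)%E.
  by rewrite lee_fin; apply: sumr_ge0 => k _; exact: cmod_ge0.
have mE : measurable_fun [set: RT] (fun s => (E s)%:E).
  exact: measurable_decayB.
have mfd k := jfmeas_sectionr xi k (forcing_diff_jfmeas mW).
have mfd' k := jfmeas_sectionr xi k (forcing_diff_jfmeas mW').
have md k : measurable_fun [set: RT]
    (fun s => (cmod (forcing_diff W s xi k - forcing_diff W' s xi k))%:E).
  by apply: measurable_EFin_cmod; exact: cmeasB.
have mD : measurable_fun [set: RT] (fun s => (D s)%:E).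
  apply/measurable_EFinP; apply: measurable_sum => k.
  by apply: measurable_cmod; exact: cmeasB.
have mf := jmeas_sectionr xi (forcing_jmeas mu3 measurable_sub3 measurable_norm3 mU U0 mM M0).
have mf' := jmeas_sectionr xi (forcing_jmeas mu3 measurable_sub3 measurable_norm3 mU U0 mM' M'0).
have f0 := forcing_ge0 mu3 (@sub3 R) (@norm3_ge0 R) U0 M0.
have f'0 := forcing_ge0 mu3 (@sub3 R) (@norm3_ge0 R) U0 M'0.
have fn : ((fnorm (fsub (wstep W t) (wstep W' t)) xi)%:E <=
    2%:E * \int[lam]_(s in `[0%R, t]) ((E s)%:E * (D s)%:E))%E.
  have -> : (\int[lam]_(s in `[0%R, t]) ((E s)%:E * (D s)%:E) = \sum_(k < 3)
      \int[lam]_(s in `[0%R, t]) ((E s)%:E *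
        (cmod (forcing_diff W s xi k - forcing_diff W' s xi k))%:E))%E.
    rewrite -ge0_integral_sum//.
    - apply: eq_integral => s _; rewrite -ge0_sume_distrr ?sumEFin// => k _.
      by rewrite lee_fin cmod_ge0.
    - by move=> k; apply: measurable_funTS; exact: emeasurable_funM.
    - by move=> k s _; rewrite mule_ge0// lee_fin cmod_ge0.
  rewrite ge0_sume_distrr; last first.
    by move=> k _; apply: integral_ge0 => s _; rewrite mule_ge0// lee_fin cmod_ge0.
  rewrite /fnorm -sumEFin; apply: lee_sum => k _.
  rewrite /fsub !wstep_good// subr_subr.
  have iW := decay_forcing_cintegrable t k mW mM WM MML gf'.
  have iW' := decay_forcing_cintegrable t k mW' mM' W'M' M'ML gf'.
  have mitv : measurable (`[0%R, t] : set RT) by [].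
  rewrite -(cintB mitv iW' iW) -/E.
  apply: (le_trans (@cmod_cint_le _ _ _ lam _ mitv _ (cmeasB (proj1 iW') (proj1 iW)))).
  apply: lee_wpmul2l => //; rewrite le_eqVlt; apply/orP; left; apply/eqP.
  apply: eq_integral => s _.
  by rewrite -EFinM; congr EFin; apply: cmod_scaleB; exact: expR_ge0.
apply: (le_trans (leeD2r _ fn)).
rewrite /picard addeCA leeD2l// /duhamel -/(kappa xi).
have W2 := @weighted_integral_le _ _ _ lam `[0%R, t] 2 _ _ _ _ (measurable_itv _) (ler0n R 2) mE mD mf' mf E0 D0.
apply: (W2 (f'0^~ xi) (f0^~ xi)).
move=> s; have := forcing_diff_compare s xi mW mW' mM mM' dom MML; rewrite -/(D s) => h.
rewrite /forcing (_ : 2^-1 * norm3 xi = 2 * (4^-1 * norm3 xi))%R; last by lra.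
rewrite EFinM -!muleA -ge0_muleDr//; last first.
  apply: mule_ge0; last exact: equad_ge0.
  by rewrite lee_fin mulr_ge0// norm3_ge0.
by apply: lee_wpmul2l.
Qed.

End Perturbation.

(** * Convergence of the Picard iterates *)

Section MajorizedLimit.
Context {R : realType}.

(* Both m and a + m are nondecreasing and bounded. *)
Lemma majorized_is_cvg (a m : R ^nat) (M : R) :
  (forall n p, (n <= p)%N -> `|a p - a n| + m n <= m p) ->
  (forall n, m n <= M) -> cvgn a.
Proof.
move=> h mM.
have nd n p : (n <= p)%N -> m n <= m p /\ a n + m n <= a p + m p.
  move=> np; have := h _ _ np; rewrite -lerBrDr ler_norml => /andP[h1 h2].
  by split; lra.
have cm : cvgn m.
  apply: nondecreasing_is_cvgn; first by move=> n p /nd[].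
  by exists M => _ [n _ <-].
have cam : cvgn (fun n => a n + m n).
  apply: nondecreasing_is_cvgn; first by move=> n p /nd[].
  exists (a 0%N + M - m 0%N + M) => _ [n _ <-].
  have := h 0%N n isT; rewrite -lerBrDr ler_norml => /andP[h1 h2].
  by have := mM n; lra.
rewrite (_ : a = (fun n => (a n + m n) - m n)); last by apply/funext => n; rewrite addrK.
exact: is_cvgB.
Qed.

Lemma cmod_cvg (z : nat -> R[i]) (c : R[i]) :
  (fun n => complex.Re (z n)) @ \oo --> complex.Re c ->
  (fun n => complex.Im (z n)) @ \oo --> complex.Im c ->
  (fun n => cmod (z n)) @ \oo --> cmod c.
Proof.
move=> cR cI; rewrite /cmod.
have cv : (fun n => complex.Re (z n) ^+ 2 + complex.Im (z n) ^+ 2) @ \oo -->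
    complex.Re c ^+ 2 + complex.Im c ^+ 2 by apply: cvgD; apply: cvgM.
exact: (continuous_cvg _ (@sqrt_continuous R _) cv).
Qed.

Lemma cmod_eq0 (z : R[i]) : cmod z = 0 -> z = 0.
Proof. by move=> z0; apply/eqP; rewrite -normr_eq0 -cmodE z0. Qed.

Lemma ReB (z w : R[i]) : complex.Re (z - w) = complex.Re z - complex.Re w.
Proof. by case: z; case: w. Qed.

Lemma ImB (z w : R[i]) : complex.Im (z - w) = complex.Im z - complex.Im w.
Proof. by case: z; case: w. Qed.

End MajorizedLimit.

Section Iteration.
Context {R : realType}.
Local Open Scope complex_scope.
Local Notation RT := (measurableTypeR R).
Local Notation T3 := (RT * RT * RT)%type.
Local Notation field := (@Field R).
Local Notation lam := (@lebesgue_measure R).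
Local Notation equad3 := (equad mu3 (@sub3 R)).
Implicit Types (W : R -> field) (xi : @R3 R).
Context (nu : R) (u : R -> field) (w0 : field).
Hypothesis nu_gt0 : 0 < nu.
Hypothesis mu_u : jfmeas u.
Hypothesis mw0 : fmeas w0.
Local Notation U := (fnormE u).
Local Notation b := (fun xi : T3 => (fnorm w0 xi)%:E).
Local Notation pic := (picard mu3 (@sub3 R) (@norm3 R) nu U b).
Context (ML : RT -> T3 -> \bar R) (Mn : nat -> RT -> T3 -> \bar R).
Hypothesis mML : jmeas ML.
Hypothesis ML0 : nonneg ML.
Hypothesis ML_fixpoint : forall t xi, pic ML t xi = ML t xi.
Hypothesis Mn_0 : forall t xi, Mn 0%N t xi = 0%E.
Hypothesis Mn_S : forall n t xi, Mn n.+1 t xi = pic (Mn n) t xi.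
Hypothesis mMn : forall n, jmeas (Mn n).
Hypothesis Mn_ML : forall n t xi, (Mn n t xi <= ML t xi)%E.
Hypothesis Mn_cvg : forall t xi, (fun n => Mn n t xi) @ \oo --> ML t xi.
Local Notation good_freq3 := (good_freq mu3 (@sub3 R) U ML).
Local Notation step := (wstep nu u w0 ML).

Let mU : jmeas U. Proof. exact: fnormE_jmeas. Qed.
Let U0 : forall s xi, (0 <= U s xi)%E. Proof. exact: fnormE_ge0. Qed.

Definition witer n : R -> field := iter n step (fun _ _ _ => 0).

Lemma witer_jfmeas n : jfmeas (witer n).
Proof.
elim: n => [|n IHn]; first exact: jfmeas0.
exact: (wstep_jfmeas nu mu_u mw0 mML ML0 IHn).
Qed.

Lemma witer_bad n t xi k : xi \notin good_freq3 -> witer n t xi k = 0.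
Proof. by case: n => [//|n]; exact: wstep_bad. Qed.

Lemma fnorm_fsubxx (A : field) xi : fnorm (fsub A A) xi = 0.
Proof. by rewrite /fnorm big1// => k _; rewrite /fsub subrr cmod0. Qed.

(** The first iterate is the free evolution, bounded by the first term of M_1. From there on fields
    and majorants follow parallel recursions and [wstep_compare] carries the domination along. *)
Lemma witer_dominatedS n : dominated (witer n.+1) (witer n) (Mn n.+1) (Mn n).
Proof.
elim: n => [|n IHn]; split => t xi.
- rewrite Mn_0 adde0 Mn_S /picard.
  apply: (@le_trans _ _ ((expR (- (kappa nu xi * t)))%:E * b xi)%E); last first.
    rewrite leeDl//; apply: duhamel_ge0 => s; apply: forcing_ge0 => //; last first.
      by move=> ? ?; rewrite Mn_0.
    exact: norm3_ge0.
  rewrite -EFinM lee_fin /fnorm mulr_sumr; apply: ler_sum => k _.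
  rewrite /fsub subr0 /witer/=.
  have [gf|ngf] := boolP (xi \in good_freq3); last first.
    by rewrite wstep_bad// cmod0 mulr_ge0 ?expR_ge0 ?cmod_ge0.
  rewrite wstep_good// (_ : cint _ _ _ = 0) ?subr0; last first.
    rewrite (_ : (fun _ => _) = cst 0); first exact: cint0.
    by apply/funext => s; rewrite forcing_diff0 mulr0.
  by rewrite cmodM cmod_real ger0_norm ?expR_ge0.
- by rewrite fnorm0 Mn_0.
- rewrite !Mn_S.
  exact: (wstep_compare w0 nu_gt0 mu_u mML ML0 t xi (witer_jfmeas n.+1)
    (witer_jfmeas n) (mMn n.+1) (mMn n) IHn (Mn_ML n.+1)).
- by have [_ _ _] := dominated_props IHn.
Qed.

Lemma witer_dominated n p : (n <= p)%N ->
  dominated (witer p) (witer n) (Mn p) (Mn n).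
Proof.
move=> /subnK <-; elim: (p - n)%N => [|q [IHq IHq2]].
  split => t xi; first by rewrite fnorm_fsubxx add0e.
  by have [_] := witer_dominatedS n.
split => // t xi; rewrite addSn.
have [h1 _] := witer_dominatedS (q + n).
apply: le_trans (h1 t xi); apply: le_trans (leeD2l _ (IHq t xi)).
rewrite addeA -EFinD; apply: leeD2r; rewrite lee_fin.
rewrite /fnorm -big_split/=; apply: ler_sum => k _.
rewrite -[leLHS](_ : cmod (fsub (witer (q + n).+1 t) (witer (q + n) t) xi k +
  fsub (witer (q + n) t) (witer n t) xi k) = _) ?cmodD_le//.
by rewrite /fsub addrA subrK.
Qed.

Lemma witer_norm_le n t xi : ((fnorm (witer n t) xi)%:E <= Mn n t xi)%E.
Proof. by have [_] := witer_dominated (leqnn n). Qed.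

(** A good frequency controls integrals over time only; the fixed point equation upgrades this to
    finiteness at each single t. *)
Lemma ML_finite t xi : good_freq3 xi -> (ML t xi < +oo)%E.
Proof.
move=> gf; rewrite -ML_fixpoint /picard; apply: lte_add_pinfty.
  by rewrite -EFinM ltry.
have fin := good_freq_fin measurable_sub3 mU U0 mML ML0 t gf.
have mtot := total_jmeas mu3 measurable_sub3 mU U0 mML ML0.
have tot0 := total_ge0 mu3 (@sub3 R) U0 ML0.
have c0 : (0 <= (2^-1 * norm3 xi)%:E)%E by rewrite lee_fin mulr_ge0// norm3_ge0.
have mE : measurable_fun [set: RT] (fun s => (expR (- (kappa nu xi * (t - s))))%:E).
  exact: measurable_decayB.
have mf := jmeas_sectionr xi (forcing_jmeas mu3 measurable_sub3 measurable_norm3 mU U0 mML ML0).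
have f0 := forcing_ge0 mu3 (@sub3 R) (@norm3_ge0 R) U0 ML0.
apply: (@le_lt_trans _ _ ((2^-1 * norm3 xi)%:E *
    \int[lam]_(s in `[0%R, t]) total mu3 (@sub3 R) U ML s xi)%E); last first.
  exact: lte_mul_pinfty.
rewrite -ge0_integralZl//; last first.
  by apply: measurable_funTS; exact: jmeas_sectionr mtot.
apply: ge0_le_integral => //.
- by move=> s _; apply: mule_ge0 => //; rewrite lee_fin expR_ge0.
- by apply: measurable_funTS; exact: emeasurable_funM.
- by apply: measurable_funTS; apply: measurable_funeM; exact: jmeas_sectionr mtot.
move=> s; rewrite /= in_itv/= => /andP[_ st].
apply: (@le_trans _ _ (1%:E * forcing mu3 (@sub3 R) (@norm3 R) U ML s xi)%E).
  by apply: lee_wpmul2r => //; rewrite lee_fin decay_le1 ?(kappa_nneg nu_gt0) ?subr_ge0.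
rewrite mul1e /forcing; apply: lee_wpmul2l => //.
by rewrite /total -addeA leeDl//; apply: adde_ge0 => //; exact: econv_ge0.
Qed.

(** At a good frequency the finite value of [ML] bounds the majorants, and [majorized_is_cvg]
    applies to real and imaginary parts; elsewhere all iterates vanish. *)
Lemma witer_cvg t xi k :
  cvgn (fun n => complex.Re (witer n t xi k)) /\
  cvgn (fun n => complex.Im (witer n t xi k)).
Proof.
have [gf|ngf] := boolP (xi \in good_freq3); last first.
  split; under eq_fun do rewrite witer_bad//; exact: is_cvg_cst.
have MLfin : ML t xi \is a fin_num by rewrite ge0_fin_numE// ML_finite// -[good_freq3 _]inE.
have Mnfin n : Mn n t xi \is a fin_num.
  rewrite ge0_fin_numE; last by apply: le_trans (witer_norm_le n t xi); rewrite lee_fin fnorm_ge0.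
  by apply: le_lt_trans (Mn_ML n t xi) _; rewrite ltey_eq MLfin.
have dom n p : (n <= p)%N ->
    fnorm (fsub (witer p t) (witer n t)) xi + fine (Mn n t xi) <= fine (Mn p t xi).
  move=> /witer_dominated[/(_ t xi)].
  by rewrite -(fineK (Mnfin n)) -(fineK (Mnfin p)) -EFinD lee_fin.
have bnd n : fine (Mn n t xi) <= fine (ML t xi) by exact: fine_le.
split; apply: (majorized_is_cvg _ bnd) => n p /dom; apply: le_trans; rewrite lerD2r;
  apply: le_trans (cmod_le_fnorm _ xi k).
  by apply: le_trans (cmod_Re _); rewrite /fsub ReB.
by apply: le_trans (cmod_Im _); rewrite /fsub ImB.
Qed.

Definition wlim t : field := fun xi k =>
  limn (fun n => complex.Re (witer n t xi k)) +i* limn (fun n => complex.Im (witer n t xi k)).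

Lemma wlim_jfmeas : jfmeas wlim.
Proof.
move=> k; split.
  apply: (@measurable_fun_cvg _ _ R _ (fun n p => complex.Re (witer n p.1 p.2 k))).
    by move=> n; exact: (proj1 (witer_jfmeas n k)).
  by move=> p _; exact: (proj1 (witer_cvg p.1 p.2 k)).
apply: (@measurable_fun_cvg _ _ R _ (fun n p => complex.Im (witer n p.1 p.2 k))).
  by move=> n; exact: (proj2 (witer_jfmeas n k)).
by move=> p _; exact: (proj2 (witer_cvg p.1 p.2 k)).
Qed.

Lemma wlim_dominated n : dominated wlim (witer n) ML (Mn n).
Proof.
split; last exact: witer_norm_le.
move=> t xi; have [->|MLoo] := eqVneq (ML t xi) +oo%E; first by rewrite leey.
have MLfin : ML t xi \is a fin_num by rewrite ge0_fin_numE// lt_neqAle MLoo leey.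
have Mnfin p : Mn p t xi \is a fin_num.
  rewrite ge0_fin_numE; last by apply: le_trans (witer_norm_le p t xi); rewrite lee_fin fnorm_ge0.
  by apply: le_lt_trans (Mn_ML p t xi) _; rewrite ltey_eq MLfin.
rewrite -(fineK (Mnfin n)) -(fineK MLfin) -EFinD lee_fin -lerBrDr.
have cv : (fun p => fnorm (fsub (witer p t) (witer n t)) xi) @ \oo -->
    fnorm (fsub (wlim t) (witer n t)) xi.
  apply: cvg_big => // [|k _]; first exact: add_continuous; apply: cmod_cvg; rewrite /fsub.
    under eq_fun do rewrite ReB; rewrite ReB; apply: cvgB; last exact: cvg_cst.
    exact: (proj1 (witer_cvg t xi k)).
  under eq_fun do rewrite ImB; rewrite ImB; apply: cvgB; last exact: cvg_cst.
  exact: (proj2 (witer_cvg t xi k)).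
rewrite -(cvg_lim _ cv)//; apply: limr_le; first by apply/cvg_ex; eexists; exact: cv.
exists n => // p /= np; have [/(_ t xi)] := witer_dominated np.
rewrite -(fineK (Mnfin n)) -(fineK (Mnfin p)) -EFinD lee_fin -lerBrDr => h _.
by apply: le_trans h _; rewrite lerD2r fine_le.
Qed.

Lemma wlim_norm_le t xi : ((fnorm (wlim t) xi)%:E <= ML t xi)%E.
Proof. by have [_ _ _] := dominated_props (wlim_dominated 0). Qed.

(** |w - step w| <= |w - w_(n+1)| + |step w - step w_n|. Each term is at most ML - M_(n+1), which
    tends to 0: the first by domination of the limit, the second by [wstep_compare] and the fixed
    point equation of ML. *)
Lemma wlim_fixpoint t xi k : wlim t xi k = step wlim t xi k.
Proof.
have [gf|ngf] := boolP (xi \in good_freq3); last first.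
  rewrite wstep_bad//; apply: complex_ext => /=;
    under eq_fun do rewrite witer_bad//; exact: lim_cst.
have gf' : good_freq3 xi by rewrite inE in gf.
have MLfin : ML t xi \is a fin_num by rewrite ge0_fin_numE// ML_finite.
apply/eqP; rewrite -subr_eq0; apply/eqP/cmod_eq0/le_anti; rewrite cmod_ge0 andbT.
have bound n : ((cmod (wlim t xi k - step wlim t xi k))%:E + (Mn n.+1 t xi + Mn n.+1 t xi) <=
    ML t xi + ML t xi)%E.
  have [/(_ t xi) h1 _] := wlim_dominated n.+1.
  have h2 := wstep_compare w0 nu_gt0 mu_u mML ML0 t xi wlim_jfmeas
    (witer_jfmeas n) mML (mMn n) (wlim_dominated n) (fun s xi => lexx _).
  rewrite ML_fixpoint -Mn_S in h2.
  apply: le_trans (leeD h1 h2).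
  rewrite addeACA -EFinD leeD2r// lee_fin.
  apply: le_trans (lerD (cmod_le_fnorm _ xi k) (cmod_le_fnorm _ xi k)).
  rewrite /fsub [X in _ <= _ + X]cmodB_sym; apply: le_trans (cmodD_le _ _).
  by rewrite addrA subrK.
have cv : (fun n => (cmod (wlim t xi k - step wlim t xi k))%:E +
    (Mn n.+1 t xi + Mn n.+1 t xi))%E @ \oo -->
    ((cmod (wlim t xi k - step wlim t xi k))%:E + (ML t xi + ML t xi))%E.
  have cM : (fun n => Mn n.+1 t xi) @ \oo --> ML t xi.
    by have := @Mn_cvg t xi; rewrite -(cvg_shiftS (fun n => Mn n t xi)).
  apply: cvgeD; [exact: fin_num_adde_defr|exact: cvg_cst|].
  by apply: cvgeD => //; rewrite fin_num_adde_defr.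
have : ((cmod (wlim t xi k - step wlim t xi k))%:E + (ML t xi + ML t xi) <=
    ML t xi + ML t xi)%E.
  rewrite -(cvg_lim _ cv)//; apply: lime_le; first by apply/cvg_ex; eexists; exact: cv.
  exact: nearW.
by rewrite -[leRHS]add0e leeD2rE ?fin_numD ?MLfin// lee_fin.
Qed.

End Iteration.

(** * The integrated equation *)

Section DuhamelReal.
Context {R : realType}.
Local Notation RT := (measurableTypeR R).
Local Notation lam := (@lebesgue_measure R).
Implicit Types (F G : RT -> RT) (k b t : R).

Lemma nneg_integrable (D : set RT) G : measurable D -> measurable_fun setT G ->
  (forall s, 0 <= G s) -> (\int[lam]_(s in D) (G s)%:E < +oo)%E ->
  lam.-integrable D (EFin \o G).
Proof.
move=> mD mG G0 fin; apply/integrableP; split.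
  by apply: measurable_funTS; exact/measurable_EFinP.
by under eq_integral => s _ do rewrite /= ger0_norm//.
Qed.

Lemma decay_integrable k F t r : 0 <= k -> r <= t ->
  lam.-integrable `[0%R, t] (EFin \o F) -> measurable_fun setT F ->
  lam.-integrable `[0%R, r] (EFin \o (fun s => expR (- (k * (r - s))) * F s)).
Proof.
move=> k0 rt intF mF.
have int' : lam.-integrable `[0%R, r] (EFin \o F).
  apply: integrableS intF => //; apply: subset_itvl; by rewrite bnd_simp.
have /integrableP[m' _] := int'.
apply: (le_integrable _ _ _ int') => //.
  apply/measurable_EFinP; apply: measurable_funM; last exact: measurable_funTS.
  by apply: measurable_funTS; apply/measurable_EFinP; exact: measurable_decayB.
move=> s; rewrite /= in_itv/= => /andP[_ sr].
rewrite lee_fin normrM ger0_norm ?expR_ge0// ler_piMl//.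
by rewrite decay_le1// subr_ge0.
Qed.

(** [duhamel_identity] brought back to real integrals; the bound y <= b + int G on [0, t] supplies
    the integrability of y. *)
Lemma duhamel_nneg_real k b G t :
  0 <= k -> 0 <= b -> 0 <= t -> measurable_fun setT G -> (forall s, 0 <= G s) ->
  (\int[lam]_(s in `[0%R, t]) (G s)%:E < +oo)%E ->
  let y r := expR (- (k * r)) * b + \int[lam]_(s in `[0%R, r]) (expR (- (k * (r - s))) * G s) in
  lam.-integrable `[0%R, t] (EFin \o y) /\
  y t + k * \int[lam]_(s in `[0%R, t]) y s = b + \int[lam]_(s in `[0%R, t]) G s.
Proof.
move=> k0 b0 t0 mG G0 fin y.
have mGE : measurable_fun setT (fun s => (G s)%:E) by exact/measurable_EFinP.
have GE0 s : (0 <= (G s)%:E)%E by rewrite lee_fin.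
have intG := nneg_integrable (measurable_itv _) mG G0 fin.
have yE r : r <= t -> (y r)%:E =
    ((expR (- (k * r)))%:E * b%:E + duhamel k (fun s => (G s)%:E) r)%E.
  move=> rt; rewrite /y EFinD EFinM; congr (_ + _)%E.
  rewrite /duhamel /Rintegral fineK//.
  exact: (integrable_fin_num _ (decay_integrable k0 rt intG mG)).
have y0 r : 0 <= y r.
  rewrite addr_ge0 ?mulr_ge0 ?expR_ge0//; apply: Rintegral_ge0 => s _.
  by rewrite mulr_ge0 ?expR_ge0.
have [c finc] : exists c, (\int[lam]_(s in `[0%R, t]) (G s)%:E)%E = c%:E.
  exists (fine (\int[lam]_(s in `[0%R, t]) (G s)%:E)%E); rewrite fineK//.
  exact: (integrable_fin_num _ intG).
have md : measurable_fun [set: RT] (duhamel k (fun s => (G s)%:E)).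
  apply: (@measurable_duhamel _ _ _ (cst k) id ((fun s => (G s)%:E) \o snd)) => //.
    exact: measurableT_comp.
  by move=> p; exact: GE0.
have mY : measurable_fun [set: RT]
    (fun r => (expR (- (k * r)))%:E * b%:E + duhamel k (fun s => (G s)%:E) r)%E.
  apply: emeasurable_funD => //; apply: emeasurable_funM => //.
  exact: (@measurable_decay _ _ _ (cst k)).
have eqY : (\int[lam]_(s in `[0%R, t]) (y s)%:E = \int[lam]_(s in `[0%R, t])
    ((expR (- (k * s)))%:E * b%:E + duhamel k (fun s => (G s)%:E) s))%E.
  by apply: eq_integral => s; rewrite inE/= in_itv/= => /andP[_ st]; exact: yE.
have yb r : 0 <= r -> r <= t -> (y r <= b + c)%R.
  move=> r0 rt; rewrite -lee_fin yE// EFinD; apply: leeD.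
    by rewrite -EFinM lee_fin ler_piMl// decay_le1.
  rewrite -finc; apply: (@le_trans _ _ (\int[lam]_(s in `[0%R, r]) (G s)%:E)%E).
    apply: ge0_le_integral => //.
    - by move=> s _; apply: mule_ge0 => //; rewrite lee_fin expR_ge0.
    - apply: measurable_funTS; apply: emeasurable_funM => //.
      exact: measurable_decayB.
    - exact: measurable_funTS.
    move=> s; rewrite /= in_itv/= => /andP[_ sr].
    by rewrite -EFinM lee_fin ler_piMl// decay_le1// subr_ge0.
  apply: ge0_subset_integral => //; first exact: measurable_funTS.
  by apply: subset_itvl; rewrite bnd_simp.
have my : measurable_fun (`[0%R, t] : set RT) (EFin \o y).
  apply: (eq_measurable_fun (fun r =>
    (expR (- (k * r)))%:E * b%:E + duhamel k (fun s => (G s)%:E) r)%E).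
    by move=> r; rewrite inE/= in_itv/= => /andP[_ rt]; rewrite yE.
  exact: measurable_funTS.
have bc0 : 0 <= b + c by apply: le_trans (y0 0) (yb _ (lexx _) t0).
have iy : lam.-integrable `[0%R, t] (EFin \o y).
  apply/integrableP; split => //.
  apply: (@le_lt_trans _ _ (\int[lam]_(s in `[0%R, t]) (b + c)%:E)%E).
    apply: ge0_le_integral => //; first exact: measurableT_comp.
    move=> s; rewrite /= in_itv/= => /andP[s0 st].
    by rewrite lee_fin ger0_norm// yb.
  by rewrite integral_cst//= lebesgue_measure_itv/=; case: ifP => _; rewrite -?EFinB -?EFinM ltry.
split => //.
have IG : (\int[lam]_(s in `[0%R, t]) (G s)%:E)%E = (\int[lam]_(s in `[0%R, t]) G s)%:E.
  by rewrite /Rintegral fineK//; exact: (integrable_fin_num _ intG).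
have IY : (\int[lam]_(s in `[0%R, t]) (y s)%:E)%E = (\int[lam]_(s in `[0%R, t]) y s)%:E.
  by rewrite /Rintegral fineK//; exact: (integrable_fin_num _ iy).
have b0' : (0 <= b%:E)%E by rewrite lee_fin.
have := duhamel_identity k0 t0 b0' mGE GE0.
by rewrite -eqY -yE// IY IG -EFinM -!EFinD => -[].
Qed.

Lemma subtract_balance k (p q p' q' c c' d d' : R) :
  p + k * p' = c + d -> q + k * q' = c' + d' ->
  p - q = c - c' - (k * (p' - q') + (d' - d)).
Proof. by move=> *; lra. Qed.

Lemma duhamel_real k b F t :
  0 <= k -> 0 <= t -> measurable_fun setT F ->
  (\int[lam]_(s in `[0%R, t]) `|F s|%:E < +oo)%E ->
  let y r := expR (- (k * r)) * b - \int[lam]_(s in `[0%R, r]) (expR (- (k * (r - s))) * F s) in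
  lam.-integrable `[0%R, t] (EFin \o y) /\
  y t = b - (k * \int[lam]_(s in `[0%R, t]) y s + \int[lam]_(s in `[0%R, t]) F s).
Proof.
move=> k0 t0 mF fin y.
pose Fp s := Num.max (F s) 0; pose Fn s := Num.max (- F s) 0.
have Fp0 s : 0 <= Fp s by rewrite le_max lexx orbT.
have Fn0 s : 0 <= Fn s by rewrite le_max lexx orbT.
have FE (x : R) : x = Num.max x 0 - Num.max (- x) 0.
  by have [x0|x0] := leP 0 x; [rewrite (max_idPr _) ?oppr_le0// subr0|rewrite max_l ?sub0r ?opprK// oppr_ge0 ltW].
have mFp : measurable_fun setT Fp by exact: measurable_maxr.
have mFn : measurable_fun setT Fn by apply: measurable_maxr => //; exact: measurable_funN.
have mF' : measurable_fun [set: RT] (fun s => `|F s|%:E).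
  by apply/measurable_EFinP; exact: measurableT_comp.
have finp : (\int[lam]_(s in `[0%R, t]) (Fp s)%:E < +oo)%E.
  apply: le_lt_trans fin; apply: ge0_le_integral => //.
  - by move=> s _; rewrite lee_fin.
  - by apply: measurable_funTS; exact/measurable_EFinP.
  - exact: measurable_funTS.
  by move=> s _; rewrite lee_fin ge_max ler_norm normr_ge0.
have finn : (\int[lam]_(s in `[0%R, t]) (Fn s)%:E < +oo)%E.
  apply: le_lt_trans fin; apply: ge0_le_integral => //.
  - by move=> s _; rewrite lee_fin.
  - by apply: measurable_funTS; exact/measurable_EFinP.
  - exact: measurable_funTS.
  by move=> s _; rewrite lee_fin ge_max normr_ge0 andbT -normrN ler_norm.
have b0 (x : R) : 0 <= Num.max x 0 by rewrite le_max lexx orbT.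
(* The forcing enters y with a minus sign, so the negative part of F goes with the positive part of
   b and conversely; this makes y the difference of two nonnegative Duhamel solutions. *)
pose y1 r := expR (- (k * r)) * Num.max b 0 +
  \int[lam]_(s in `[0%R, r]) (expR (- (k * (r - s))) * Fn s).
pose y2 r := expR (- (k * r)) * Num.max (- b) 0 +
  \int[lam]_(s in `[0%R, r]) (expR (- (k * (r - s))) * Fp s).
have [i1 e1] : lam.-integrable `[0%R, t] (EFin \o y1) /\
    y1 t + k * \int[lam]_(s in `[0%R, t]) y1 s =
    Num.max b 0 + \int[lam]_(s in `[0%R, t]) Fn s.
  exact: duhamel_nneg_real k0 (b0 b) t0 mFn Fn0 finn.
have [i2 e2] : lam.-integrable `[0%R, t] (EFin \o y2) /\
    y2 t + k * \int[lam]_(s in `[0%R, t]) y2 s =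
    Num.max (- b) 0 + \int[lam]_(s in `[0%R, t]) Fp s.
  exact: duhamel_nneg_real k0 (b0 (- b)) t0 mFp Fp0 finp.
have ip := nneg_integrable (measurable_itv _) mFp Fp0 finp.
have in_ := nneg_integrable (measurable_itv _) mFn Fn0 finn.
have mitv r : measurable (`[0%R, r] : set RT) by [].
have yE r : r <= t -> y r = y1 r - y2 r.
  move=> rt; rewrite /y /y1 /y2 [b in LHS]FE mulrBr.
  rewrite (_ : (\int[lam]_(s in `[0%R, r]) (expR (- (k * (r - s))) * F s))%R =
    (\int[lam]_(s in `[0%R, r]) (expR (- (k * (r - s))) * Fp s))%R -
    (\int[lam]_(s in `[0%R, r]) (expR (- (k * (r - s))) * Fn s))%R); first by ring.
  rewrite -(RintegralB (mitv r) (decay_integrable k0 rt ip mFp)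
    (decay_integrable k0 rt in_ mFn)).
  by apply: eq_Rintegral => s _; rewrite -mulrBr -FE.
have IF : (\int[lam]_(s in `[0%R, t]) F s)%R =
    (\int[lam]_(s in `[0%R, t]) Fp s)%R - (\int[lam]_(s in `[0%R, t]) Fn s)%R.
  by rewrite -(RintegralB (mitv t) ip in_); apply: eq_Rintegral => s _; exact: FE.
have Iy : (\int[lam]_(s in `[0%R, t]) y s)%R =
    (\int[lam]_(s in `[0%R, t]) y1 s)%R - (\int[lam]_(s in `[0%R, t]) y2 s)%R.
  rewrite -(RintegralB (mitv t) i1 i2); apply: eq_Rintegral => s.
  by rewrite inE/= in_itv/= => /andP[_ st]; exact: yE.
split.
  have i12 := integrableB (mitv t) i1 i2.
  apply: (eq_integrable (mitv t) _ _ _ i12).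
  by move=> s; rewrite inE/= in_itv/= => /andP[_ st]; rewrite yE// EFinB.
by rewrite yE// Iy IF (subtract_balance e1 e2) -FE.
Qed.

End DuhamelReal.

Section DuhamelComplex.
Context {R : realType}.
Local Open Scope complex_scope.
Local Notation RT := (measurableTypeR R).
Local Notation lam := (@lebesgue_measure R).

Lemma duhamel_complex (k t : R) (b : R[i]) (F y : RT -> R[i]) :
  0 <= k -> 0 <= t -> cmeas setT F ->
  (\int[lam]_(s in `[0%R, t]) (cmod (F s))%:E < +oo)%E ->
  (forall r, r <= t -> y r = (expR (- (k * r)))%:C * b -
     cint lam `[0%R, r] (fun s => (expR (- (k * (r - s))))%:C * F s)) ->
  [/\ lam.-integrable `[0%R, t] (EFin \o (fun s => complex.Re (y s))),
      lam.-integrable `[0%R, t] (EFin \o (fun s => complex.Im (y s))) &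
      y t = b - (k%:C * cint lam `[0%R, t] y + cint lam `[0%R, t] F)].
Proof.
move=> k0 t0 [mF1 mF2] fin yE.
have le_fin (h : RT -> RT) : measurable_fun setT h -> (forall s, `|h s| <= cmod (F s)) ->
    (\int[lam]_(s in `[0%R, t]) `|h s|%:E < +oo)%E.
  move=> mh hF; apply: le_lt_trans fin; apply: ge0_le_integral => //.
  - by apply/measurable_EFinP; apply: measurableT_comp => //; exact: measurable_funTS.
  - by apply: measurable_EFin_cmod; split; exact: measurable_funTS.
  by move=> s _; rewrite lee_fin.
pose z (h : R[i] -> R) r := expR (- (k * r)) * h b -
  \int[lam]_(s in `[0%R, r]) (expR (- (k * (r - s))) * h (F s)).
pose y1 := z (@complex.Re R); pose y2 := z (@complex.Im R).
have zE (h : R[i] -> R) : measurable_fun setT (fun s => h (F s) : RT) ->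
    (forall s, `|h (F s)| <= cmod (F s)) ->
    lam.-integrable `[0%R, t] (EFin \o z h) /\ z h t =
    h b - (k * \int[lam]_(s in `[0%R, t]) z h s + \int[lam]_(s in `[0%R, t]) h (F s)).
  by move=> mh hF; exact: (duhamel_real (h b) k0 t0 mh (le_fin _ mh hF)).
have [i1 e1] := zE _ mF1 (fun s => cmod_Re _).
have [i2 e2] := zE _ mF2 (fun s => cmod_Im _).
have mitv : measurable (`[0%R, t] : set RT) by [].
have y1E r : r <= t -> complex.Re (y r) = y1 r.
  move=> rt; rewrite yE// ReB Re_scale Re_cint /y1; congr (_ - _).
  by apply: eq_Rintegral => s _; rewrite Re_scale.
have y2E r : r <= t -> complex.Im (y r) = y2 r.
  move=> rt; rewrite yE// ImB Im_scale Im_cint /y2; congr (_ - _).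
  by apply: eq_Rintegral => s _; rewrite Im_scale.
split.
- apply: (eq_integrable mitv (EFin \o y1)) => // s.
  by rewrite inE/= in_itv/= => /andP[_ st]; rewrite y1E.
- apply: (eq_integrable mitv (EFin \o y2)) => // s.
  by rewrite inE/= in_itv/= => /andP[_ st]; rewrite y2E.
apply: complex_ext.
  rewrite y1E// [LHS]e1 [RHS]ReB [X in _ = _ - X]ReD Re_scale !Re_cint.
  congr (_ - (_ * _ + _)); apply: eq_Rintegral => s.
  by rewrite inE/= in_itv/= => /andP[_ st]; rewrite y1E.
rewrite y2E// [LHS]e2 [RHS]ImB [X in _ = _ - X]ImD Im_scale !Im_cint.
congr (_ - (_ * _ + _)); apply: eq_Rintegral => s.
by rewrite inE/= in_itv/= => /andP[_ st]; rewrite y2E.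
Qed.

End DuhamelComplex.

Section CintMore.
Context {R : realType} d (T : measurableType d) (mu : {measure set T -> \bar R}) (D : set T).
Hypothesis mD : measurable D.
Implicit Types f g : T -> R[i].

Lemma ae_eq_cint f g : cmeas D f -> cmeas D g ->
  {ae mu, forall x, D x -> f x = g x} -> cint mu D f = cint mu D g.
Proof.
move=> [f1 f2] [g1 g2] fg; apply: complex_ext; rewrite ?Re_cint ?Im_cint;
  congr fine; apply: ae_eq_integral => //; try exact/measurable_EFinP.
  by apply: filterS fg => x h Dx; rewrite /= h.
by apply: filterS fg => x h Dx; rewrite /= h.
Qed.

Lemma cintegrable_le f (h : T -> \bar R) : cmeas D f -> measurable_fun D h ->
  (forall x, D x -> ((cmod (f x))%:E <= h x)%E) -> (\int[mu]_(x in D) h x < +oo)%E ->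
  cintegrable mu D f.
Proof.
move=> mf mh fh fin; split => //; apply: le_lt_trans fin.
apply: ge0_le_integral => //.
- by move=> x _; rewrite lee_fin cmod_ge0.
- exact: measurable_EFin_cmod.
Qed.

Lemma cintegrableD f g : cintegrable mu D f -> cintegrable mu D g ->
  cintegrable mu D (fun x => f x + g x).
Proof.
move=> [mf ff] [mg gf]; have mcf := measurable_EFin_cmod mf.
have mcg := measurable_EFin_cmod mg.
apply: (cintegrable_le (h := fun x => (cmod (f x))%:E + (cmod (g x))%:E)%E).
- exact: cmeasD.
- exact: emeasurable_funD.
- by move=> x _; rewrite -EFinD lee_fin cmodD_le.
rewrite ge0_integralD//; last 2 first.
- by move=> x _; rewrite lee_fin cmod_ge0.
- by move=> x _; rewrite lee_fin cmod_ge0.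
exact: lte_add_pinfty.
Qed.

Lemma cintegrableZ (c : R) f : cintegrable mu D f ->
  cintegrable mu D (fun x => c%:C%C * f x).
Proof.
move=> [mf ff]; have mcf := measurable_EFin_cmod mf.
apply: (cintegrable_le (h := fun x => (`|c|%:E * (cmod (f x))%:E)%E)).
- by apply: cmeasM => //; exact: cmeas_cst.
- exact: measurable_funeM.
- by move=> x _; rewrite -EFinM lee_fin cmodM cmod_real.
rewrite ge0_integralZl//; first by apply: lte_mul_pinfty => //; rewrite lee_fin.
by move=> x _; rewrite lee_fin cmod_ge0.
Qed.

Lemma cint_sum n (c : 'I_n -> R) (g : 'I_n -> T -> R[i]) :
  (forall k, cintegrable mu D (g k)) ->
  cintegrable mu D (fun x => \sum_(k < n) (c k)%:C%C * g k x) /\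
  cint mu D (fun x => \sum_(k < n) (c k)%:C%C * g k x) =
  \sum_(k < n) (c k)%:C%C * cint mu D (g k).
Proof.
elim: n c g => [|n IHn] c g ig.
  rewrite big_ord0 (_ : (fun x => _) = fun=> 0); last first.
    by apply/funext => x; rewrite big_ord0.
  split; last exact: cint0.
  split; first exact: cmeas_cst.
  by rewrite integral0_eq ?ltry// => x _; rewrite cmod0.
rewrite big_ord_recl (_ : (fun x => _) = fun x => (c ord0)%:C%C * g ord0 x +
    \sum_(k < n) (c (lift ord0 k))%:C%C * g (lift ord0 k) x); last first.
  by apply/funext => x; rewrite big_ord_recl.
have [i1 e1] := IHn (c \o lift ord0) (fun k => g (lift ord0 k)) (fun k => ig _).
have i0 := cintegrableZ (c ord0) (ig ord0).
split; first exact: cintegrableD i0 i1.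
by rewrite cintD// cintZ// e1.
Qed.

Lemma cintegrable_of_ReIm f : mu.-integrable D (EFin \o (fun x => complex.Re (f x))) ->
  mu.-integrable D (EFin \o (fun x => complex.Im (f x))) -> cintegrable mu D f.
Proof.
move=> /integrableP[m1 f1] /integrableP[m2 f2].
apply: (cintegrable_le
  (h := fun x => (`|(complex.Re (f x))%:E| + `|(complex.Im (f x))%:E|)%E)).
- by split; exact/measurable_EFinP.
- by apply: emeasurable_funD; exact: measurableT_comp.
- by move=> x _; rewrite -EFinD lee_fin cmod_le_ReIm.
rewrite ge0_integralD//; first exact: lte_add_pinfty.
- exact: measurableT_comp.
- exact: measurableT_comp.
Qed.

End CintMore.

(** * Size and divergence of the nonlinearity *)

Section Nonlinearity.
Context {R : realType}.
Local Open Scope complex_scope.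
Local Notation RT := (measurableTypeR R).
Local Notation T3 := (RT * RT * RT)%type.
Implicit Types (xi : @R3 R) (A : @Field R).

Lemma NSnonlin0 xi k : NSnonlin (fun _ _ => 0 : R[i]) xi k = 0.
Proof.
rewrite /NSnonlin big1// => l _; rewrite big1 ?mulr0// => j _.
rewrite /Defs.conv (_ : (fun eta => _) = fun=> 0); first by rewrite cint0 mulr0.
by apply/funext => eta; rewrite mulr0.
Qed.

(** Comparison with the zero field. For xi away from 0 an infinite convolution makes the bound
    infinite, whereas at 0 the product of 0 and +oo would be 0. *)
Lemma NSnonlin_le A xi k : fmeas A -> 0 < norm3 xi ->
  ((cmod (NSnonlin A xi k))%:E <= (4^-1 * norm3 xi)%:E *
    econv mu3 (@sub3 R) (fun eta => (fnorm A eta)%:E) (fun eta => (fnorm A eta)%:E) xi)%E.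
Proof.
move=> mA xi0; set C := econv _ _ _ _ _.
have [Coo|Coo] := eqVneq C +oo%E.
  by rewrite Coo gt0_muley ?leey// lte_fin mulr_gt0.
have m0 : fmeas (fun _ _ => 0 : R[i]) by move=> j; exact: cmeas_cst.
have mm : measurable_fun [set: T3] (fun eta => (fnorm A eta)%:E).
  by apply/measurable_EFinP; exact: measurable_fnorm.
have := @NSnonlin_compare R A _ (fun eta => (fnorm A eta)%:E) (fun=> 0%E) xi mA m0 mm
  (measurable_cst _).
rewrite -/C; have -> : econv mu3 (@sub3 R) (fun=> 0%E) (fun=> 0%E) xi = 0%E.
  by rewrite /econv integral0_eq// => eta _; rewrite mul0e.
rewrite mule0 adde0 => /(_ _ _ _)/wrap[||//|].
- move=> eta; rewrite adde0 lee_fin /fsub; under [X in X <= _]eq_bigr do rewrite subr0.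
  exact: lexx.
- by move=> eta; rewrite fnorm0.
- by rewrite lt_neqAle Coo leey.
move=> h.
apply: le_trans h; rewrite lee_fin; under [X in _ <= X]eq_bigr do rewrite NSnonlin0 subr0.
by rewrite (bigD1 k)//= lerDl; apply: sumr_ge0 => i _; exact: cmod_ge0.
Qed.

(** The Leray matrix projects onto the orthogonal complement of xi; at xi = 0 all coordinates
    vanish. *)
Lemma coord_leray xi l : \sum_(k < 3) (Defs.coord xi k)%:C * leray xi k l = 0.
Proof.
rewrite /leray; under eq_bigr do rewrite -rmorphM.
rewrite -rmorph_sum/=; congr (_%:C).
under eq_bigr do rewrite mulrBr.
rewrite sumrB (bigD1 l)//= eqxx mulr1 big1 ?addr0; last first.
  by move=> k kl; rewrite (negbTE kl) mulr0.
have [xi0|xi0] := eqVneq (norm3 xi) 0.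
  have c0 k : Defs.coord xi k = 0.
    by apply/eqP; rewrite -normr_eq0 eq_le normr_ge0 andbT -xi0 coord_le_norm3.
  by rewrite c0 big1 ?subrr// => k _; rewrite c0 mul0r.
rewrite (_ : \sum_(k < 3) _ =
    (\sum_(k < 3) Defs.coord xi k ^+ 2) / norm3 xi ^+ 2 * Defs.coord xi l); last first.
  by rewrite !mulr_suml; apply: eq_bigr => k _; rewrite expr2; ring.
rewrite -[X in X / _]sqr_sqrtr; last by apply: sumr_ge0 => k _; exact: sqr_ge0.
by rewrite divff ?mul1r ?subrr// sqrf_eq0.
Qed.

Lemma coord_NSnonlin A xi : \sum_(k < 3) (Defs.coord xi k)%:C * NSnonlin A xi k = 0.
Proof.
rewrite /NSnonlin; under eq_bigr do rewrite mulr_sumr.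
rewrite exchange_big big1//= => l _; under eq_bigr do rewrite mulrA.
by rewrite -mulr_suml coord_leray mul0r.
Qed.

End Nonlinearity.

Section GoodTimes.
Context {R : realType} {d} {T : measurableType d}.
Context (mu : {sigma_finite_measure set T -> \bar R}) (sub : T -> T -> T).
Hypothesis msub : measurable_fun [set: T * T] (fun p => sub p.1 p.2).
Local Open Scope ereal_scope.
Local Notation RT := (measurableTypeR R).
Local Notation lam := (@lebesgue_measure R).
Context (U ML : RT -> T -> \bar R).
Hypothesis mU : jmeas U.
Hypothesis U0 : forall s x, 0 <= U s x.
Hypothesis mML : jmeas ML.
Hypothesis ML0 : nonneg ML.

(** At a good frequency [total] has a finite time integral, hence is finite at almost every time,
    and so are its summands. *)
Lemma good_time_ae x t : good_freq mu sub U ML x ->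
  {ae lam, forall s, `[0%R, t]%classic s -> good_time mu sub U ML (s, x)}.
Proof.
move=> gf; have fin := good_freq_fin msub mU U0 mML ML0 t gf.
have mtot := jmeas_sectionr x (total_jmeas mu msub mU U0 mML ML0).
have tot0 := total_ge0 mu sub U0 ML0.
have mitv : measurable (`[0%R, t] : set RT) by [].
have : lam.-integrable `[0%R, t] (fun s => total mu sub U ML s x).
  apply/integrableP; split; first exact: measurable_funTS.
  by under eq_integral do rewrite gee0_abs//.
move=> /(integrable_ae mitv); apply: filterS => s h Ds.
have {h} := h Ds; rewrite ge0_fin_numE// /total => h.
have q0 : 0 <= equad mu sub (U s) (ML s) x by exact: equad_ge0.
have e0 : 0 <= econv mu sub (U s) (U s) x by exact: econv_ge0.
have h' : equad mu sub (U s) (ML s) x + econv mu sub (U s) (U s) x < +oo.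
  by apply: le_lt_trans h; rewrite leeDl.
split; rewrite /=; apply: le_lt_trans h'; [by rewrite leeDr|by rewrite leeDl].
Qed.

Hypothesis mu_sub : forall (f : T -> \bar R) y, measurable_fun setT f ->
  (forall x, 0 <= f x) -> \int[mu]_x f (sub x y) = \int[mu]_x f x.

Lemma integral_econv_self (f : T -> \bar R) : measurable_fun setT f -> (forall x, 0 <= f x) ->
  \int[mu]_x econv mu sub f f x = \int[mu]_x f x * \int[mu]_x f x.
Proof. by move=> mf f0; rewrite integral_econv. Qed.

(* x <= 1 + x^2 *)
Lemma mass_finite (Ginf : R) t :
  \int[lam]_(s in `[0%R, t]) usq mu U s <= Ginf%:E ->
  \int[lam]_(s in `[0%R, t]) mass mu U s < +oo.
Proof.
move=> h.
have mm : measurable_fun [set: RT] (mass mu U) by exact: measurable_mass.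
have m0 s : 0 <= mass mu U s by exact: integral_ge0.
apply: (@le_lt_trans _ _ (\int[lam]_(s in `[0%R, t]) (1 + usq mu U s))).
  apply: ge0_le_integral => //.
  - exact: measurable_funTS.
  - by apply: measurable_funTS; apply: emeasurable_funD => //; exact: emeasurable_funM.
  move=> s _; rewrite /usq /=; case: (mass mu U s) (m0 s) => [r|//|//].
    by rewrite -EFinM -EFinD !lee_fin => r0; nra.
rewrite ge0_integralD//; last 2 first.
- by move=> s _; exact: mule_ge0.
- by apply: measurable_funTS; exact: emeasurable_funM.
apply: lte_add_pinfty; last exact: le_lt_trans h (ltry _).
by rewrite integral_cst//= lebesgue_measure_itv/=; case: ifP => _; rewrite -?EFinB -?EFinM ?mule0 ltry.
Qed.

End GoodTimes.

Section TimeIncrement.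
Context {R : realType}.
Local Notation RT := (measurableTypeR R).
Local Notation lam := (@lebesgue_measure R).

Lemma cint_increment (g : RT -> R[i]) (s t : R) : 0 <= s -> s <= t ->
  cintegrable lam `[0%R, t] g ->
  ((cmod (cint lam `[0%R, t] g - cint lam `[0%R, s] g))%:E <=
   2%:E * \int[lam]_(r in `[s, t]) (cmod (g r))%:E)%E.
Proof.
move=> s0 st ig; have mitv a b : measurable (`]a, b] : set RT) by [].
have mitv0 : measurable (`[0%R, t] : set RT) by [].
have [i1 i2] := cintegrable_ReIm mitv0 ig.
have mg : cmeas `]s, t]%classic g.
  have [[m1 m2] _] := ig.
  have sub : `]s, t]%classic `<=` (`[0%R, t]%classic : set RT).
    by move=> r /=; rewrite !in_itv/= => /andP[/ltW sr ->]; rewrite (le_trans s0 sr).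
  by split; [exact: measurable_funS m1|exact: measurable_funS m2].
rewrite (_ : _ - _ = cint lam `]s, t] g).
  apply: le_trans (cmod_cint_le lam (mitv s t) mg) _.
  rewrite integral_itv_obnd_cbnd//; exact: measurable_EFin_cmod.
have h0 : (BLeft 0 <= BRight s :> itv_bound R)%O by rewrite bnd_simp.
have h1 : (BRight s <= BRight t :> itv_bound R)%O by rewrite bnd_simp.
apply: complex_ext.
  by rewrite ReB !Re_cint -(Rintegral_itvB i1 h0 h1).
by rewrite ImB !Im_cint -(Rintegral_itvB i2 h0 h1).
Qed.

(** Absolute continuity of the integral. It is applied to [fine] of h cut off to [0, T], which
    agrees with h almost everywhere there, as h is integrable. *)
Lemma nneg_integral_small (h : RT -> \bar R) (T e : R) :
  measurable_fun setT h -> (forall s, 0 <= h s)%E ->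
  (\int[lam]_(s in `[0%R, T]) h s < +oo)%E -> 0 < e ->
  exists2 dl : R, 0 < dl & forall s t : R, 0 <= s -> s <= t -> t <= T -> t - s < dl ->
    (\int[lam]_(r in `[s, t]) h r < e%:E)%E.
Proof.
move=> mh h0 fin e0; have mitv a b : measurable (`[a, b] : set RT) by [].
have ih : lam.-integrable `[0%R, T] h.
  apply/integrableP; split; first exact: measurable_funTS.
  by under eq_integral do rewrite gee0_abs//.
have mf : measurable_fun [set: RT] (fun s => fine (h s) : RT).
  by apply: measurableT_comp => //; exact: fine_measurable.
have if_ : lam.-integrable `[0%R, T] (EFin \o (fun s => fine (h s))).
  apply: (le_integrable _ _ _ ih) => //.
    by apply: measurable_funTS; exact/measurable_EFinP.
  move=> s _ /=; case: (h s) (h0 s) => [r|//|//] _ /=; last by rewrite normr0 leey.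
  exact: lexx.
pose f := (fun s => fine (h s)) \_ `[0%R, T].
have ifT : lam.-integrable setT (EFin \o f).
  by rewrite /f -restrict_EFin; apply/integrable_restrict => //=; rewrite setTI.
have [dl [dl0 H]] := integral_normr_continuous ifT e0.
exists dl => // s t s0 st tT tsd.
have sub : `[s, t]%classic `<=` (`[0%R, T]%classic : set RT).
  by move=> r /=; rewrite !in_itv/= => /andP[sr rt]; rewrite (le_trans s0 sr) (le_trans rt tT).
have -> : (\int[lam]_(r in `[s, t]) h r = \int[lam]_(r in `[s, t]) `|f r|%:E)%E.
  apply: ae_eq_integral => //.
  - exact: measurable_funTS.
  - apply: measurable_funTS; apply/measurable_EFinP; apply: measurableT_comp => //.
    by apply/measurable_EFinP; have /integrableP[] := ifT.
  have := integrable_ae (mitv _ _) ih.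
  apply: (@filterS _ _ (ae_filter_ringOfSetsType lam)) => r hr /= Dr.
  rewrite /f patchE mem_set; last exact: sub.
  by rewrite ger0_norm ?fine_ge0// fineK// hr//; exact: sub.
have ifn : lam.-integrable `[s, t] (EFin \o (fun r => `|f r|)).
  have : lam.-integrable `[s, t] (EFin \o f) by exact: integrableS ifT.
  by move/integrable_abse.
have := H _ (mitv s t); rewrite /Rintegral -lte_fin fineK; last exact: integrable_fin_num ifn.
move=> ->//; apply: (@le_lt_trans _ _ (lam `[s, t]%classic)) => //.
by rewrite lebesgue_measure_itv/=; case: ifP => _; rewrite -?EFinB lte_fin.
Qed.

End TimeIncrement.

(** * Equation, divergence and time continuity of the perturbation *)

Section Solution.
Context {R : realType}.
Local Open Scope complex_scope.
Local Notation RT := (measurableTypeR R).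
Local Notation T3 := (RT * RT * RT)%type.
Local Notation field := (@Field R).
Local Notation lam := (@lebesgue_measure R).
Local Notation econv3 := (econv mu3 (@sub3 R)).
Local Notation equad3 := (equad mu3 (@sub3 R)).
Implicit Types (xi : @R3 R).
Context (nu : R) (u : R -> field) (w0 : field) (eps Ginf : R).
Hypothesis nu_gt0 : 0 < nu.
Hypothesis mu_u : jfmeas u.
Hypothesis mw0 : fmeas w0.
Local Notation U := (fnormE u).
Local Notation b := (fun xi : T3 => (fnorm w0 xi)%:E).
Hypothesis eps_def : (\int[mu3]_xi ((norm3 xi)^-1%:E * (fnorm w0 xi)%:E) = eps%:E)%E.
Hypothesis usq_le : forall t, (\int[lam]_(s in `[0%R, t]) usq mu3 U s <= Ginf%:E)%E.
Hypothesis small : eps * expR (2 / nu * Ginf) < nu / 8.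

Let mU : jmeas U. Proof. exact: fnormE_jmeas. Qed.
Let U0 : forall s xi, (0 <= U s xi)%E. Proof. exact: fnormE_ge0. Qed.
Let mb : measurable_fun [set: T3] b.
Proof. by apply/measurable_EFinP; exact: measurable_fnorm. Qed.
Let b0 : forall xi, (0 <= b xi)%E. Proof. by move=> xi; rewrite lee_fin fnorm_ge0. Qed.

Local Notation ML := (majlim mu3 (@sub3 R) (@norm3 R) nu U b).
Local Notation Mn := (majorant mu3 (@sub3 R) (@norm3 R) nu U b).

Definition perturbation : R -> field := wlim nu u w0 ML.
Local Notation w := perturbation.
Local Notation good_freq3 := (good_freq mu3 (@sub3 R) U ML).
Local Notation good_time3 := (good_time mu3 (@sub3 R) U ML).
Local Notation fd := (forcing_diff u ML w).

Let mML : jmeas ML.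
Proof. exact: (jmeas_majlim mu3 measurable_sub3 measurable_norm3 (@norm3_ge0 R) nu mU U0 mb b0). Qed.

Let ML0 : nonneg ML.
Proof. exact: (@majlim_ge0 _ _ _ mu3 _ _ measurable_sub3 measurable_norm3 (@norm3_ge0 R) nu _ _ mU U0 mb b0). Qed.

Let ML_fix t xi : picard mu3 (@sub3 R) (@norm3 R) nu U b ML t xi = ML t xi.
Proof. exact: (picard_majlim mu3 measurable_sub3 measurable_norm3 (@norm3_ge0 R) nu mU U0 mb b0). Qed.

Let mMn n : jmeas (Mn n).
Proof. exact: (jmeas_majorant mu3 measurable_sub3 measurable_norm3 (@norm3_ge0 R) nu mU U0 mb b0). Qed.

Let Mn_ML n t xi : (Mn n t xi <= ML t xi)%E.
Proof. exact: (majorant_le_majlim mu3 measurable_sub3 measurable_norm3 (@norm3_ge0 R) nu mU U0 mb b0). Qed.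

Let Mn_cvg t xi : (fun n => Mn n t xi) @ \oo --> ML t xi.
Proof. exact: (@majlim_cvg _ _ _ mu3 _ _ measurable_sub3 measurable_norm3 (@norm3_ge0 R) nu _ _ mU U0 mb b0 t xi). Qed.

Lemma perturbation_jfmeas : jfmeas w.
Proof.
exact: (wlim_jfmeas nu_gt0 mu_u mw0 mML ML0 ML_fix (fun _ _ => erefl) (fun _ _ _ => erefl)
  mMn Mn_ML).
Qed.

Lemma perturbation_le t xi : ((fnorm (w t) xi)%:E <= ML t xi)%E.
Proof.
exact: (wlim_norm_le nu_gt0 mu_u mw0 mML ML0 ML_fix (fun _ _ => erefl) (fun _ _ _ => erefl)
  mMn Mn_ML).
Qed.

Lemma perturbation_fixpoint t xi k : w t xi k = wstep nu u w0 ML w t xi k.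
Proof.
exact: (wlim_fixpoint nu_gt0 mu_u mw0 mML ML0 ML_fix (fun _ _ => erefl) (fun _ _ _ => erefl)
  mMn Mn_ML Mn_cvg).
Qed.

Lemma ML_energy t : 0 <= t ->
  (energy mu3 (@norm3 R) nu ML t <= (eps * expR (2 / nu * Ginf))%:E)%E.
Proof.
exact: (majlim_energy_le measurable_sub3 (@integral_sub3 R) measurable_norm3
  (@norm3_ge0 R) (@norm3_gt0_ae R) nu_gt0 mU U0 mb b0 eps_def usq_le small).
Qed.

Lemma forcing_finite t : 0 <= t -> (\int[lam]_(s in `[0%R, t])
  \int[mu3]_xi equad3 (U s) (ML s) xi < +oo)%E.
Proof.
exact: (majlim_forcing_finite measurable_sub3 (@integral_sub3 R) measurable_norm3
  (@norm3_ge0 R) (@norm3_gt0_ae R) nu_gt0 mU U0 mb b0 eps_def usq_le small).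
Qed.

(** Over frequencies [total] integrates to the integral of [equad] plus [usq] plus the mass of U,
    because a convolution square integrates to a square; each of the three has a finite time
    integral. *)
Lemma good_freq3_ae : {ae mu3, forall xi, good_freq3 xi}.
Proof.
apply: (good_freq_ae measurable_sub3 mU U0 mML ML0) => t t0.
have mq := equad_jmeas mu3 measurable_sub3 mU U0 mML ML0.
have mc := jmeas_econv mu3 measurable_sub3 mU mU U0 U0.
have q0 : nonneg (fun s xi => equad3 (U s) (ML s) xi).
  by move=> s xi; exact: equad_ge0.
have c0 : nonneg (fun s xi => econv3 (U s) (U s) xi).
  by move=> s xi; exact: econv_ge0.
rewrite (_ : (\int[lam]_(s in _) _ = \int[lam]_(s in `[0%R, t])
  (\int[mu3]_xi equad3 (U s) (ML s) xi + usq mu3 U s + mass mu3 U s))%E); last first.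
  apply: eq_integral => s _; rewrite /total.
  have mqs := jmeas_section s mq; have mcs := jmeas_section s mc.
  have mUs := jmeas_section s mU.
  rewrite ge0_integralD//.
  - rewrite ge0_integralD//.
      by rewrite (integral_econv_self measurable_sub3 (@integral_sub3 R)).
  - by move=> xi _; apply: adde_ge0; [exact: q0|exact: c0].
  - exact: emeasurable_funD.
have mI : measurable_fun [set: RT] (fun s => \int[mu3]_xi equad3 (U s) (ML s) xi)%E.
  exact: (measurable_mass mu3 mq q0).
have I0 s : (0 <= \int[mu3]_xi equad3 (U s) (ML s) xi)%E.
  by apply: integral_ge0 => xi _; exact: q0.
have mm : measurable_fun [set: RT] (mass mu3 U) by exact: measurable_mass.
have m0 s : (0 <= mass mu3 U s)%E by apply: integral_ge0 => xi _; exact: U0.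
have ms : measurable_fun [set: RT] (usq mu3 U) by exact: emeasurable_funM.
have s0 s : (0 <= usq mu3 U s)%E by exact: mule_ge0.
rewrite ge0_integralD//; last 3 first.
- by move=> s _; exact: adde_ge0.
- by apply: measurable_funTS; exact: emeasurable_funD.
- exact: measurable_funTS.
rewrite ge0_integralD//; last 2 first.
- exact: measurable_funTS.
- exact: measurable_funTS.
apply: lte_add_pinfty; last exact: (mass_finite mU U0 (usq_le t)).
by apply: lte_add_pinfty; [exact: forcing_finite|exact: le_lt_trans (usq_le t) (ltry _)].
Qed.

Let wML : forall (s : R) xi, ((fnorm (w s) xi)%:E <= ML s xi)%E := perturbation_le.
Let ML_refl : forall (s : RT) xi, (ML s xi <= ML s xi)%E := fun _ _ => lexx _.

Lemma fd_cmeas xi k : cmeas [set: RT] (fun s => fd s xi k).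
Proof. exact: (jfmeas_sectionr xi k (forcing_diff_jfmeas mu_u mML ML0 perturbation_jfmeas)). Qed.

Lemma fd_cintegrable t xi k : good_freq3 xi -> cintegrable lam `[0%R, t] (fun s => fd s xi k).
Proof.
exact: (forcing_diff_cintegrable mu_u mML ML0 t k perturbation_jfmeas mML wML ML_refl).
Qed.

Lemma perturbation_integrated t xi k : good_freq3 xi -> 0 <= t ->
  cintegrable lam `[0%R, t] (fun s => w s xi k) /\
  w t xi k = w0 xi k - ((kappa nu xi)%:C * cint lam `[0%R, t] (fun s => w s xi k) +
                        cint lam `[0%R, t] (fun s => fd s xi k)).
Proof.
move=> gf t0; have k0 := kappa_nneg nu_gt0 xi.
have wE r : r <= t -> w r xi k = (expR (- (kappa nu xi * r)))%:C * w0 xi k -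
    cint lam `[0%R, r] (fun s => (expR (- (kappa nu xi * (r - s))))%:C * fd s xi k).
  by move=> _; rewrite perturbation_fixpoint; apply: wstep_good; rewrite inE.
have [_ fin] := fd_cintegrable t k gf.
have [i1 i2 e] := duhamel_complex (y := fun s => w s xi k) k0 t0 (fd_cmeas xi k) fin wE.
by split => //; exact: cintegrable_of_ReIm.
Qed.

(** The equation assumed for u does not itself assert that its time integrand is integrable; this
    has to be known before the integrals in the equation of w can be added to it. *)
Lemma base_cintegrable t xi k : good_freq3 xi -> 0 < norm3 xi ->
  cintegrable lam `[0%R, t] (fun s => u s xi k) /\
  cintegrable lam `[0%R, t] (fun s => NSnonlin (u s) xi k).
Proof.
move=> gf xi0; have fin := good_freq_fin measurable_sub3 mU U0 mML ML0 t gf.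
have mtot := jmeas_sectionr xi (total_jmeas mu3 measurable_sub3 mU U0 mML ML0).
have tot0 := total_ge0 mu3 (@sub3 R) U0 ML0.
have mitv : measurable (`[0%R, t] : set RT) by [].
have q0 s : (0 <= equad3 (U s) (ML s) xi)%E by exact: equad_ge0.
have e0 s : (0 <= econv3 (U s) (U s) xi)%E by exact: econv_ge0.
have c0 : (0 <= (4^-1 * norm3 xi)%:E)%E by rewrite lee_fin mulr_ge0// norm3_ge0.
split.
  apply: (cintegrable_le mitv (h := fun s => total mu3 (@sub3 R) U ML s xi)) => //.
  - by have [m1 m2] := jfmeas_sectionr xi k mu_u; split; exact: measurable_funTS.
  - exact: measurable_funTS.
  move=> s _; rewrite /total; apply: (@le_trans _ _ (U s xi)).
    by rewrite lee_fin cmod_le_fnorm.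
  by rewrite leeDr//; exact: adde_ge0.
apply: (cintegrable_le mitv
  (h := fun s => (4^-1 * norm3 xi)%:E * total mu3 (@sub3 R) U ML s xi)%E) => //.
- have [m1 m2] := jfmeas_sectionr xi k (NSnonlin_jfmeas mu_u).
  by split; exact: measurable_funTS.
- by apply: measurable_funTS; exact: measurable_funeM.
- move=> s _; apply: le_trans (NSnonlin_le k (jfmeas_section s mu_u) xi0) _.
  apply: lee_wpmul2l => //; rewrite /total -addeA addeCA leeDl//.
  exact: adde_ge0.
rewrite ge0_integralZl//; first exact: lte_mul_pinfty.
exact: measurable_funTS.
Qed.

Lemma fnorm_fsubC (A B : field) xi : fnorm (fsub A B) xi = fnorm (fsub B A) xi.
Proof. by apply: eq_bigr => k _; rewrite /fsub cmodB_sym. Qed.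

Lemma subr_addACA (V : zmodType) (x y z t : V) : x - y + (z - t) = x + z - (y + t).
Proof. by rewrite opprD addrACA. Qed.

Lemma weighted_sum_diff0 n (c F G : 'I_n -> R[i]) (x y : R[i]) :
  \sum_(k < n) c k * F k = 0 -> \sum_(k < n) c k * G k = 0 ->
  \sum_(k < n) c k * (x * (y * (F k - G k))) = 0.
Proof.
move=> F0 G0; rewrite -[RHS](mulr0 x) -[in RHS](mulr0 y) -[in RHS](subrr (0 : R[i])).
rewrite -[in X in X - _]F0 -[in X in _ - X]G0 -sumrB !mulr_sumr.
by apply: eq_bigr => k _; rewrite -mulrBr mulrCA; congr (_ * _); rewrite mulrCA.
Qed.

Lemma weighted_sum0 n (c F : 'I_n -> R[i]) (x : R[i]) :
  \sum_(k < n) c k * F k = 0 -> \sum_(k < n) c k * (x * F k) = 0.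
Proof.
move=> F0; transitivity (x * \sum_(k < n) c k * F k); last by rewrite F0 mulr0.
by rewrite mulr_sumr; apply: eq_bigr => k _; rewrite mulrCA.
Qed.

Lemma sum_rearrange (k a c p n : R[i]) : k * (a + c) + p = k * a + n + (k * c + (p - n)).
Proof. by rewrite mulrDr addrACA [n + _]addrC subrK. Qed.

Lemma sum_integrated t xi k : good_freq3 xi -> 0 < norm3 xi -> 0 <= t ->
  cint lam `[0%R, t] (fun s => (kappa nu xi)%:C * fadd (u s) (w s) xi k +
    NSnonlin (fadd (u s) (w s)) xi k) =
  cint lam `[0%R, t] (fun s => (kappa nu xi)%:C * u s xi k + NSnonlin (u s) xi k) +
  ((kappa nu xi)%:C * cint lam `[0%R, t] (fun s => w s xi k) +
   cint lam `[0%R, t] (fun s => fd s xi k)).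
Proof.
move=> gf xi0 t0; have mitv : measurable (`[0%R, t] : set RT) by [].
have [iu iN] := base_cintegrable t k gf xi0.
have [iw _] := perturbation_integrated k gf t0.
have ifd := fd_cintegrable t k gf.
have k0 := kappa_nneg nu_gt0 xi.
have ikw := cintegrableZ mitv (kappa nu xi) iw; have iku := cintegrableZ mitv (kappa nu xi) iu.
rewrite -(cintZ mitv (kappa nu xi) iw) -(cintD mitv ikw ifd).
rewrite -(cintD mitv (cintegrableD mitv iku iN) (cintegrableD mitv ikw ifd)).
apply: (ae_eq_cint mitv).
- apply: cmeasD.
    have [m1 m2] : cmeas [set: RT] (fun s => (kappa nu xi)%:C * fadd (u s) (w s) xi k).
      apply: cmeasM; first exact: cmeas_cst.
      exact: (jfmeas_sectionr xi k (jfmeas_add mu_u perturbation_jfmeas)).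
    by split; exact: measurable_funTS.
  have [m1 m2] := jfmeas_sectionr xi k
    (NSnonlin_jfmeas (jfmeas_add mu_u perturbation_jfmeas)).
  by split; exact: measurable_funTS.
- exact: (proj1 (cintegrableD mitv (cintegrableD mitv iku iN) (cintegrableD mitv ikw ifd))).
(* The cut-off in [fd] is inactive at good times, that is, for almost every s in [0, t]. *)
have gta := good_time_ae measurable_sub3 mU U0 mML ML0 t gf.
apply: (@filterS _ _ (ae_filter_ringOfSetsType lam) _ _ _ gta) => s h Ds.
have gt : (s, xi) \in good_time3 by rewrite inE; exact: h.
rewrite (forcing_diff_good _ _ gt); exact: sum_rearrange.
Qed.

Lemma perturbed_equation (u0 : field) t xi k : good_freq3 xi -> 0 < norm3 xi -> 0 <= t ->
  u t xi k = u0 xi k - cint lam `[0%R, t]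
    (fun s => (kappa nu xi)%:C * u s xi k + NSnonlin (u s) xi k) ->
  fadd (u t) (w t) xi k = fadd u0 w0 xi k - cint lam `[0%R, t]
    (fun s => (kappa nu xi)%:C * fadd (u s) (w s) xi k + NSnonlin (fadd (u s) (w s)) xi k).
Proof.
move=> gf xi0 t0 ue; rewrite sum_integrated//.
have [_ we] := perturbation_integrated k gf t0.
by rewrite [LHS]/fadd ue we; exact: subr_addACA.
Qed.

(** In the Duhamel formula the exponentials are scalars and both nonlinearities are orthogonal to
    xi, so only the free evolution of w0 contributes. *)
Lemma perturbation_divfree t xi :
  \sum_(k < 3) (Defs.coord xi k)%:C * w0 xi k = 0 ->
  \sum_(k < 3) (Defs.coord xi k)%:C * w t xi k = 0.
Proof.
move=> w00; have [gf|ngf] := boolP (xi \in good_freq3); last first.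
  by rewrite big1// => k _; rewrite perturbation_fixpoint wstep_bad// mulr0.
have gf' : good_freq3 xi by rewrite inE in gf.
have mitv : measurable (`[0%R, t] : set RT) by [].
pose g k s := (expR (- (kappa nu xi * (t - s))))%:C * fd s xi k.
have ig k : cintegrable lam `[0%R, t] (g k).
  exact: (decay_forcing_cintegrable nu_gt0 mu_u mML ML0 t k perturbation_jfmeas mML wML ML_refl gf').
under eq_bigr do rewrite perturbation_fixpoint wstep_good// mulrBr.
rewrite sumrB; have [_ <-] := cint_sum mitv (Defs.coord xi) ig.
rewrite (_ : (fun s => _) = fun=> 0); last first.
  by apply/funext => s; apply: weighted_sum_diff0; exact: coord_NSnonlin.
by rewrite cint0 subr0; exact: weighted_sum0.
Qed.

(** Its integral over [s, t] bounds the increment of w weighted by 1 / |xi|. Away from xi = 0 it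
    equals 2 / |xi| times [forcing_rate], the 2 being that of [cmod_cint_le]. *)
Let rate (r : RT) xi : \bar R :=
  ((2 * nu)%:E * ((norm3 xi)%:E * ML r xi) + 2^-1%:E * equad3 (U r) (ML r) xi)%E.

Let mq : jmeas (fun s xi => equad3 (U s) (ML s) xi).
Proof. exact: (equad_jmeas mu3 measurable_sub3 mU U0 mML ML0). Qed.

Let q0 : nonneg (fun s xi => equad3 (U s) (ML s) xi).
Proof. by move=> s xi; exact: equad_ge0. Qed.

Let mh : jmeas (fun s xi => (norm3 xi)%:E * ML s xi)%E.
Proof. exact: (highnorm_integrand_jmeas measurable_norm3 mML). Qed.

Let h0 : nonneg (fun s xi => (norm3 xi)%:E * ML s xi)%E.
Proof. by move=> s xi; apply: mule_ge0 => //; rewrite lee_fin norm3_ge0. Qed.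

Let c1 : (0 <= (2 * nu)%:E)%E. Proof. by rewrite lee_fin mulr_ge0// ltW. Qed.
Let c2 : (0 <= 2^-1%:E :> \bar R)%E. Proof. by rewrite lee_fin. Qed.

Let rate_jmeas : jmeas rate.
Proof. by apply: emeasurable_funD; exact: measurable_funeM. Qed.

Let rate_ge0 : nonneg rate.
Proof. by move=> s xi; apply: adde_ge0; apply: mule_ge0. Qed.

Let forcing_rate (r : RT) xi : \bar R :=
  ((kappa nu xi)%:E * ML r xi + (4^-1 * norm3 xi)%:E * equad3 (U r) (ML r) xi)%E.

(** Up to sign, w(t) - w(s) is the integral over [s, t] of kappa w + [fd]. Here |w| is bounded by
    ML, and [fd] by the comparison with the zero field. *)
Lemma perturbation_increment s t xi : good_freq3 xi -> 0 <= s -> s <= t ->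
  ((fnorm (fsub (w t) (w s)) xi)%:E <= 2%:E * \int[lam]_(r in `[s, t]) forcing_rate r xi)%E.
Proof.
move=> gf s0 st; have t0 := le_trans s0 st.
have mitv : measurable (`[0%R, t] : set RT) by [].
have mitv' : measurable (`[0%R, s] : set RT) by [].
have mitvs : measurable (`[s, t] : set RT) by [].
pose g k r := (kappa nu xi)%:C * w r xi k + fd r xi k.
have gE k r : 0 <= r -> cintegrable lam `[0%R, r] (g k) /\
    w r xi k = w0 xi k - cint lam `[0%R, r] (g k).
  move=> r0; have mr : measurable (`[0%R, r] : set RT) by [].
  have [iw ->] := perturbation_integrated k gf r0.
  have ikw := cintegrableZ mr (kappa nu xi) iw; have ifd := fd_cintegrable r k gf.
  split; first exact: cintegrableD.
  by rewrite -(cintZ mr (kappa nu xi) iw) -(cintD mr ikw ifd).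
have mg k : cmeas [set: RT] (g k).
  apply: cmeasD; last exact: fd_cmeas.
  apply: cmeasM; first exact: cmeas_cst.
  exact: (jfmeas_sectionr xi k perturbation_jfmeas).
have mcg k : measurable_fun [set: RT] (fun r => (cmod (g k r))%:E).
  exact: measurable_EFin_cmod.
have step k : ((cmod (fsub (w t) (w s) xi k))%:E <=
    2%:E * \int[lam]_(r in `[s, t]) (cmod (g k r))%:E)%E.
  rewrite /fsub; have [it ->] := gE k t t0; have [_ ->] := gE k s s0.
  by rewrite subr_subr cmodB_sym; exact: cint_increment.
rewrite /fnorm -sumEFin; apply: (@le_trans _ _ (\sum_(k < 3)
    2%:E * \int[lam]_(r in `[s, t]) (cmod (g k r))%:E)%E).
  by apply: lee_sum => k _; exact: step.
rewrite -ge0_sume_distrr; last first.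
  by move=> k _; apply: integral_ge0 => r _; rewrite lee_fin cmod_ge0.
apply: lee_wpmul2l => //.
rewrite -ge0_integral_sum//; last 2 first.
- by move=> k; exact: measurable_funTS.
- by move=> k r _; rewrite lee_fin cmod_ge0.
apply: ge0_le_integral => //.
- by move=> r _; apply: sume_ge0 => k _; rewrite lee_fin cmod_ge0.
- by apply: measurable_funTS; exact: emeasurable_sum.
- apply: measurable_funTS; apply: emeasurable_funD; apply: measurable_funeM.
    exact: (jmeas_sectionr xi mML).
  exact: (jmeas_sectionr xi mq).
move=> r _; apply: (@le_trans _ _ ((kappa nu xi)%:E * (fnorm (w r) xi)%:E +
    (\sum_(k < 3) cmod (fd r xi k))%:E)%E).
  rewrite sumEFin -EFinM -EFinD lee_fin /fnorm mulr_sumr -big_split/=.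
  apply: ler_sum => k _; apply: le_trans (cmodD_le _ _) _.
  by rewrite cmodM cmod_real ger0_norm// kappa_nneg.
apply: leeD; first by apply: lee_wpmul2l => //; rewrite lee_fin kappa_nneg.
exact: (forcing_diff_bound mu_u mML r xi perturbation_jfmeas mML wML ML_refl).
Qed.

Lemma perturbation_lownorm_increment s t : 0 <= s -> s <= t ->
  (\int[mu3]_xi ((norm3 xi)^-1%:E * (fnorm (fsub (w t) (w s)) xi)%:E) <=
   \int[lam]_(r in `[s, t]) \int[mu3]_xi rate r xi)%E.
Proof.
move=> s0 st; rewrite -(@integral_time_swap _ _ _ mu3 rate s t rate_jmeas rate_ge0).
have mN : measurable_fun [set: T3] (fun xi => (norm3 xi)^-1 : RT).
  exact: (mrhoV measurable_norm3 (@norm3_ge0 R)).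
apply: ae_ge0_le_integral => //.
- by move=> xi _; rewrite -EFinM lee_fin mulr_ge0 ?invr_ge0 ?norm3_ge0 ?fnorm_ge0.
- apply: emeasurable_funM; first exact/measurable_EFinP.
  apply/measurable_EFinP; apply: measurable_fnorm; apply: fmeas_sub;
    exact: jfmeas_section perturbation_jfmeas.
- by move=> xi _; apply: integral_ge0 => r _; exact: rate_ge0.
- apply: (@measurable_fun_band_integral _ _ _ (cst s) (cst t)
    (fun p : T3 * RT => rate p.2 p.1)) => //.
  exact: (measurableT_comp rate_jmeas (@measurable_swap _ _ _ _)).
have := @norm3_gt0_ae R; apply: filterS2 good_freq3_ae => xi gf xi0 _.
have i0 : (0 <= (norm3 xi)^-1%:E)%E by rewrite lee_fin invr_ge0 norm3_ge0.
apply: le_trans (lee_wpmul2l i0 (perturbation_increment gf s0 st)) _.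
have fr0 r : (0 <= forcing_rate r xi)%E.
  apply: adde_ge0; apply: mule_ge0 => //; rewrite lee_fin.
    exact: kappa_nneg.
  by rewrite mulr_ge0// norm3_ge0.
have mfr : measurable_fun [set: RT] (fun r => forcing_rate r xi).
  apply: emeasurable_funD; apply: measurable_funeM.
    exact: (jmeas_sectionr xi mML).
  exact: (jmeas_sectionr xi mq).
rewrite muleA -EFinM -ge0_integralZl//; last 2 first.
- exact: measurable_funTS.
- by rewrite lee_fin mulr_ge0// invr_ge0 norm3_ge0.
rewrite le_eqVlt; apply/orP; left; apply/eqP; apply: eq_integral => r _.
rewrite /forcing_rate /rate ge0_muleDr//; last 2 first.
- by apply: mule_ge0 => //; rewrite lee_fin kappa_nneg.
- by apply: mule_ge0 => //; rewrite lee_fin mulr_ge0// norm3_ge0.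
rewrite !muleA -!EFinM; congr (_%:E * _ + _%:E * _)%E; rewrite /kappa; field;
  exact: lt0r_neq0.
Qed.

Lemma rate_finite t : 0 <= t ->
  (\int[lam]_(r in `[0%R, t]) \int[mu3]_xi rate r xi < +oo)%E.
Proof.
move=> t0; have mH := measurable_mass mu3 mh h0; have mQ := measurable_mass mu3 mq q0.
have H0 s : (0 <= mass mu3 (fun s xi => (norm3 xi)%:E * ML s xi)%E s)%E.
  by apply: integral_ge0 => xi _; exact: h0.
have Q0 s : (0 <= mass mu3 (fun s xi => equad3 (U s) (ML s) xi) s)%E.
  by apply: integral_ge0 => xi _; exact: q0.
rewrite (_ : (\int[lam]_(s in _) _ = \int[lam]_(s in `[0%R, t])
  ((2 * nu)%:E * highnorm mu3 (@norm3 R) ML s +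
   2^-1%:E * \int[mu3]_xi equad3 (U s) (ML s) xi))%E); last first.
  apply: eq_integral => s _; have mhs := jmeas_section s mh; have mqs := jmeas_section s mq.
  rewrite ge0_integralD//; last 4 first.
  - by move=> xi _; apply: mule_ge0 => //; exact: h0.
  - exact: measurable_funeM.
  - by move=> xi _; apply: mule_ge0 => //; exact: q0.
  - exact: measurable_funeM.
  by rewrite ge0_integralZl// ge0_integralZl.
rewrite ge0_integralD//; last 4 first.
- by move=> s _; apply: mule_ge0 => //; exact: H0.
- by apply: measurable_funTS; exact: measurable_funeM.
- by move=> s _; apply: mule_ge0 => //; exact: Q0.
- by apply: measurable_funTS; exact: measurable_funeM.
rewrite ge0_integralZl//; last 2 first.
- exact: measurable_funTS.
- by move=> s _; exact: H0.
rewrite ge0_integralZl//; last 2 first.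
- exact: measurable_funTS.
- by move=> s _; exact: Q0.
apply: lte_add_pinfty; last by apply: lte_mul_pinfty => //; exact: forcing_finite.
apply: lte_mul_pinfty => //.
exact: (@energy_highnorm_fin _ _ _ mu3 _ (@norm3_ge0 R) _ nu_gt0 _ _ _ ML0 (ML_energy t0)).
Qed.

(** The increment is bounded by the integral over the interval between s and t of a function that is
    integrable on [0, T]; absolute continuity makes dl uniform there. *)
Lemma perturbation_continuous (T e : R) : 0 <= T -> 0 < e ->
  exists2 dl : R, 0 < dl & forall s t, 0 <= s <= T -> 0 <= t <= T -> `|s - t| < dl ->
  (\int[mu3]_xi ((norm3 xi)^-1%:E * (fnorm (fsub (w s) (w t)) xi)%:E) < e%:E)%E.
Proof.
move=> T0 e0.
have [dl dl0 H] := nneg_integral_small (measurable_mass mu3 rate_jmeas rate_ge0)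
  (fun s => mass_ge0 mu3 s rate_ge0) (rate_finite T0) e0.
exists dl => // s t /andP[s0 sT] /andP[t0 tT].
have [st|/ltW ts] := leP s t.
  rewrite distrC ger0_norm ?subr_ge0// => h.
  apply: le_lt_trans (H s t s0 st tT h).
  under eq_integral do rewrite fnorm_fsubC.
  exact: perturbation_lownorm_increment.
rewrite ger0_norm ?subr_ge0// => h; apply: le_lt_trans (H t s t0 ts sT h).
exact: perturbation_lownorm_increment.
Qed.

Lemma perturbation_energy t : 0 <= t ->
  (energy mu3 (@norm3 R) nu (fnormE w) t <= (eps * expR (2 / nu * Ginf))%:E)%E.
Proof.
move=> t0; apply: le_trans (ML_energy t0); rewrite /energy.
have mw := fnormE_jmeas perturbation_jfmeas; have w_ge0 := @fnormE_ge0 R w.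
have i0 xi : (0 <= (norm3 xi)^-1%:E)%E by rewrite lee_fin invr_ge0 norm3_ge0.
have n0 xi : (0 <= (norm3 xi)%:E)%E by rewrite lee_fin norm3_ge0.
apply: leeD.
  apply: ge0_le_integral => //.
  - by move=> xi _; exact: mule_ge0.
  - exact: (jmeas_section t (lownorm_integrand_jmeas measurable_norm3 (@norm3_ge0 R) mw)).
  - exact: (jmeas_section t (lownorm_integrand_jmeas measurable_norm3 (@norm3_ge0 R) mML)).
  by move=> xi _; apply: lee_wpmul2l => //; exact: perturbation_le.
apply: lee_wpmul2l; first by rewrite lee_fin divr_ge0// ltW.
apply: ge0_le_integral => //.
- by move=> s _; apply: highnorm_ge0 => //; exact: norm3_ge0.
- by apply: measurable_funTS; apply: measurable_highnorm => //; exact: measurable_norm3.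
- by apply: measurable_funTS; apply: measurable_highnorm => //; exact: measurable_norm3.
move=> s _; apply: ge0_le_integral => //.
- by move=> xi _; exact: mule_ge0.
- exact: (jmeas_section s (highnorm_integrand_jmeas measurable_norm3 mw)).
- exact: (jmeas_section s (highnorm_integrand_jmeas measurable_norm3 mML)).
by move=> xi _; apply: lee_wpmul2l => //; exact: perturbation_le.
Qed.

End Solution.

(** * Stability *)

Section Glue.
Context {R : realType}.
Local Open Scope complex_scope.
Local Notation RT := (measurableTypeR R).
Local Notation T3 := (RT * RT * RT)%type.
Local Notation field := (@Field R).
Local Notation lam := (@lebesgue_measure R).
Implicit Types (f g : field) (xi : @R3 R) (i : int).

Lemma measurable_norm3Z i : measurable_fun [set: T3] (fun xi => norm3 xi ^ i : RT).
Proof.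
case: i => n; first exact: measurable_funX measurable_norm3.
(* In the remaining case the exponent is -(n+1), as [Negz] is shifted by one. *)
apply: (@mrhoV R _ _ (fun xi => norm3 xi ^+ n.+1)).
  exact: measurable_funX measurable_norm3.
by move=> xi; rewrite exprn_ge0 ?norm3_ge0.
Qed.

Lemma norm3Z_ge0 i xi : 0 <= norm3 xi ^ i.
Proof. by rewrite exprz_ge0 ?norm3_ge0. Qed.

Lemma XnormE i f : fmeas f ->
  (Xnorm i f = \int[mu3]_xi ((norm3 xi ^ i)%:E * (fnorm f xi)%:E))%E.
Proof.
move=> mf; rewrite /Xnorm.
rewrite -(@ge0_integral_sum _ _ _ mu3 setT measurableT _
  (fun k xi => (norm3 xi ^ i * cmod (f xi k))%:E)).
- apply: eq_integral => xi _; rewrite sumEFin -EFinM /fnorm mulr_sumr//.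
- move=> k; apply/measurable_EFinP; apply: measurable_funM.
    exact: measurable_norm3Z.
  exact: measurable_cmod.
- by move=> k xi _; rewrite lee_fin mulr_ge0 ?norm3Z_ge0 ?cmod_ge0.
Qed.

Lemma Xnorm_integrand_ge0 i f xi : (0 <= (norm3 xi ^ i)%:E * (fnorm f xi)%:E)%E.
Proof. by rewrite mule_ge0 ?lee_fin ?norm3Z_ge0 ?fnorm_ge0. Qed.

Lemma measurable_Xnorm_integrand i f : fmeas f ->
  measurable_fun [set: T3] (fun xi => (norm3 xi ^ i)%:E * (fnorm f xi)%:E)%E.
Proof.
move=> mf; apply: emeasurable_funM; apply/measurable_EFinP.
  exact: measurable_norm3Z.
exact: measurable_fnorm.
Qed.

Lemma Xnorm_ge0 i f : fmeas f -> (0 <= Xnorm i f)%E.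
Proof. by move=> mf; rewrite XnormE//; apply: integral_ge0 => xi _; exact: Xnorm_integrand_ge0. Qed.

Lemma Xnorm_le_add i f g h : fmeas f -> fmeas g -> fmeas h ->
  (forall xi, fnorm f xi <= fnorm g xi + fnorm h xi) ->
  (Xnorm i f <= Xnorm i g + Xnorm i h)%E.
Proof.
move=> mf mg mh fgh; rewrite !XnormE// -ge0_integralD//; last 4 first.
- by move=> xi _; exact: Xnorm_integrand_ge0.
- exact: measurable_Xnorm_integrand.
- by move=> xi _; exact: Xnorm_integrand_ge0.
- exact: measurable_Xnorm_integrand.
apply: ge0_le_integral => //.
- by move=> xi _; exact: Xnorm_integrand_ge0.
- exact: measurable_Xnorm_integrand.
- by apply: emeasurable_funD; exact: measurable_Xnorm_integrand.
move=> xi _; rewrite -!EFinM -EFinD lee_fin -mulrDr ler_wpM2l//.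
exact: norm3Z_ge0.
Qed.

Lemma InX_fmeas i f : InX i f -> fmeas f.
Proof. by case=> mf _ _ k; exact: mf k. Qed.

(** Local integrability follows from the norm, since 1 <= r / |xi| for almost every xi in the ball
    of radius r. *)
Lemma InXm1 f : fmeas f -> (Xnorm (-1) f < +oo)%E -> InX (-1) f.
Proof.
move=> mf fin; split => // k r r0.
have mr : measurable [set xi : T3 | norm3 xi < r].
  rewrite -[X in measurable X]setTI.
  exact: (measurable_fun_ltr measurable_norm3 (measurable_cst r)).
have mcf : measurable_fun [set: T3] (fun xi => (cmod (f xi k))%:E).
  by apply/measurable_EFinP; exact: measurable_cmod.
change (\int[mu3]_(xi in [set xi : T3 | (norm3 xi < r)%R]) (cmod (f xi k))%:E < +oo)%E.
apply: (@le_lt_trans _ _ (r%:E * Xnorm (-1) f)%E); last first.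
  by apply: lte_mul_pinfty => //; rewrite lee_fin ltW.
rewrite XnormE// -ge0_integralZl//; last 3 first.
- exact: measurable_Xnorm_integrand.
- by move=> xi _; exact: Xnorm_integrand_ge0.
- by rewrite lee_fin ltW.
have mG : measurable_fun [set: T3] (fun xi => r%:E * ((norm3 xi ^ (-1))%:E * (fnorm f xi)%:E))%E.
  by apply: measurable_funeM; exact: measurable_Xnorm_integrand.
have G0 xi : (0 <= r%:E * ((norm3 xi ^ (-1))%:E * (fnorm f xi)%:E))%E.
  by apply: mule_ge0; [rewrite lee_fin ltW|exact: Xnorm_integrand_ge0].
apply: (@le_trans _ _ (\int[mu3]_(xi in [set xi : T3 | (norm3 xi < r)%R])
    (r%:E * ((norm3 xi ^ (-1))%:E * (fnorm f xi)%:E)))%E); last first.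
  by apply: ge0_subset_integral.
apply: ae_ge0_le_integral => //.
- by move=> xi _; rewrite lee_fin cmod_ge0.
- exact: measurable_funTS.
- exact: measurable_funTS.
have := @norm3_gt0_ae R; apply: (@filterS _ _ (ae_filter_ringOfSetsType mu3)) => xi xi0 /= xir.
rewrite -!EFinM lee_fin exprN1 mulrA; apply: le_trans (cmod_le_fnorm f xi k) _.
by rewrite ler_peMl ?fnorm_ge0// ler_pdivlMr// mul1r ltW.
Qed.

Lemma fnorm_fadd_le f g xi : fnorm (fadd f g) xi <= fnorm f xi + fnorm g xi.
Proof.
rewrite /fnorm -big_split/=; apply: ler_sum => k _; exact: cmodD_le.
Qed.

Lemma fmeas_add f g : fmeas f -> fmeas g -> fmeas (fadd f g).
Proof. by move=> mf mg k; exact: cmeasD. Qed.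

(* Nothing is known about [u] at negative times. *)
Definition extend0 (u : R -> field) (s : R) : field :=
  if 0 <= s then u s else fun _ _ => 0.

Lemma extend0E u s : 0 <= s -> extend0 u s = u s.
Proof. by rewrite /extend0 => ->. Qed.

Lemma extend0_jfmeas u :
  (forall k, measurable_fun [set p : R * R3 | 0 <= p.1]
                  (fun p => complex.Re (u p.1 p.2 k)) /\
                measurable_fun [set p : R * R3 | 0 <= p.1]
                  (fun p => complex.Im (u p.1 p.2 k))) ->
  jfmeas (extend0 u).
Proof.
move=> mu_u k; have [m1 m2] := mu_u k.
have mD : measurable [set p : RT * T3 | (0 <= p.1)%R].
  rewrite -[X in measurable X]setTI.
  exact: (measurable_fun_ler (measurable_cst (0 : R)) measurable_fst).
have gen (h : R[i] -> R) : h 0 = 0 ->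
    measurable_fun [set p : RT * T3 | (0 <= p.1)%R] (fun p => h (u p.1 p.2 k) : RT) ->
    measurable_fun [set: RT * T3] (fun p => h (extend0 u p.1 p.2 k) : RT).
  move=> h0 mh; rewrite (_ : (fun p => _) =
      (fun p : RT * T3 => h (u p.1 p.2 k) : RT) \_ [set p : RT * T3 | (0 <= p.1)%R]).
    exact/(measurable_restrictT _ mD).
  apply/funext => -[s xi]; rewrite patchE /extend0/=.
  by have [s0|s0] := leP 0 s; [rewrite mem_set|rewrite memNset//= leNgt s0].
split; [exact: (gen (@complex.Re R) erefl)|exact: (gen (@complex.Im R) erefl)].
Qed.

End Glue.

Section Stability.
Context {R : realType}.
Local Open Scope complex_scope.
Local Notation RT := (measurableTypeR R).
Local Notation T3 := (RT * RT * RT)%type.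
Local Notation field := (@Field R).
Local Notation lam := (@lebesgue_measure R).
Implicit Types (xi : @R3 R).
Context (nu : R) (u : R -> field) (v0 : field) (eps Ginf : R).
Hypothesis nu_gt0 : 0 < nu.
Hypothesis u_sol : global_solution nu u (u 0).
Hypothesis v0_X : InX (-1) v0.
Hypothesis v0_div : divfree v0.
Hypothesis eps_def : Xnorm (-1) (fsub v0 (u 0)) = eps%:E.
Hypothesis Ginf_def :
  (\int[lam]_(s in `[0%R, +oo[) (Xnorm 0 (u s) * Xnorm 0 (u s)) = Ginf%:E)%E.
Hypothesis small : eps * expR (2 / nu * Ginf) < nu / 8.

Local Notation w0 := (fsub v0 (u 0)).
Local Notation u' := (extend0 u).
Local Notation w := (perturbation nu u' w0).

Let u_X t : 0 <= t -> InX (-1) (u t). Proof. by case: u_sol => h _ _ _ _ /h[]. Qed.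
Let mu_u : jfmeas u'. Proof. by case: u_sol => _ _ h _ _; exact: extend0_jfmeas. Qed.
Let mw0 : fmeas w0.
Proof. by apply: fmeas_sub; [exact: InX_fmeas v0_X|exact: InX_fmeas (u_X (lexx 0))]. Qed.

Let eps_int : (\int[mu3]_xi ((norm3 xi)^-1%:E * (fnorm w0 xi)%:E) = eps%:E)%E.
Proof.
by rewrite -eps_def XnormE//; apply: eq_integral => xi _; rewrite exprN1.
Qed.

Let usq_le t : (\int[lam]_(s in `[0%R, t]) usq mu3 (fnormE u') s <= Ginf%:E)%E.
Proof.
have mU : jmeas (fnormE u') by exact: fnormE_jmeas.
have mm := measurable_mass mu3 mU (@fnormE_ge0 R u').
have m0 s : (0 <= mass mu3 (fnormE u') s)%E by apply: mass_ge0; exact: fnormE_ge0.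
rewrite -Ginf_def.
apply: (@le_trans _ _ (\int[lam]_(s in `[0%R, +oo[) usq mu3 (fnormE u') s)%E).
  apply: ge0_subset_integral => //.
  - by apply: measurable_funTS; exact: emeasurable_funM.
  - by move=> s _; exact: mule_ge0.
  - by move=> s /=; rewrite !in_itv/= => /andP[-> _].
rewrite le_eqVlt; apply/orP; left; apply/eqP; apply: eq_integral => s.
rewrite inE/= in_itv/= andbT => s0.
have E0 : Xnorm 0 (u s) = mass mu3 (fnormE u') s.
  rewrite XnormE; last exact: InX_fmeas (u_X s0).
  by apply: eq_integral => xi _; rewrite expr0z mul1e /fnormE extend0E.
by rewrite /usq/= E0.
Qed.

Let mw : jfmeas w. Proof. exact: perturbation_jfmeas nu_gt0 mu_u mw0. Qed.

Let w_energy t : 0 <= t ->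
  (energy mu3 (@norm3 R) nu (fnormE w) t <= (eps * expR (2 / nu * Ginf))%:E)%E.
Proof. exact: (perturbation_energy nu_gt0 mu_u mw0 eps_int usq_le small). Qed.

Let Xm1_w (f : field) : fmeas f ->
  Xnorm (-1) f = (\int[mu3]_xi ((norm3 xi)^-1%:E * (fnorm f xi)%:E))%E.
Proof. by move=> mf; rewrite XnormE//; apply: eq_integral => xi _; rewrite exprN1. Qed.

Let X1E (g : R -> field) s : jfmeas g ->
  Xnorm 1 (g s) = highnorm mu3 (@norm3 R) (fnormE g) s.
Proof.
move=> mg; rewrite XnormE; last exact: jfmeas_section mg.
by apply: eq_integral => xi _; rewrite expr1z.
Qed.

Let low_w t : Xnorm (-1) (w t) = lownorm mu3 (@norm3 R) (fnormE w) t.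
Proof. by rewrite Xm1_w//; exact: jfmeas_section mw. Qed.

Let high_ge0 t : (0 <= (nu / 2)%:E *
  \int[lam]_(s in `[0%R, t]) highnorm mu3 (@norm3 R) (fnormE w) s)%E.
Proof.
apply: mule_ge0; first by rewrite lee_fin divr_ge0// ltW.
apply: integral_ge0 => s _; apply: highnorm_ge0; first exact: norm3_ge0.
exact: fnormE_ge0.
Qed.

Let low_fin t : 0 <= t -> (Xnorm (-1) (w t) < +oo)%E.
Proof.
move=> t0; rewrite low_w; apply: le_lt_trans (ltry _); apply: le_trans (w_energy t0).
by rewrite leeDl.
Qed.

Definition perturbed (t : R) : field := fadd (u' t) (w t).
Local Notation v := perturbed.

Let mv : jfmeas v. Proof. exact: jfmeas_add. Qed.

Let v_sub t : 0 <= t -> fsub (v t) (u t) = w t.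
Proof.
move=> t0; apply/funext => xi; apply/funext => k.
by rewrite /fsub /perturbed /fadd extend0E// addrC addKr.
Qed.

Lemma perturbed_bound t : 0 <= t ->
  (Xnorm (-1) (fsub (v t) (u t)) +
    (nu / 2)%:E * \int[lam]_(s in `[0%R, t]) Xnorm 1 (fsub (v s) (u s)) <=
   (eps * expR (2 / nu * Ginf))%:E)%E.
Proof.
move=> t0; rewrite v_sub// low_w; apply: le_trans (w_energy t0).
rewrite le_eqVlt; apply/orP; left; apply/eqP; congr (_ + _ * _)%E.
apply: eq_integral => s; rewrite inE/= in_itv/= => /andP[s0 _].
by rewrite v_sub// X1E.
Qed.

Lemma perturbed_X t : 0 <= t -> InX (-1) (v t).
Proof.
move=> t0; apply: InXm1; first exact: jfmeas_section mv.
have mut := jfmeas_section t mu_u; have mwt := jfmeas_section t mw.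
apply: le_lt_trans (Xnorm_le_add (-1) (fmeas_add mut mwt) mut mwt (fnorm_fadd_le _ _)) _.
apply: lte_add_pinfty; last exact: low_fin.
by rewrite extend0E//; have [] := u_X t0.
Qed.

Lemma perturbed_divfree t : 0 <= t -> divfree (v t).
Proof.
move=> t0; have [h _ _ _ _] := u_sol.
have d0 := proj2 (h 0 (lexx 0)); have dt := proj2 (h t t0).
have := v0_div; apply: (@filterS3 _ _ (ae_filter_ringOfSetsType mu3) _ _ _ _ _ d0 dt).
move=> xi e1 e2 e3; rewrite /perturbed /fadd; under eq_bigr do rewrite mulrDr.
rewrite big_split/= extend0E// e2 add0r; apply: perturbation_divfree => //.
by rewrite /fsub; under eq_bigr do rewrite mulrBr; rewrite sumrB e3 e1 subrr.
Qed.

Lemma perturbed_cont t : 0 <= t -> forall e : R, 0 < e ->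
  exists2 dl : R, 0 < dl & forall s, 0 <= s -> `|s - t| < dl ->
    (Xnorm (-1) (fsub (v s) (v t)) < e%:E)%E.
Proof.
move=> t0 e e0; have [_ h _ _ _] := u_sol.
have e20 : 0 < e / 2 by rewrite divr_gt0.
have [d1 d10 H1] := h t t0 _ e20.
have t10 : 0 <= t + 1 by rewrite addr_ge0.
have [d2 d20 H2] := perturbation_continuous nu_gt0 mu_u mw0 eps_int usq_le small t10 e20.
(* The bound 1 keeps s in [0, t + 1], the interval on which d2 was chosen. *)
exists (Num.min d1 (Num.min d2 1)); first by rewrite !lt_min d10 d20 ltr01.
move=> s s0; rewrite !lt_min => /and3P[st1 st2 st3].
have st : s <= t + 1 by move: st3; rewrite ltr_norml => /andP[_ ?]; lra.
have mus := jfmeas_section s mu_u; have mut := jfmeas_section t mu_u.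
have mws := jfmeas_section s mw; have mwt := jfmeas_section t mw.
apply: (@le_lt_trans _ _ (Xnorm (-1) (fsub (u' s) (u' t)) +
    Xnorm (-1) (fsub (w s) (w t)))%E).
  apply: Xnorm_le_add; [|exact: fmeas_sub|exact: fmeas_sub|].
    by apply: fmeas_sub; exact: fmeas_add.
  move=> xi; rewrite /fnorm -big_split/=; apply: ler_sum => k _.
  rewrite /fsub /perturbed /fadd opprD addrACA; exact: cmodD_le.
rewrite [e]splitr EFinD; apply: lteD; first by rewrite !extend0E//; exact: H1.
rewrite Xm1_w; last exact: fmeas_sub.
by apply: H2 => //; rewrite ?s0 ?t0//= lerDl.
Qed.

Lemma perturbed_X1 T : 0 <= T -> (\int[lam]_(s in `[0%R, T]) Xnorm 1 (v s) < +oo)%E.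
Proof.
move=> T0; have [_ _ _ h _] := u_sol.
have mX (g : R -> field) : jfmeas g -> measurable_fun [set: RT] (fun s => Xnorm 1 (g s)).
  move=> mg; rewrite (_ : (fun s => _) = highnorm mu3 (@norm3 R) (fnormE g)).
    by apply: measurable_highnorm; [exact: measurable_norm3|exact: norm3_ge0
      |exact: fnormE_jmeas|exact: fnormE_ge0].
  by apply/funext => s; exact: X1E.
have X0 (g : R -> field) s : jfmeas g -> (0 <= Xnorm 1 (g s))%E.
  by move=> mg; apply: Xnorm_ge0; exact: jfmeas_section mg.
apply: (@le_lt_trans _ _ (\int[lam]_(s in `[0%R, T]) (Xnorm 1 (u' s) + Xnorm 1 (w s)))%E).
  apply: ge0_le_integral => //.
  - by move=> s _; exact: X0.
  - by apply: measurable_funTS; exact: mX.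
  - by apply: measurable_funTS; apply: emeasurable_funD; exact: mX.
  move=> s _; have mus := jfmeas_section s mu_u; have mws := jfmeas_section s mw.
  exact: (Xnorm_le_add 1 (fmeas_add mus mws) mus mws (fnorm_fadd_le _ _)).
rewrite ge0_integralD//; last 4 first.
- by move=> s _; exact: X0.
- by apply: measurable_funTS; exact: mX.
- by move=> s _; exact: X0.
- by apply: measurable_funTS; exact: mX.
apply: lte_add_pinfty.
  apply: le_lt_trans (h T T0); rewrite le_eqVlt; apply/orP; left; apply/eqP.
  by apply: eq_integral => s; rewrite inE/= in_itv/= => /andP[s0 _]; rewrite extend0E.
under eq_integral do rewrite X1E//.
exact: (@energy_highnorm_fin _ _ _ mu3 _ (@norm3_ge0 R) _ nu_gt0 _ _ _ (@fnormE_ge0 R w)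
  (w_energy T0)).
Qed.

(** Three null sets are discarded: the exceptional set of the equation for u at time t, the bad
    frequencies and the zero frequency. *)
Lemma perturbed_integrated t : 0 <= t -> {ae mu3, forall xi, forall k,
  v t xi k = v0 xi k - cint lam `[0%R, t]
    (fun s => (nu * norm3 xi ^+ 2)%:C * v s xi k + NSnonlin (v s) xi k)}.
Proof.
move=> t0; have [_ _ _ _ h] := u_sol; have ue := h t t0.
have gf := good_freq3_ae nu_gt0 mu_u mw0 eps_int usq_le small.
have := @norm3_gt0_ae R; apply: (@filterS3 _ _ (ae_filter_ringOfSetsType mu3) _ _ _ _ _ ue gf).
move=> xi {}ue {}gf xi0 k.
have -> : v0 xi k = fadd (u 0) w0 xi k by rewrite /fadd /fsub addrC subrK.
apply: (perturbed_equation nu_gt0 mu_u mw0 gf xi0 t0).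
have cE : cint lam `[0%R, t] (fun s => (kappa nu xi)%:C * u s xi k + NSnonlin (u s) xi k) =
    cint lam `[0%R, t] (fun s => (kappa nu xi)%:C * u' s xi k + NSnonlin (u' s) xi k).
  apply: eq_cint => s; rewrite inE/= in_itv/= => /andP[s0 _].
  by have -> : u' s = u s by exact: extend0E.
have -> : u' t = u t by exact: extend0E.
by rewrite -cE; move: (ue k); rewrite /leb -/(kappa nu xi).
Qed.

Lemma perturbed_solution : global_solution nu v v0.
Proof.
split.
- by move=> t t0; split; [exact: perturbed_X|exact: perturbed_divfree].
- exact: perturbed_cont.
- by move=> k; have [m1 m2] := mv k; split; exact: measurable_funTS.
- exact: perturbed_X1.
- exact: perturbed_integrated.
Qed.

End Stability.

Theorem theorem1p4 (R : realType) (nu : R) (u : R -> @Field R) (v0 : @Field R) :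
  0 < nu ->
  global_solution nu u (u 0%R) ->
  InX (-1) v0 -> divfree v0 ->
  (Xnorm (-1) (fsub v0 (u 0%R)) <
     (nu / 8)%:E * expeR (- ((2 / nu)%:E *
        \int[leb]_(s in `[0%R, +oo[) (Xnorm 0 (u s) * Xnorm 0 (u s)))))%E ->
  exists v : R -> Field,
    global_solution nu v v0 /\
    forall t, 0 <= t ->
      (Xnorm (-1) (fsub (v t) (u t))
         + (nu / 2)%:E * \int[leb]_(s in `[0%R, t]) Xnorm 1 (fsub (v s) (u s))
       <= Xnorm (-1) (fsub v0 (u 0%R)) *
          expeR ((2 / nu)%:E *
            \int[leb]_(s in `[0%R, +oo[) (Xnorm 0 (u s) * Xnorm 0 (u s))))%E.
Proof.
move=> nu0 u_sol v0X v0div.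
set G := (\int[leb]_(s in _) _)%E; set E := Xnorm (-1) _ => small.
have u_X t : 0 <= t -> InX (-1) (u t) by case: u_sol => h _ _ _ _ /h[].
have mw0 : fmeas (fsub v0 (u 0)).
  by apply: fmeas_sub; [exact: InX_fmeas v0X|exact: InX_fmeas (u_X _ (lexx 0))].
have E0 : (0 <= E)%E by exact: Xnorm_ge0.
have G0 : (0 <= G)%E.
  apply: integral_ge0 => s; rewrite /= in_itv/= andbT => s0.
  by apply: mule_ge0; apply: Xnorm_ge0; exact: InX_fmeas (u_X _ s0).
have nu20 : 0 < 2 / nu by rewrite divr_gt0.
(* If G were infinite, the smallness condition would read E < 0, because [expeR] vanishes at -oo. *)
have [Ginf Gdef] : exists g, G = g%:E.
  case: G G0 small => [g _ _|_|//]; first by exists g.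
  by rewrite gt0_muley ?lte_fin//= mule0 ltNge E0.
have decayE : expeR (- ((2 / nu)%:E * G)) = (expR (- (2 / nu * Ginf)))%:E.
  by rewrite Gdef -EFinM.
rewrite decayE -EFinM in small.
have [eps epsdef] : exists e, E = e%:E.
  by case: E E0 small => [e _ _|_|//]; [exists e|rewrite ltNge leey].
(* Multiplied by the positive exponential, the hypothesis says that the final energy bound lies
   below the threshold nu/8. *)
have sm : eps * expR (2 / nu * Ginf) < nu / 8.
  by move: small; rewrite epsdef lte_fin expRN ltr_pdivlMr// expR_gt0.
have growthE : expeR ((2 / nu)%:E * G) = (expR (2 / nu * Ginf))%:E by rewrite Gdef -EFinM.
exists (perturbed nu u v0); split; first exact: (perturbed_solution nu0 u_sol v0X v0div epsdef Gdef sm).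
move=> t t0; rewrite epsdef growthE -EFinM.
exact: (perturbed_bound nu0 u_sol v0X epsdef Gdef sm).
Qed.
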